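(* Consider a canonical SCS with BS density function $\lambda(r)$, $r\ge 0$, and background noise power $\eta$. The tail probability of the SINR at the MS is $$\mathbb{P}(\{\mathrm{SINR}>\gamma\})=\begin{cases}\displaystyle\int_{\omega=-\infty}^{\infty}\Phi_{\frac1{\mathrm{SINR}}}(\omega)\left(\frac{1-\exp\left(-\frac{i\omega}{\gamma}\right)}{i\omega}\right)\frac{d\omega}{2\pi},&\gamma>0,\\ 1,&\gamma=0,\end{cases}$$ where $\Phi_{\frac1{\mathrm{SINR}}}(\omega)$ is the characteristic function of $\frac{1}{\mathrm{SINR}}$, given by $$\Phi_{\frac1{\mathrm{SINR}}}(\omega)=\mathbb{E}_{R_1}\left[\exp(i\omega\eta R_1)\times\Phi_{P_I|R_1}(\omega R_1|R_1)\right]=\mathbb{E}_{R_1}\left[\exp(i\omega\eta R_1)\exp\left(R_1\times\int_{u=1}^{\infty}\left(\exp\left(\frac{i\omega}{u}\right)-1\right)\lambda(uR_1)\,du\right)\right],$$ where $\mathbb{E}_{R_1}[\cdot]$ is the expectation with respect to the random variable $R_1$, which is the distance of the BS closest to the origin and has probability density function $f_{R_1}(r)=\lambda(r)\times e^{-\int_{s=0}^r\lambda(s)ds}$, $r\ge0$.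
   Context: A canonical SCS (shotgun cellular system) with BS density function $\lambda(r)$, $r\ge0$, is a one-dimensional system in which base stations (BSs) are placed according to a (possibly non-homogeneous) Poisson point process on $[0,\infty)$ with intensity function $\lambda$; every BS has unity transmission power and unity fading factor, and the path-loss model is $1/R$, so a BS at distance $R$ is received with power $R^{-1}$ at the mobile station (MS), which is located at the origin. Write $R_1\le R_2\le\cdots$ for the ordered distances of the BSs from the origin. The MS is served by the BS with the strongest received power, i.e. the closest one, and all other BSs contribute to the interference power $P_I=\sum_{k=2}^\infty R_k^{-1}$. The signal-to-interference-plus-noise ratio at the MS is $\mathrm{SINR}=\dfrac{R_1^{-1}}{\sum_{k=2}^\infty R_k^{-1}+\eta}$, where $\eta$ is the background noise power. The characteristic function of a random variable $X$ is $\Phi_X(\omega)=\mathbb{E}[e^{i\omega X}]$, and $\Phi_{P_I|R_1}(\cdot|R_1)$ is the conditional characteristic function of $P_I$ given $R_1$.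
   Formalization: The interference power P_I is assumed to be almost surely finite; otherwise (for example for constant λ) SINR = 0, so P(SINR > 0) = 1 fails and 1/SINR has no characteristic function. The integral over ω is the symmetric limit of integrals over [−A, A]. *)

(* Defs.v *)
From HB Require Import structures.
From mathcomp Require Import all_boot all_order all_algebra.
From mathcomp Require Import all_classical all_reals all_analysis.
From mathcomp Require Import complex.

Set Implicit Arguments.
Unset Strict Implicit.
Unset Printing Implicit Defensive.

Import Order.TTheory GRing.Theory Num.Theory.
Import numFieldNormedType.Exports.

Local Open Scope classical_set_scope.
Local Open Scope ring_scope.

Section complex_integral.
Context {R : realType}.

Definition cexp (z : R[i]) : R[i] :=
  (expR (complex.Re z))%:C%C *
  Complex (cos (complex.Im z)) (sin (complex.Im z)).

Definition Cintegral d (T : measurableType d) (mu : {measure set T -> \bar R})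
    (D : set T) (f : T -> R[i]) : R[i] :=
  Complex (\int[mu]_(x in D) complex.Re (f x))
          (\int[mu]_(x in D) complex.Im (f x)).

Definition Cexpectation d (T : measurableType d) (P : probability T R)
    (f : T -> R[i]) : R[i] := Cintegral P setT f.

Definition charfun d (T : measurableType d) (P : probability T R)
    (X : T -> R) (w : R) : R[i] :=
  Cexpectation P (fun x => cexp ('i%C * w%:C%C * (X x)%:C%C)).

(* The integral over the whole line is the symmetric improper integral
   lim_(A -> +oo) \int_[-A, A], as in Levy's inversion formula; the integrand
   need not be absolutely integrable. *)
Definition is_Cintegral_line (f : R -> R[i]) (l : R[i]) : Prop :=
  Cintegral lebesgue_measure `[- A, A] f @[A --> +oo%R] --> (l : R[i]^o).

End complex_integral.

Section conditional_law.
Context {R : realType} d (T : measurableType d) (P : probability T R).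

(* k is a regular conditional distribution of X given Y. *)
Definition conditional_law (X : T -> R) (Y : T -> R)
    (k : R.-pker (measurableTypeR R) ~> (measurableTypeR R)) : Prop :=
  forall A B : set (measurableTypeR R), measurable A -> measurable B ->
    P (X @^-1` A `&` Y @^-1` B) = (\int[P]_(x in Y @^-1` B) k (Y x) A)%E.

(* Phi_(X|Y)(w | y), where k is the conditional law of X given Y. *)
Definition cond_charfun
    (k : R.-pker (measurableTypeR R) ~> (measurableTypeR R)) (w y : R) : R[i] :=
  Cintegral (k y) setT
    (fun p : measurableTypeR R => cexp ('i%C * w%:C%C * p%:C%C)).

Definition has_density (Y : {RV P >-> R}) (f : R -> R) : Prop :=
  forall B : set (measurableTypeR R), measurable B ->
    distribution P Y B = (\int[lebesgue_measure]_(r in B) (f r)%:E)%E.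

End conditional_law.

Section shotgun_cellular_system.
Context {R : realType} d (T : measurableType d) (P : probability T R).
Implicit Types (lambda : R -> R) (dist : nat -> {RV P >-> R}).

Definition bs_density lambda : Prop :=
  (forall r, 0 <= r -> 0 <= lambda r) /\
  (forall r, 0 <= r ->
     lebesgue_measure.-integrable `[0, r] (EFin \o lambda)).

Definition mean_measure lambda (B : set R) : \bar R :=
  (\int[lebesgue_measure]_(r in B) (lambda r)%:E)%E.

Definition bs_count dist (B : set R) (x : T) : \bar R :=
  (\sum_(0 <= k <oo) \d_(dist k x) B)%E.

Definition count_event dist (B : set R) (n : nat) : set T :=
  [set x | bs_count dist B x = n%:R%:E].

Definition finite_mean lambda (B : set R) : Prop :=
  [/\ measurable B, B `<=` `[0, +oo[ & (mean_measure lambda B < +oo)%E].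

(* [poisson_pmf] is not used because poisson_pmf 0 n = 1 for every n. *)
Definition poisson_process lambda dist : Prop :=
  (forall (B : set R) (n : nat), finite_mean lambda B ->
     let m := fine (mean_measure lambda B) in
     P (count_event dist B n) = (m ^+ n / n`!%:R * expR (- m))%:E) /\
  (forall (p : nat) (B : 'I_p -> set R) (n : 'I_p -> nat),
     (forall i, finite_mean lambda (B i)) ->
     (forall i j, i != j -> B i `&` B j = set0) ->
     P (\bigcap_i count_event dist (B i) (n i)) =
       (\prod_i P (count_event dist (B i) (n i)))%E).

(* [dist k] is the distance R_(k+1) of the (k+1)-st closest base station.  The
   ordered enumeration is infinite, as it must be for lambda(r) exp(-\int_0^r
   lambda) to be a probability density: the total mass of lambda is then
   infinite. *)
Definition canonical_SCS lambda dist : Prop :=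
  [/\ bs_density lambda,
      {ae P, forall x, forall k, 0 <= dist k x <= dist k.+1 x} &
      poisson_process lambda dist].

(* P_I = \sum_(k >= 2) 1 / R_k, possibly +oo; [interference] is its real value,
   which is meaningful where the series converges. *)
Definition ext_interference dist (x : T) : \bar R :=
  (\sum_(1 <= k <oo) ((dist k x)^-1)%:E)%E.

Definition interference dist (x : T) : R := fine (ext_interference dist x).

Definition SINR (eta : R) dist (x : T) : R :=
  (dist 0%N x)^-1 / (interference dist x + eta).

(* f_(R_1), extended by 0 to the negative reals *)
Definition nearest_pdf lambda (r : R) : R :=
  if 0 <= r
  then lambda r * expR (- \int[lebesgue_measure]_(s in `[0, r]) lambda s)
  else 0.

End shotgun_cellular_system.

(* Main.v *)
(* 1/SINR = R_1 (P_I + eta), so the tail formula is Levy's inversion formula for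
   1/SINR on ]0, 1/gamma[; by the Dirichlet integral the symmetric integral over
   [-A, A] tends to P(X < c) + P(X = c) / 2 with X = 1/SINR and c = 1/gamma, and
   it remains to see that X has no atom.

   The laws of R_1 and of P_I given R_1 come from partitions of mesh tending
   to 0.  A cell of mass m contains two or more points with probability at most
   m^2, and the sum of m^2 over the cells of a bounded interval tends to 0.
   Outside such events, R_1 belongs to the cell ]a, b] if and only if [0, a]
   contains no point and ]a, b] contains one, and then P_I is the sum of 1/r over
   the points in ]b, +oo[, which is independent of the counts in [0, b] and has
   the characteristic function given by Campbell's formula.  The latter is proved
   in the same way, from the counts in the cells of ]b, M].

   No atom: suppose that ]0, b] contains a single point, which is then R_1, so
   that X = R_1 (S + eta) where S is the sum of 1/r over the points beyond b.
   When R_1 ranges over the successive cells of ]0, b], the value X = a confines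
   S to successive disjoint intervals, whose probabilities add up to at most 1;
   by independence the event has probability at most a multiple of the maximal
   mass of a cell. *)
Require Import Defs.
From HB Require Import structures.
From mathcomp Require Import all_boot all_order all_algebra.
From mathcomp Require Import all_classical all_reals all_analysis.
From mathcomp Require Import measurable_realfun complex ring lra.

Set Implicit Arguments.
Unset Strict Implicit.
Unset Printing Implicit Defensive.

Import Order.TTheory GRing.Theory Num.Theory.
Import numFieldNormedType.Exports.

Local Open Scope classical_set_scope.
Local Open Scope ring_scope.
Local Open Scope complex_scope.

(** * Bounds on the complex exponential *)

(** The process is known only through its counts on finitely many disjoint sets, so independence
    between sigma-algebras is not at hand. Every formula about the points beyond [b] therefore
    carries an arbitrary event [cev s] prescribing counts inside [0, b], and independence appears as
    the factor [pr (cev s)]. For the absence of atoms this factorization is obtained for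
    characteristic functions and transferred to intervals by a second use of Levy inversion.
    Exponents on half-lines need lambda(r)/r to be integrable at infinity, whereas the hypothesis
    only says that the interference is almost surely finite. The integrability is extracted from
    Campbell's formula itself, at the real argument -1; this is why the formulas are proved for all
    complex z with Re z <= 0 and not only on the imaginary axis. Functions of R_1 are compared after
    R_1 has been rounded up to the right end of its cell, so continuity in R_1 is needed only from
    the right. This suits integrals over ]r, +oo[, whose domains then grow to their limit and stay
    inside it. *)

Section elementary_bounds.
Context {R : realType}.
Implicit Types x y m : R.

(** Mean value theorem between 0 and [y], with oddness for negative [y]. The location of [c] is
    kept, and not only the bound on its cosine, because it yields the quadratic bound on [sin y - y]
    below. *)
Lemma sin_eq_mul_cos y : exists2 c : R, `|c| <= `|y| & sin y = cos c * y.
Proof.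
have pos t : 0 <= t -> exists2 c : R, `|c| <= `|t| & sin t = cos c * t.
  move=> t0; have [c] := @MVT_segment R sin cos 0 t t0
    (fun c _ => is_derive_sin c) (continuous_subspaceT (@continuous_sin R)).
  rewrite in_itv/= => /andP[c0 ct]; rewrite sin0 !subr0 => ->.
  by exists c => //; rewrite !ger0_norm.
have [y0|/ltW y0] := leP 0 y; first exact: pos.
have [|c cy sE] := pos (- y); first by rewrite oppr_ge0.
exists c; first by rewrite -(normrN y).
by apply: oppr_inj; rewrite -sinN sE mulrN.
Qed.

Lemma ler_norm_sin y : `|sin y| <= `|y|.
Proof.
have [c _ ->] := sin_eq_mul_cos y.
by rewrite normrM ler_piMl// cos_max.
Qed.

Lemma oneBcosE y : 1 - cos y = 2 * sin (y / 2) ^+ 2.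
Proof.
have e : y = (y / 2) *+ 2 by rewrite mulr2n -splitr.
by rewrite [in LHS]e cos_mulr2n cos2sin2 !mulr2n; ring.
Qed.

Lemma oneBcos_ge0 y : 0 <= 1 - cos y.
Proof. by rewrite subr_ge0 cos_le1. Qed.

Lemma ler_oneBcos_sqr y : 1 - cos y <= y ^+ 2.
Proof.
rewrite oneBcosE.
have : sin (y / 2) ^+ 2 <= (y / 2) ^+ 2 by rewrite -ler_sqrt ?sqr_ge0// !sqrtr_sqr ler_norm_sin.
have := sqr_ge0 y; rewrite exprMn; set s := sin _ ^+ 2; rewrite exprVn; lra.
Qed.

Lemma ler_norm_oneBcos y : `|1 - cos y| <= `|y|.
Proof.
rewrite ger0_norm ?oneBcos_ge0// oneBcosE.
have h := ler_norm_sin (y / 2); have h1 := sin_max (y / 2).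
have -> : sin (y / 2) ^+ 2 = `|sin (y / 2)| * `|sin (y / 2)|.
  by rewrite -normrM -expr2 ger0_norm ?sqr_ge0.
have e : `|y / 2| = `|y| / 2 by rewrite normrM [X in _ * X]ger0_norm.
rewrite e in h; have h0 := normr_ge0 (sin (y / 2)).
apply: (@le_trans _ _ (2 * (`|y| / 2 * 1))); last by lra.
by rewrite ler_wpM2l// ler_pM.
Qed.

Lemma ler_norm_sinB y : `|sin y - y| <= y ^+ 2.
Proof.
have [c cy ->] := sin_eq_mul_cos y.
have -> : cos c * y - y = - ((1 - cos c) * y) by ring.
rewrite normrN normrM -[y ^+ 2]ger0_norm ?sqr_ge0// expr2 normrM.
by rewrite ler_wpM2r// (le_trans (ler_norm_oneBcos _)).
Qed.

(** Multiply 1 - x <= exp(-x) by exp(x). *)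
Lemma expRB1_le x : expR x - 1 <= x * expR x.
Proof.
have := ler_wpM2l (expR_ge0 x) (expR_ge1Dx (- x)).
by rewrite expRxMexpNx_1; lra.
Qed.

Lemma ler_norm_expRB1 x m : `|x| <= m -> `|expR x - 1| <= m * expR m.
Proof.
move=> xm; have m0 : 0 <= m := le_trans (normr_ge0 _) xm.
have e1 : 1 <= expR m by rewrite -expR0 ler_expR.
have me : m <= m * expR m by rewrite ler_peMr.
move: xm; rewrite ler_norml => /andP[mx xm]; rewrite ler_norml; apply/andP; split.
  have := expR_ge1Dx x; lra.
apply: (le_trans (expRB1_le x)).
apply: (@le_trans _ _ (m * expR x)); first by rewrite ler_wpM2r ?expR_ge0.
by rewrite ler_wpM2l// ler_expR.
Qed.

Lemma ler_norm_expRB1B x m : `|x| <= m -> `|expR x - 1 - x| <= m ^+ 2 * expR m.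
Proof.
move=> xm; rewrite ger0_norm; last by have := expR_ge1Dx x; lra.
apply: (@le_trans _ _ (x * (expR x - 1))); first by have := expRB1_le x; lra.
apply: (le_trans (ler_norm _)); rewrite normrM expr2 -mulrA.
by rewrite ler_pM// ler_norm_expRB1.
Qed.

Lemma ler_norm_expRB1_npos x : x <= 0 -> `|expR x - 1| <= `|x|.
Proof.
move=> x0; have e1 : expR x <= 1 by rewrite -expR0 ler_expR.
rewrite (ler0_norm x0) ler0_norm ?subr_le0//.
by have := expR_ge1Dx x; lra.
Qed.

End elementary_bounds.

Section complex_norm.
Context {R : realType}.
Implicit Types z w : R[i].
Import Normc.

Lemma cReD z w : complex.Re (z + w) = complex.Re z + complex.Re w.
Proof. by case: z w => [? ?] [? ?]. Qed.
Lemma cImD z w : complex.Im (z + w) = complex.Im z + complex.Im w.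
Proof. by case: z w => [? ?] [? ?]. Qed.
Lemma cReN z : complex.Re (- z) = - complex.Re z. Proof. by case: z. Qed.
Lemma cImN z : complex.Im (- z) = - complex.Im z. Proof. by case: z. Qed.
Lemma cReB z w : complex.Re (z - w) = complex.Re z - complex.Re w.
Proof. by rewrite cReD cReN. Qed.
Lemma cImB z w : complex.Im (z - w) = complex.Im z - complex.Im w.
Proof. by rewrite cImD cImN. Qed.
Lemma cReM z w : complex.Re (z * w) =
  complex.Re z * complex.Re w - complex.Im z * complex.Im w.
Proof. by case: z w => [? ?] [? ?]. Qed.
Lemma cImM z w : complex.Im (z * w) =
  complex.Re z * complex.Im w + complex.Im z * complex.Re w.
Proof. by case: z w => [? ?] [? ?]. Qed.

Lemma complex_ext z w :
  complex.Re z = complex.Re w -> complex.Im z = complex.Im w -> z = w.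
Proof. by case: z w => [? ?] [? ?] /= -> ->. Qed.

Lemma normc_ge0 z : 0 <= normc z.
Proof. by case: z => a b; exact: sqrtr_ge0. Qed.

Lemma normcN z : normc (- z) = normc z.
Proof. by case: z => a b /=; rewrite !sqrrN. Qed.

Lemma normc_real (x : R) : normc x%:C = `|x|.
Proof. by rewrite /= expr0n/= addr0 sqrtr_sqr. Qed.

Lemma ler_normcD z w : normc (z + w) <= normc z + normc w.
Proof. by rewrite -lecR rmorphD/=; exact: (ler_normD z w). Qed.

Lemma ler_normcB z w : normc (z - w) <= normc z + normc w.
Proof. by rewrite (le_trans (ler_normcD _ _))// normcN. Qed.

Lemma normcBC z w : normc (z - w) = normc (w - z).
Proof. by rewrite -opprB normcN. Qed.

Lemma ler_norm_Re z : `|complex.Re z| <= normc z.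
Proof.
case: z => a b /=; rewrite -sqrtr_sqr ler_wsqrtr// lerDl sqr_ge0 //.
Qed.

Lemma ler_norm_Im z : `|complex.Im z| <= normc z.
Proof.
case: z => a b /=; rewrite -sqrtr_sqr ler_wsqrtr// lerDr sqr_ge0 //.
Qed.

Lemma ler_normc z : normc z <= `|complex.Re z| + `|complex.Im z|.
Proof.
case: z => a b /=; rewrite -[leRHS]ger0_norm ?addr_ge0// -sqrtr_sqr ler_wsqrtr//.
rewrite sqrrD !real_normK ?num_real// -addrA lerD2l lerDr.
by rewrite mulrn_wge0// mulr_ge0.
Qed.

End complex_norm.

Section cexp_theory.
Context {R : realType}.
Implicit Types z w : R[i].
Import Normc.

Lemma Re_cexp z : complex.Re (cexp z) = expR (complex.Re z) * cos (complex.Im z).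
Proof. by rewrite /cexp cReM/= mul0r subr0. Qed.

Lemma Im_cexp z : complex.Im (cexp z) = expR (complex.Re z) * sin (complex.Im z).
Proof. by rewrite /cexp cImM/= mul0r addr0. Qed.

Lemma cexp0 : cexp (0 : R[i]) = 1.
Proof. by apply: complex_ext; rewrite ?Re_cexp ?Im_cexp/= expR0 ?cos0 ?sin0 mul1r. Qed.

Lemma cexpD z w : cexp (z + w) = cexp z * cexp w.
Proof.
apply: complex_ext.
  by rewrite [RHS]cReM !Re_cexp !Im_cexp cReD cImD expRD cosD; ring.
by rewrite [RHS]cImM !Re_cexp !Im_cexp cReD cImD expRD sinD; ring.
Qed.

Lemma normc_cexp z : normc (cexp z) = expR (complex.Re z).
Proof.
rewrite /cexp normcM normc_real ger0_norm ?expR_ge0//= cos2Dsin2 sqrtr1 mulr1 //.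
Qed.

Lemma normc_cexp_le1 z : complex.Re z <= 0 -> normc (cexp z) <= 1.
Proof. by move=> z0; rewrite normc_cexp -expR0 ler_expR. Qed.

Lemma cexp_real (x : R) : cexp x%:C = (expR x)%:C.
Proof. by apply: complex_ext; rewrite ?Re_cexp ?Im_cexp/= ?cos0 ?sin0 ?mulr1 ?mulr0. Qed.

Lemma mul_i_real (x : R) : 'i%C * x%:C = Complex 0 x.
Proof. by apply: complex_ext; rewrite ?cReM ?cImM/=; ring. Qed.

Lemma Re_cexp_i (x : R) : complex.Re (cexp ('i%C * x%:C)) = cos x.
Proof. by rewrite mul_i_real Re_cexp/= expR0 mul1r. Qed.

Lemma Im_cexp_i (x : R) : complex.Im (cexp ('i%C * x%:C)) = sin x.
Proof. by rewrite mul_i_real Im_cexp/= expR0 mul1r. Qed.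

(** Second-order Taylor remainder. The real and the imaginary part each split into two terms bounded
    by m^2 exp(m), hence the constant 4. *)
Lemma normc_cexpB1B z (m : R) : normc z <= m ->
  normc (cexp z - 1 - z) <= 4 * m ^+ 2 * expR m.
Proof.
move=> zm; apply: (le_trans (ler_normc _)).
have xm := le_trans (ler_norm_Re z) zm; have ym := le_trans (ler_norm_Im z) zm.
have m0 : 0 <= m := le_trans (normr_ge0 _) xm.
rewrite !cReB !cImB Re_cexp Im_cexp; case: z zm xm ym => x y /= _ xm ym.
have em : expR x <= expR m by rewrite ler_expR (le_trans (ler_norm _)).
have y2 : y ^+ 2 <= m ^+ 2 by rewrite -real_normK ?num_real// lerXn2r ?nnegrE.
have -> : expR x * cos y - 1 - x = (expR x - 1 - x) - expR x * (1 - cos y) by ring.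
have -> : expR x * sin y - 0 - y = expR x * (sin y - y) + y * (expR x - 1) by ring.
have h1 := ler_norm_expRB1B xm.
have h2 : `|expR x * (1 - cos y)| <= expR m * m ^+ 2.
  rewrite normrM (ger0_norm (expR_ge0 _)) ler_pM ?expR_ge0//.
  by rewrite ger0_norm ?oneBcos_ge0// (le_trans (ler_oneBcos_sqr _)).
have h3 : `|expR x * (sin y - y)| <= expR m * m ^+ 2.
  rewrite normrM (ger0_norm (expR_ge0 _)) ler_pM ?expR_ge0//.
  by rewrite (le_trans (ler_norm_sinB _)).
have h4 : `|y * (expR x - 1)| <= m * (m * expR m).
  by rewrite normrM ler_pM// ler_norm_expRB1.
have h5 := ler_normB (expR x - 1 - x) (expR x * (1 - cos y)).
have h6 := ler_normD (expR x * (sin y - y)) (y * (expR x - 1)).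
move: h1 h2 h3 h4 h5 h6; rewrite expr2; lra.
Qed.

(** In the left half-plane exp(x) <= 1, so no exponential factor is left. The real part costs |x| +
    |y| and the imaginary part |y|, hence the constant 3. *)
Lemma normc_cexpB1_npos z : complex.Re z <= 0 -> normc (cexp z - 1) <= 3 * normc z.
Proof.
move=> z0; apply: (le_trans (ler_normc _)).
rewrite !cReB !cImB Re_cexp Im_cexp.
have h1 := ler_norm_Re z; have h2 := ler_norm_Im z.
case: z z0 h1 h2 => x y /= x0 h1 h2.
have e1 : expR x <= 1 by rewrite -expR0 ler_expR.
have -> : expR x * cos y - 1 = (expR x - 1) - expR x * (1 - cos y) by ring.
have h3 := ler_norm_expRB1_npos x0.
have h4 : `|expR x * (1 - cos y)| <= 1 * `|y|.
  by rewrite normrM (ger0_norm (expR_ge0 _)) ler_pM ?expR_ge0// ler_norm_oneBcos.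
have h5 : `|expR x * sin y| <= 1 * `|y|.
  by rewrite normrM (ger0_norm (expR_ge0 _)) ler_pM ?expR_ge0// ler_norm_sin.
have h6 := ler_normB (expR x - 1) (expR x * (1 - cos y)).
rewrite subr0; lra.
Qed.

(** Factor out the exponential whose exponent has the larger real part: it has modulus at most 1,
    and the remaining exponent is again in the left half-plane. *)
Lemma normc_cexpB z w : complex.Re z <= 0 -> complex.Re w <= 0 ->
  normc (cexp z - cexp w) <= 3 * normc (z - w).
Proof.
wlog zw : z w / complex.Re z <= complex.Re w.
  move=> h z0 w0; have [zw|/ltW wz] := leP (complex.Re z) (complex.Re w).
    exact: h.
  by rewrite normcBC (normcBC z) h.
move=> z0 w0.
have -> : cexp z - cexp w = cexp w * (cexp (z - w) - 1).
  by rewrite mulrBr mulr1 -cexpD [w + _]addrC subrK.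
rewrite normcM; apply: (@le_trans _ _ (1 * (3 * normc (z - w)))); last by rewrite mul1r.
rewrite ler_pM ?normc_ge0 ?normc_cexp_le1// normc_cexpB1_npos//.
by rewrite cReB subr_le0.
Qed.

End cexp_theory.

(** * Complex-valued integrals *)

Section integral_off_null_set.
Context d (T : measurableType d) (R : realType) (mu : {measure set T -> \bar R}).
Local Open Scope ereal_scope.
Import HBNNSimple.

Let ge0_le_integral_off_null (N : set T) (f g : T -> \bar R) :
  measurable N -> mu N = 0 -> (forall x, 0 <= f x) -> (forall x, 0 <= g x) ->
  (forall x, ~ N x -> f x = g x) -> \int[mu]_x f x <= \int[mu]_x g x.
Proof.
move=> mN N0 f0 g0 fg; rewrite !ge0_integralTE//; apply: ge_ereal_sup => _ [h/= hf <-].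
have mNC : measurable (~` N) by exact: measurableC.
have projE x : proj_nnsfun h mNC x = (h \_ (~` N)) x by rewrite (mrestrict h mNC).
apply: ereal_sup_ubound; exists (proj_nnsfun h mNC).
  move=> x; rewrite projE patchE; case: ifPn => [|_]; last by rewrite g0.
  by rewrite inE => Nx; rewrite -fg.
rewrite -!integralT_nnsfun; apply: ge0_ae_eq_integral => //.
- exact/measurable_EFinP.
- exact/measurable_EFinP.
- by move=> x _; rewrite lee_fin.
- by move=> x _; rewrite lee_fin.
- exists N; split => // x hx; apply: contrapT => Nx; apply: hx => _.
  by rewrite projE patchE mem_set.
Qed.

(* The integral is a supremum over the simple functions below the integrand, and
   these can be modified on [N]. *)
Lemma eq_integral_off_null (N : set T) (f g : T -> \bar R) :
  measurable N -> mu N = 0 -> (forall x, ~ N x -> f x = g x) ->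
  \int[mu]_x f x = \int[mu]_x g x.
Proof.
move=> mN N0 fg; rewrite integralE [RHS]integralE; congr (_ - _);
  apply/eqP; rewrite eq_le; apply/andP; split;
  apply: (ge0_le_integral_off_null mN) => // x Nx; rewrite ?funeposE ?funenegE fg//.
Qed.

End integral_off_null_set.

Section Rintegral_convergence.
Context d (T : measurableType d) (R : realType) (mu : {measure set T -> \bar R}).

Lemma Rdominated_cvg (D : set T) (f_ : nat -> T -> R) (f g : T -> R) :
  measurable D -> (forall n, measurable_fun D (f_ n)) -> measurable_fun D f ->
  {ae mu, forall x, D x -> f_ n x @[n --> \oo] --> f x} ->
  mu.-integrable D (EFin \o g) ->
  (forall n x, D x -> `|f_ n x| <= g x) ->
  \int[mu]_(x in D) f_ n x @[n --> \oo] --> \int[mu]_(x in D) f x.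
Proof.
move=> mD mf_ mf cf ig fg.
have [||||i _ h] := @dominated_convergence _ _ _ mu D mD (fun n => EFin \o f_ n) (EFin \o f)
    (EFin \o g) _ _ _ ig.
- by move=> n; exact/measurable_EFinP.
- exact/measurable_EFinP.
- by apply: filterS cf => x + Dx => /(_ Dx) cx; apply: cvg_EFin => //; exact: nearW.
- by apply: aeW => x n Dx /=; rewrite lee_fin fg.
by apply: fine_cvg; rewrite fineK//; exact: integrable_fin_num.
Qed.

Lemma Rintegral_bounded (D : set T) (f : T -> R) (M : R) :
  measurable D -> (mu D < +oo)%E -> measurable_fun D f ->
  (forall x, D x -> `|f x| <= M) -> mu.-integrable D (EFin \o f).
Proof.
move=> mD muD mf fM; apply: measurable_bounded_integrable => //.
exists M; split; first exact: num_real.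
by move=> y My x Dx; exact: le_trans (fM _ Dx) (ltW My).
Qed.

Lemma ge0_Rintegrable (D : set T) (f : T -> R) : measurable_fun D f ->
  (forall x, D x -> 0 <= f x) -> (\int[mu]_(x in D) (f x)%:E < +oo)%E ->
  mu.-integrable D (EFin \o f).
Proof.
move=> mf f0 foo; apply/integrableP; split; first exact/measurable_EFinP.
suff -> : (\int[mu]_(x in D) `|(EFin \o f) x| = \int[mu]_(x in D) (f x)%:E)%E by [].
by apply: eq_integral => x; rewrite inE => Dx /=; rewrite ger0_norm// f0.
Qed.

Lemma ler_norm_Rintegral_bounded (D : set T) (f : T -> R) (M : R) :
  measurable D -> (mu D < +oo)%E -> measurable_fun D f ->
  (forall x, D x -> `|f x| <= M) -> `|\int[mu]_(x in D) f x| <= M * fine (mu D).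
Proof.
move=> mD muD mf fM; have i := Rintegral_bounded mD muD mf fM.
apply: (le_trans (le_normr_Rintegral mD i)).
rewrite -Rintegral_cst//; apply: le_Rintegral => //.
- by apply: integrable_norm.
- exact: (Rintegral_bounded mD muD (@measurable_cst _ _ _ _ _ M) (fun _ _ => lexx `|M|)).
Qed.

End Rintegral_convergence.

Lemma measurable_fun_sin (R : realType) : measurable_fun setT (@sin R).
Proof. by apply: continuous_measurable_fun; exact: continuous_sin. Qed.

Lemma measurable_fun_cos (R : realType) : measurable_fun setT (@cos R).
Proof. by apply: continuous_measurable_fun; exact: continuous_cos. Qed.

Lemma measurable_fun_inv (R : realType) : measurable_fun setT (@GRing.inv R).
Proof.
rewrite -(setUv [set 0 : R]); apply/measurable_funU => //; first exact: measurableC.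
split; first exact: measurable_fun_set1.
apply: open_continuous_measurable_fun; first exact: closed_openC.
by move=> x; rewrite inE => /= /eqP x0; exact: inv_continuous.
Qed.

Section complex_measurability.
Context d (T : measurableType d) {R : realType}.
Implicit Types f g : T -> R[i].

Definition cmeasurable (D : set T) f :=
  measurable_fun D (@complex.Re R \o f) /\ measurable_fun D (@complex.Im R \o f).

Lemma cmeasurable_cst D (c : R[i]) : cmeasurable D (fun=> c).
Proof. by split; exact: measurable_cst. Qed.

Lemma cmeasurable_real D (f : T -> R) :
  measurable_fun D f -> cmeasurable D (fun x => (f x)%:C).
Proof. by split => //=; exact: measurable_cst. Qed.

Lemma cmeasurableD D f g :
  cmeasurable D f -> cmeasurable D g -> cmeasurable D (fun x => f x + g x).
Proof.
move=> [fr fi] [gr gi]; split.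
  by rewrite (_ : _ \o _ = (@complex.Re R \o f) \+ (@complex.Re R \o g));
    [exact: measurable_funD|apply/funext => x /=; rewrite cReD].
by rewrite (_ : _ \o _ = (@complex.Im R \o f) \+ (@complex.Im R \o g));
  [exact: measurable_funD|apply/funext => x /=; rewrite cImD].
Qed.

Lemma cmeasurableM D f g :
  cmeasurable D f -> cmeasurable D g -> cmeasurable D (fun x => f x * g x).
Proof.
move=> [fr fi] [gr gi]; split.
  rewrite (_ : _ \o _ = ((@complex.Re R \o f) \* (@complex.Re R \o g)) \-
      ((@complex.Im R \o f) \* (@complex.Im R \o g))).
    by apply: measurable_funB; exact: measurable_funM.
  by apply/funext => x /=; rewrite cReM.
rewrite (_ : _ \o _ = ((@complex.Re R \o f) \* (@complex.Im R \o g)) \+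
    ((@complex.Im R \o f) \* (@complex.Re R \o g))).
  by apply: measurable_funD; exact: measurable_funM.
by apply/funext => x /=; rewrite cImM.
Qed.

Lemma cmeasurableB D f g :
  cmeasurable D f -> cmeasurable D g -> cmeasurable D (fun x => f x - g x).
Proof.
move=> mf mg; rewrite (_ : (fun x => _) = (fun x => f x + (-1) * g x)).
  by apply: cmeasurableD => //; apply: cmeasurableM => //; exact: cmeasurable_cst.
by apply/funext => x; rewrite mulN1r.
Qed.

Lemma cmeasurable_cexp D f :
  cmeasurable D f -> cmeasurable D (fun x => cexp (f x)).
Proof.
move=> [fr fi]; split.
  rewrite (_ : _ \o _ = (expR \o (@complex.Re R \o f)) \* (cos \o (@complex.Im R \o f))).
    apply: measurable_funM; first exact: measurableT_comp.
    apply: measurableT_comp => //; apply: continuous_measurable_fun.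
    exact: continuous_cos.
  by apply/funext => x; exact: Re_cexp.
rewrite (_ : _ \o _ = (expR \o (@complex.Re R \o f)) \* (sin \o (@complex.Im R \o f))).
  apply: measurable_funM; first exact: measurableT_comp.
  apply: measurableT_comp => //; apply: continuous_measurable_fun.
  exact: continuous_sin.
by apply/funext => x; exact: Im_cexp.
Qed.

Lemma cmeasurable_sum D (I : Type) (s : seq I) (f : I -> T -> R[i]) :
  (forall i, cmeasurable D (f i)) -> cmeasurable D (fun x => \sum_(i <- s) f i x).
Proof.
move=> mf; elim: s => [|i s IH].
  by rewrite (_ : (fun x => _) = fun=> 0);
    [exact: cmeasurable_cst|apply/funext => x; rewrite big_nil].
rewrite (_ : (fun x => _) = fun x => f i x + \sum_(i <- s) f i x);
  last by apply/funext => x; rewrite big_cons.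
exact: cmeasurableD.
Qed.

End complex_measurability.

Section Cintegral_theory.
Context d (T : measurableType d) {R : realType} (mu : {measure set T -> \bar R}).
Implicit Types (f g : T -> R[i]) (D : set T).
Import Normc.

Definition Cintegrable D f :=
  mu.-integrable D (EFin \o (@complex.Re R \o f)) /\
  mu.-integrable D (EFin \o (@complex.Im R \o f)).

Lemma eq_Cintegral D g f : {in D, f =1 g} -> Cintegral mu D f = Cintegral mu D g.
Proof.
by move=> fg; rewrite /Cintegral; congr Complex; apply: eq_Rintegral => x xD; rewrite fg.
Qed.

Lemma CintegralD D f g : measurable D -> Cintegrable D f -> Cintegrable D g ->
  Cintegral mu D (fun x => f x + g x) = Cintegral mu D f + Cintegral mu D g.
Proof.
move=> mD [fr fi] [gr gi]; apply: complex_ext.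
  rewrite cReD /= -RintegralD//; by apply: eq_Rintegral => x _; rewrite cReD.
rewrite cImD /= -RintegralD//; by apply: eq_Rintegral => x _; rewrite cImD.
Qed.

Lemma CintegralZl D f (c : R[i]) : measurable D -> Cintegrable D f ->
  Cintegral mu D (fun x => c * f x) = c * Cintegral mu D f.
Proof.
move=> mD [fr fi].
have ir (r : R) h : mu.-integrable D (EFin \o h) ->
    mu.-integrable D (EFin \o (fun x => r * h x)).
  by move=> ih; have := integrableZl mD r ih.
apply: complex_ext.
  rewrite cReM /= -!RintegralZl// -RintegralB//; last 2 first.
  - exact: ir.
  - exact: ir.
  by apply: eq_Rintegral => x _; rewrite cReM.
rewrite cImM /= -!RintegralZl// -RintegralD//; last 2 first.
- exact: ir.
- exact: ir.
by apply: eq_Rintegral => x _; rewrite cImM.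
Qed.

Lemma CintegrableD D f g : measurable D -> Cintegrable D f -> Cintegrable D g ->
  Cintegrable D (fun x => f x + g x).
Proof.
move=> mD [fr fi] [gr gi]; split.
  apply: (eq_integrable mD _ _ _ (integrableD mD fr gr)) => x _ /=.
  by rewrite cReD.
apply: (eq_integrable mD _ _ _ (integrableD mD fi gi)) => x _ /=.
by rewrite cImD.
Qed.

Lemma CintegrableZl D f (c : R[i]) : measurable D -> Cintegrable D f ->
  Cintegrable D (fun x => c * f x).
Proof.
move=> mD [fr fi]; split.
  apply: (eq_integrable mD _ _ _ (integrableB mD (integrableZl mD (complex.Re c) fr)
     (integrableZl mD (complex.Im c) fi))) => x _ /=.
  by rewrite cReM.
apply: (eq_integrable mD _ _ _ (integrableD mD (integrableZl mD (complex.Re c) fi)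
     (integrableZl mD (complex.Im c) fr))) => x _ /=.
by rewrite cImM.
Qed.

Lemma CintegralB D f g : measurable D -> Cintegrable D f -> Cintegrable D g ->
  Cintegral mu D (fun x => f x - g x) = Cintegral mu D f - Cintegral mu D g.
Proof.
move=> mD fi gi; rewrite -mulN1r -CintegralZl// -CintegralD//; last exact: CintegrableZl.
by apply: eq_Cintegral => x _; rewrite mulN1r.
Qed.

Lemma Cintegral_setU (A B : set T) f : measurable A -> measurable B ->
  [disjoint A & B] -> Cintegrable (A `|` B) f ->
  Cintegral mu (A `|` B) f = Cintegral mu A f + Cintegral mu B f.
Proof.
move=> mA mB AB [fr fi]; apply: complex_ext; rewrite ?cReD ?cImD /=.
  by rewrite -Rintegral_setU.
by rewrite -Rintegral_setU.
Qed.

Lemma Cintegral_mkcond D f :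
  Cintegral mu D f = Cintegral mu setT (fun x => (\1_D x)%:C * f x).
Proof.
apply: complex_ext => /=; rewrite Rintegral_mkcond; apply: eq_Rintegral => x _;
  rewrite ?cReM ?cImM /= indicE patchE; case: (x \in D); rewrite /= ?mul1r ?mul0r ?subr0 ?addr0//.
Qed.

Lemma Cintegral_cst D (c : R[i]) : measurable D ->
  Cintegral mu D (fun=> c) = c * (fine (mu D))%:C.
Proof.
move=> mD; apply: complex_ext; rewrite ?cReM ?cImM /= Rintegral_cst//; ring.
Qed.

Lemma Cintegrable_bounded D f (M : R) : measurable D -> (mu D < +oo)%E ->
  cmeasurable D f -> (forall x, D x -> normc (f x) <= M) -> Cintegrable D f.
Proof.
move=> mD muD [mr mi] fM; split; apply: (@Rintegral_bounded _ _ _ _ _ _ M) => // x Dx.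
  exact: le_trans (ler_norm_Re _) (fM _ Dx).
exact: le_trans (ler_norm_Im _) (fM _ Dx).
Qed.

(** The factor 2 comes from bounding the real and imaginary parts separately; it is harmless, since
    the errors it multiplies tend to 0. *)
Lemma normc_Cintegral_le D f (M : R) : measurable D -> (mu D < +oo)%E ->
  cmeasurable D f -> (forall x, D x -> normc (f x) <= M) ->
  normc (Cintegral mu D f) <= 2 * M * fine (mu D).
Proof.
move=> mD muD [mr mi] fM; apply: (le_trans (ler_normc _)) => /=.
rewrite -mulrA mulr_natl mulr2n lerD// ler_norm_Rintegral_bounded// => x Dx /=.
  exact: le_trans (ler_norm_Re _) (fM _ Dx).
exact: le_trans (ler_norm_Im _) (fM _ Dx).
Qed.

Lemma CintegrableS (A D : set T) f : measurable A -> measurable D -> A `<=` D ->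
  Cintegrable D f -> Cintegrable A f.
Proof. by move=> mA mD AD [fr fi]; split; apply: (integrableS mD). Qed.

Lemma Cintegral_off_null (N : set T) f g : measurable N -> mu N = 0 ->
  (forall x, ~ N x -> f x = g x) -> Cintegral mu setT f = Cintegral mu setT g.
Proof.
move=> mN N0 fg; apply: complex_ext; rewrite /Cintegral/=; congr fine;
  apply: (eq_integral_off_null mN) => // x Nx; by rewrite fg.
Qed.

End Cintegral_theory.

Section complex_limits.
Context {R : realType}.
Import Normc.

Definition ccvg (u : nat -> R[i]) (l : R[i]) :=
  (complex.Re (u n) @[n --> \oo] --> complex.Re l) /\
  (complex.Im (u n) @[n --> \oo] --> complex.Im l).

(** The device behind the identities between complex integrals: each side is the limit of a
    discretized quantity, and the two discretizations differ by a vanishing error. *)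
Lemma ccvg_eq (u v : nat -> R[i]) (l m : R[i]) (e : nat -> R) :
  ccvg u l -> ccvg v m -> (forall n, normc (u n - v n) <= e n) ->
  e n @[n --> \oo] --> 0 -> l = m.
Proof.
move=> [ur ui] [vr vi] uv e0; apply: complex_ext; apply/eqP; rewrite -subr_eq0; apply/eqP.
  apply: (@cvg_unique _ (@norm_hausdorff _ _) (complex.Re (u n) - complex.Re (v n) @[n --> \oo])).
    exact: cvgB.
  apply/cvgr0Pnorm_le => eps eps0; move/cvgr0Pnorm_le : e0 => /(_ eps eps0).
  apply: filterS => n; apply: le_trans; rewrite -cReB (le_trans (ler_norm_Re _))//.
  by rewrite (le_trans (uv n))// ler_norm.
apply: (@cvg_unique _ (@norm_hausdorff _ _) (complex.Im (u n) - complex.Im (v n) @[n --> \oo])).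
  exact: cvgB.
apply/cvgr0Pnorm_le => eps eps0; move/cvgr0Pnorm_le : e0 => /(_ eps eps0).
apply: filterS => n; apply: le_trans; rewrite -cImB (le_trans (ler_norm_Im _))//.
by rewrite (le_trans (uv n))// ler_norm.
Qed.

Lemma ccvg_cst (l : R[i]) : ccvg (fun=> l) l.
Proof. by split; exact: cvg_cst. Qed.

Lemma ccvgM (u v : nat -> R[i]) (l m : R[i]) :
  ccvg u l -> ccvg v m -> ccvg (fun n => u n * v n) (l * m).
Proof.
move=> [ur ui] [vr vi]; split.
  rewrite cReM (_ : (fun n => _) = fun n => complex.Re (u n) * complex.Re (v n) -
    complex.Im (u n) * complex.Im (v n)); first by apply: cvgB; exact: cvgM.
  by apply/funext => n; rewrite cReM.
rewrite cImM (_ : (fun n => _) = fun n => complex.Re (u n) * complex.Im (v n) +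
    complex.Im (u n) * complex.Re (v n)); first by apply: cvgD; exact: cvgM.
by apply/funext => n; rewrite cImM.
Qed.

Lemma ccvgD (u v : nat -> R[i]) (l m : R[i]) :
  ccvg u l -> ccvg v m -> ccvg (fun n => u n + v n) (l + m).
Proof.
move=> [ur ui] [vr vi]; split.
  rewrite cReD (_ : (fun n => _) = fun n => complex.Re (u n) + complex.Re (v n));
    first exact: cvgD.
  by apply/funext => n; rewrite cReD.
rewrite cImD (_ : (fun n => _) = fun n => complex.Im (u n) + complex.Im (v n));
  first exact: cvgD.
by apply/funext => n; rewrite cImD.
Qed.

Lemma ccvg_real (u : nat -> R) (l : R) :
  u n @[n --> \oo] --> l -> ccvg (fun n => (u n)%:C) l%:C.
Proof. by move=> ul; split => //=; exact: cvg_cst. Qed.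

Lemma ccvg_cexp (u : nat -> R[i]) (l : R[i]) :
  ccvg u l -> ccvg (fun n => cexp (u n)) (cexp l).
Proof.
move=> [ur ui]; split.
  rewrite Re_cexp (_ : (fun n => _) = fun n => expR (complex.Re (u n)) * cos (complex.Im (u n))).
    apply: cvgM; first by apply: continuous_cvg => //; exact: continuous_expR.
    by apply: continuous_cvg => //; exact: continuous_cos.
  by apply/funext => n; rewrite Re_cexp.
rewrite Im_cexp (_ : (fun n => _) = fun n => expR (complex.Re (u n)) * sin (complex.Im (u n))).
  apply: cvgM; first by apply: continuous_cvg => //; exact: continuous_expR.
  by apply: continuous_cvg => //; exact: continuous_sin.
by apply/funext => n; rewrite Im_cexp.
Qed.

Lemma Cdominated_cvg d (T : measurableType d) (mu : {measure set T -> \bar R})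
  (D : set T) (f_ : nat -> T -> R[i]) (f : T -> R[i]) (g : T -> R) :
  measurable D -> (forall n, cmeasurable D (f_ n)) -> cmeasurable D f ->
  {ae mu, forall x, D x -> ccvg (f_ ^~ x) (f x)} ->
  mu.-integrable D (EFin \o g) ->
  (forall n x, D x -> normc (f_ n x) <= g x) ->
  ccvg (fun n => Cintegral mu D (f_ n)) (Cintegral mu D f).
Proof.
move=> mD mf_ mf cf ig fg; split => /=.
  apply: (@Rdominated_cvg _ _ _ mu D _ _ g) => //.
  - by move=> n; have [] := mf_ n.
  - by have [] := mf.
  - by apply: filterS cf => x + Dx => /(_ Dx) [].
  - by move=> n x Dx; rewrite (le_trans (ler_norm_Re _))// fg.
apply: (@Rdominated_cvg _ _ _ mu D _ _ g) => //.
- by move=> n; have [] := mf_ n.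
- by have [] := mf.
- by apply: filterS cf => x + Dx => /(_ Dx) [].
- by move=> n x Dx; rewrite (le_trans (ler_norm_Im _))// fg.
Qed.

End complex_limits.

(** * The Dirichlet integral and Levy inversion *)

Section fubini_on_rectangles.
Context d1 d2 (T1 : measurableType d1) (T2 : measurableType d2) (R : realType).
Variable m1 : {sigma_finite_measure set T1 -> \bar R}.
Variable m2 : {sigma_finite_measure set T2 -> \bar R}.

(** No integrability is asked: the integral is by definition [fine] of a difference of two
    nonnegative integrals, each measurable in [x] by Tonelli. *)
Lemma measurable_fun_Rintegral (D2 : set T2) (f : T1 * T2 -> R) :
  measurable D2 -> measurable_fun setT f ->
  measurable_fun setT (fun x => \int[m2]_(y in D2) f (x, y)).
Proof.
move=> mD2 mf; pose g z := (f z * \1_D2 z.2)%:E.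
have mg : measurable_fun setT g.
  apply/measurable_EFinP; apply: measurable_funM => //.
  by apply: (measurableT_comp (measurable_indic mD2)); exact: measurable_snd.
rewrite (_ : (fun x => _) = fine \o (fun x => (\int[m2]_y (g^\+ (x, y)) - \int[m2]_y (g^\- (x, y)))%E)).
  apply: measurableT_comp => //.
  apply: emeasurable_funB.
    by apply: measurable_fun_fubini_tonelli_F => //; exact: measurable_funepos.
  by apply: measurable_fun_fubini_tonelli_F => //; exact: measurable_funeneg.
apply/funext => x; rewrite /Rintegral/=; congr fine.
rewrite integral_mkcond (_ : _ \_ _ = fun y => g (x, y)).
  rewrite integralE; congr (_ - _)%E; apply: eq_integral => y _;
    by rewrite ?funeposE ?funenegE.
apply/funext => y; rewrite patchE /g/= indicE.
by case: (y \in D2); rewrite /= ?mulr1 ?mulr0.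
Qed.

(** The sections are assumed integrable at every point, not almost everywhere, so that [fine] can be
    removed from each inner integral before Fubini's theorem is applied to the function cut off by
    the indicators of [D1] and [D2]. *)
Lemma Rfubini (D1 : set T1) (D2 : set T2) (f : T1 * T2 -> R) :
  measurable D1 -> measurable D2 -> measurable_fun setT f ->
  (\int[m1]_(x in D1) \int[m2]_(y in D2) `|f (x, y)|%:E < +oo)%E ->
  (forall x, D1 x -> m2.-integrable D2 (fun y => (f (x, y))%:E)) ->
  (forall y, D2 y -> m1.-integrable D1 (fun x => (f (x, y))%:E)) ->
  \int[m1]_(x in D1) \int[m2]_(y in D2) f (x, y) =
  \int[m2]_(y in D2) \int[m1]_(x in D1) f (x, y).
Proof.
move=> mD1 mD2 mf foo i1 i2.
pose g (z : T1 * T2) := \1_D1 z.1 * (\1_D2 z.2 * f z) : R.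
have mg : measurable_fun setT (EFin \o g).
  apply/measurable_EFinP; apply: measurable_funM.
    by apply: (measurableT_comp (measurable_indic mD1)); exact: measurable_fst.
  apply: measurable_funM => //.
  by apply: (measurableT_comp (measurable_indic mD2)); exact: measurable_snd.
have E1 (h : R -> R) x : h 0 = 0 -> (\int[m2]_y (h (g (x, y)))%:E)%E =
    ((fun x => \int[m2]_(y in D2) (h (f (x, y)))%:E)%E \_ D1) x.
  move=> h0; rewrite patchE; case: ifPn => xD1.
    rewrite [RHS]integral_mkcond; apply: eq_integral => y _.
    rewrite /g/= !indicE xD1 mul1r patchE.
    by case: (y \in D2); rewrite /= ?mul1r// mul0r h0.
  apply: integral0_eq => y _; rewrite /g/= indicE (negbTE xD1) mul0r h0//.
have E2 y : (\int[m1]_x (g (x, y))%:E)%E =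
    ((fun y => \int[m1]_(x in D1) (f (x, y))%:E)%E \_ D2) y.
  rewrite patchE; case: ifPn => yD2.
    rewrite [RHS]integral_mkcond; apply: eq_integral => x _.
    rewrite /g/= !indicE yD2 mul1r patchE.
    by case: (x \in D1); rewrite /= ?mul1r// mul0r.
  by apply: integral0_eq => x _; rewrite /g/= [\1_D2 _]indicE (negbTE yD2) mul0r mulr0.
have /(integrable12ltyP _ _ mg) ig : (\int[m1]_x \int[m2]_y `|(EFin \o g) (x, y)| < +oo)%E.
  rewrite (eq_integral (fun x => ((fun x => \int[m2]_(y in D2) `|f (x, y)|%:E)%E \_ D1) x)).
    by rewrite -integral_mkcond.
  by move=> x _; rewrite -(E1 (fun t => `|t|)) ?normr0.
have := Fubini ig; rewrite /= => FE.
rewrite /Rintegral; congr fine.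
transitivity (\int[m1]_(x in D1) \int[m2]_(y in D2) (f (x, y))%:E)%E.
  apply: eq_integral => x; rewrite inE => D1x; rewrite fineK//.
  by apply: integrable_fin_num => //; exact: i1.
transitivity (\int[m2]_(y in D2) \int[m1]_(x in D1) (f (x, y))%:E)%E; last first.
  apply: eq_integral => y; rewrite inE => D2y; rewrite fineK//.
  by apply: integrable_fin_num => //; exact: i2.
rewrite integral_mkcond [RHS]integral_mkcond.
under eq_integral do rewrite -(E1 id)//.
by under [RHS]eq_integral do rewrite -E2.
Qed.

Lemma Rfubini_bounded (D1 : set T1) (D2 : set T2) (f : T1 * T2 -> R) (M : R) :
  measurable D1 -> measurable D2 -> (m1 D1 < +oo)%E -> (m2 D2 < +oo)%E ->
  measurable_fun setT f -> (forall x y, D1 x -> D2 y -> `|f (x, y)| <= M) ->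
  \int[m1]_(x in D1) \int[m2]_(y in D2) f (x, y) =
  \int[m2]_(y in D2) \int[m1]_(x in D1) f (x, y).
Proof.
move=> mD1 mD2 D1oo D2oo mf fM.
have mx x : measurable_fun D2 (fun y => f (x, y)).
  apply: measurable_funTS; apply: measurableT_comp => //.
have my y : measurable_fun D1 (fun x => f (x, y)).
  apply: measurable_funTS; apply: measurableT_comp => //.
apply: Rfubini => //; last 2 first.
- move=> x D1x; apply: (@Rintegral_bounded _ _ _ _ _ _ M) => // y D2y; exact: fM.
- move=> y D2y; apply: (@Rintegral_bounded _ _ _ _ _ _ M) => // x D1x; exact: fM.
apply: (@le_lt_trans _ _ (\int[m1]_(x in D1) ((`|M| * fine (m2 D2))%:E))%E).
  have [->|/set0P[x0 D1x0]] := eqVneq D1 set0; first by rewrite !integral_set0.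
  have mN : measurable_fun setT (fun z => `|f z|%:E).
    by apply/measurable_EFinP; exact: measurableT_comp.
  apply: ge0_le_integral => //.
  - by move=> x _; apply: integral_ge0 => y _; rewrite lee_fin.
  - rewrite (_ : (fun x => _) = fun x => (\int[m2]_y (`|f (x, y)| * \1_D2 y)%:E)%E).
      apply: measurable_funTS.
      apply: (measurable_fun_fubini_tonelli_F (fun z => (`|f z| * \1_D2 z.2)%:E)).
        apply/measurable_EFinP; apply: measurable_funM; first exact: measurableT_comp.
        by apply: (measurableT_comp (measurable_indic mD2)); exact: measurable_snd.
      by move=> z; rewrite lee_fin mulr_ge0.
    apply/funext => x; rewrite integral_mkcond; apply: eq_integral => y _.
    by rewrite patchE indicE; case: (y \in D2); rewrite /= ?mulr1 ?mulr0.
  - move=> x D1x; apply: (@le_trans _ _ (\int[m2]_(y in D2) `|M|%:E)%E).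
      apply: ge0_le_integral => //.
      + by apply/measurable_EFinP; exact: measurableT_comp.
      + by move=> y D2y; rewrite lee_fin (le_trans (fM _ _ D1x D2y))// ler_norm.
    by rewrite integral_cst//= EFinM fineK// ge0_fin_numE.
rewrite integral_cst// lte_mul_pinfty// ?lee_fin ?mulr_ge0// fine_ge0//.
Qed.

End fubini_on_rectangles.

Section fundamental_theorem.
Context {R : realType}.
Notation mu := (@lebesgue_measure R).

Lemma FTC2_is_derive (f F : R -> R) (a b : R) : a <= b ->
  continuous f -> (forall x, is_derive x (1 : R) F (f x)) ->
  \int[mu]_(x in `[a, b]) f x = F b - F a.
Proof.
rewrite le_eqVlt => /predU1P[<-|ab] cf dF; first by rewrite set_itv1 Rintegral_set1 subrr.
have cF : continuous F.
  by move=> x; apply: differentiable_continuous; apply/derivable1_diffP; have [] := dF x.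
rewrite /Rintegral (@continuous_FTC2 _ f F)//.
- exact: continuous_subspaceT.
- split; [by move=> x _; have [] := dF x| |].
  + by apply: cvg_at_right_filter; exact: cF.
  + by apply: cvg_at_left_filter; exact: cF.
- by move=> x _; rewrite derive1E; have [] := dF x.
Qed.

Lemma FTC2y_is_derive (f F : R -> R) (a l : R) :
  (forall x, a <= x -> 0 <= f x) -> continuous f ->
  (forall x, is_derive x (1 : R) F (f x)) -> F x @[x --> +oo] --> l ->
  (\int[mu]_(x in `[a, +oo[) (f x)%:E = (l - F a)%:E)%E.
Proof.
move=> f0 cf dF Fl.
have cF : continuous F.
  by move=> x; apply: differentiable_continuous; apply/derivable1_diffP; have [] := dF x.
rewrite (@ge0_continuous_FTC2y _ f F a l)//.
- exact: continuous_subspaceT.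
- by apply: cvg_at_right_filter; exact: cF.
- by move=> x _; rewrite derive1E; have [] := dF x.
Qed.

End fundamental_theorem.

Section dirichlet.
Context {R : realType}.
Notation mu := (@lebesgue_measure R).

(** Read from right to left, this writes the factor 1/w of the Dirichlet kernel as a superposition
    of exponentials. *)
Lemma integral_expRN (w : R) : 0 < w ->
  (\int[mu]_(x in `[0%R, +oo[) (expR (- (x * w)))%:E = (w^-1)%:E)%E.
Proof.
move=> w0; pose F x := - (w^-1 * expR (- (x * w))).
have dF x : is_derive x (1 : R) F (expR (- (x * w))).
  apply: is_derive_eq; rewrite /GRing.scale /=; field; exact: lt0r_neq0.
have cf : continuous (fun x : R => expR (- (x * w))).
  move=> x; apply: continuous_comp; last exact: continuous_expR.
  by apply: continuousN; apply: mulrr_continuous.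
have Fl : F x @[x --> +oo] --> 0.
  rewrite -oppr0; apply: cvgN; rewrite -(mulr0 w^-1); apply: cvgMr.
  apply: (@cvg_comp _ _ _ (fun x => x * w) (fun z => expR (- z)) _ (pinfty_nbhs R));
    last exact: cvgr_expR.
  exact: gt0_cvgMly.
rewrite (FTC2y_is_derive (fun x _ => expR_ge0 _) cf dF Fl) /F.
by rewrite mul0r oppr0 expR0 mulr1 sub0r opprK.
Qed.

Lemma integral_sin_expRN (x y A : R) : 0 <= A -> 0 < y ->
  \int[mu]_(w in `[0, A]) (sin (w * y) * expR (- (x * w))) =
  (y - expR (- (x * A)) * (x * sin (A * y) + y * cos (A * y))) / (x ^+ 2 + y ^+ 2).
Proof.
move=> A0 y0; have n0 : x ^+ 2 + y ^+ 2 != 0.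
  by rewrite lt0r_neq0// ltr_wpDl ?sqr_ge0// exprn_gt0.
(* The imaginary part of exp((-x + iy)w) / (-x + iy). *)
pose F w := - (expR (- (x * w)) * (x * sin (w * y) + y * cos (w * y)) / (x ^+ 2 + y ^+ 2)).
have dF w : is_derive w (1 : R) F (sin (w * y) * expR (- (x * w))).
  apply: is_derive_eq; rewrite /GRing.scale /=; field.
  exact: n0.
have cf : continuous (fun w : R => sin (w * y) * expR (- (x * w))).
  move=> w; apply: differentiable_continuous; apply/derivable1_diffP.
  exact: ex_derive.
rewrite (FTC2_is_derive A0 cf dF) /F.
rewrite mul0r mulr0 oppr0 expR0 sin0 cos0; field.
exact: n0.
Qed.

Lemma integral_cauchy (y : R) : 0 < y ->
  (\int[mu]_(x in `[0%R, +oo[) (y / (x ^+ 2 + y ^+ 2))%:E = (pi / 2)%:E)%E.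
Proof.
move=> y0; have n0 x : x ^+ 2 + y ^+ 2 != 0.
  by rewrite lt0r_neq0// ltr_wpDl ?sqr_ge0// exprn_gt0.
pose F x := atan (x * y^-1).
have dF x : is_derive x (1 : R) F (y / (x ^+ 2 + y ^+ 2)).
  apply: is_derive_eq; rewrite /GRing.scale /=; field.
  by rewrite n0 lt0r_neq0.
have cf : continuous (fun x : R => y / (x ^+ 2 + y ^+ 2)).
  move=> x; apply: cvgM; first exact: cvg_cst.
  apply: cvgV => //; apply: cvgD; last exact: cvg_cst.
  exact: exprn_continuous.
have Fl : F x @[x --> +oo] --> pi / 2.
  apply: (@cvg_comp _ _ _ (fun x => x * y^-1) (@atan R) _ (pinfty_nbhs R)); last exact: cvgy_atan.
  by apply: gt0_cvgMly; rewrite ?invr_gt0.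
rewrite (FTC2y_is_derive _ cf dF Fl) /F ?mul0r ?atan0 ?subr0//.
move=> x _; apply: divr_ge0; first exact: ltW.
by apply: addr_ge0; exact: sqr_ge0.
Qed.

Lemma dirichlet_remainder_le (x y A : R) : 0 <= x -> 0 < y ->
  `|expR (- (x * A)) * (x * sin (A * y) + y * cos (A * y)) / (x ^+ 2 + y ^+ 2)| <=
  2 / y * expR (- (x * A)).
Proof.
move=> x0 y0; have n0 : 0 < x ^+ 2 + y ^+ 2 by rewrite ltr_wpDl ?sqr_ge0// exprn_gt0.
have h1 : `|x * sin (A * y) + y * cos (A * y)| <= x + y.
  apply: (le_trans (ler_normD _ _)); rewrite !normrM; apply: lerD.
    by rewrite (ger0_norm x0) ler_piMr// sin_max.
  by rewrite (gtr0_norm y0) ler_piMr ?cos_max// ltW.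
rewrite -mulrA normrM (ger0_norm (expR_ge0 _)) mulrC.
apply: ler_wpM2r; first exact: expR_ge0.
rewrite normrM [`|_^-1|]gtr0_norm ?invr_gt0//.
rewrite ler_pdivrMr// mulrAC ler_pdivlMr//.
apply: (@le_trans _ _ ((x + y) * y)); first by rewrite ler_wpM2r// ltW.
(* The claim is now (x + y) y <= 2 (x^2 + y^2), shown by an explicit sum of squares. *)
rewrite -subr_ge0 (_ : _ - _ = (x - y / 2) ^+ 2 + x ^+ 2 + 3 / 4 * y ^+ 2); last by field.
by rewrite !addr_ge0 ?sqr_ge0// mulr_ge0 ?sqr_ge0.
Qed.

(** Write 1/w as the integral of exp(-xw) over x >= 0 and exchange the integrals. The integral over
    w in [0, A] is y / (x^2 + y^2) minus a remainder: the first term integrates to pi/2, and the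
    remainder, dominated by (2/y) exp(-xA), to at most 2/(yA). *)
Lemma dirichlet_approx (y A : R) : 0 < y -> 0 < A ->
  `|\int[mu]_(w in `[0, A]) (sin (w * y) / w) - pi / 2| <= 2 / y * A^-1.
Proof.
move=> y0 A0; have n0 x : 0 < x ^+ 2 + y ^+ 2.
  by rewrite ltr_wpDl ?sqr_ge0// exprn_gt0.
pose D := `[0%R, +oo[%classic : set (measurableTypeR R).
have mD : measurable D := measurable_itv _.
pose f (z : measurableTypeR R * measurableTypeR R) : R := sin (z.1 * y) * expR (- (z.2 * z.1)).
have mf : measurable_fun [set: measurableTypeR R * measurableTypeR R] f.
  apply: measurable_funM.
    apply: measurableT_comp; first exact: measurable_fun_sin.
    exact: measurable_funM.
  apply: measurableT_comp => //; apply: measurableT_comp => //.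
  exact: measurable_funM.
have mfw w : measurable_fun D (fun x => f (w, x)).
  by apply: measurable_funTS; apply: measurableT_comp.
have mfx x : measurable_fun `[0, A] (fun w => f (w, x)).
  by apply: measurable_funTS; apply: measurableT_comp.
(* At w = 0 the left side vanishes because of the sine and the right side because of the convention
   1/0 = 0. *)
have wI w : 0 <= w -> (\int[mu]_(x in D) `|f (w, x)|%:E = (`|sin (w * y)| / w)%:E)%E.
  rewrite le_eqVlt => /predU1P[<-|w0].
    rewrite mul0r sin0 normr0 mul0r; apply: integral0_eq => x _.
    by rewrite /f/= mul0r sin0 mul0r normr0.
  rewrite EFinM -(integral_expRN w0) -/D -ge0_integralZl_EFin//; last first.
    apply/measurable_EFinP; apply: measurableT_comp => //.
    by apply: measurableT_comp => //; exact: measurable_funM.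
  by apply: eq_integral => x _; rewrite /f/= normrM (ger0_norm (expR_ge0 _)).
have sw w : 0 <= w -> `|sin (w * y)| / w <= y.
  rewrite le_eqVlt => /predU1P[<-|w0]; first by rewrite invr0 mulr0 ltW.
  rewrite ler_pdivrMr//; apply: (le_trans (ler_norm_sin _)).
  by rewrite normrM !gtr0_norm// mulrC.
have foo : (\int[mu]_(w in `[0%R, A]) \int[mu]_(x in D) `|f (w, x)|%:E < +oo)%E.
  have -> : (\int[mu]_(w in `[0%R, A]) \int[mu]_(x in D) `|f (w, x)|%:E =
      \int[mu]_(w in `[0%R, A]) (`|sin (w * y)| / w)%:E)%E.
    by apply: eq_integral => w; rewrite inE/= in_itv/= => /andP[w0 _]; exact: wI.
  apply: (@le_lt_trans _ _ (\int[mu]_(w in `[0%R, A]) y%:E)%E).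
    apply: ge0_le_integral => //.
    - by move=> w; rewrite /= in_itv/= => /andP[w0 _]; rewrite lee_fin divr_ge0.
    - apply/measurable_EFinP; apply: measurable_funTS; apply: measurable_funM => //.
      apply: measurableT_comp => //; apply: measurableT_comp.
        exact: measurable_fun_sin.
      exact: measurable_funM.
    - exact: measurable_fun_inv.
    - by move=> w Aw; move: Aw; rewrite /= in_itv/= => /andP[w0 wA]; rewrite lee_fin sw.
  by rewrite integral_cst//= lebesgue_measure_itv/= lte_fin A0 -EFinD -EFinM ltry.
have i1 (w : measurableTypeR R) : `[0, A]%classic w -> mu.-integrable D (fun x => (f (w, x))%:E).
  rewrite /= in_itv/= => /andP[w0 _]; apply/integrableP; split; first by apply/measurable_EFinP; exact: mfw.
  by rewrite wI// ltry.
have i2 (x : measurableTypeR R) : D x -> mu.-integrable `[0, A] (fun w => (f (w, x))%:E).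
  rewrite /D/= in_itv/= andbT => x0.
  apply: (@Rintegral_bounded _ _ _ _ _ _ 1) => //.
  - by rewrite /= lebesgue_measure_itv/= lte_fin A0 -EFinD ltry.
  - exact: mfx.
  move=> w; rewrite /= in_itv/= => /andP[w0 _]; rewrite normrM -[leRHS]mulr1.
  rewrite ler_pM ?sin_max// ger0_norm ?expR_ge0// -expR0 ler_expR oppr_le0.
  by rewrite mulr_ge0.
have FE := @Rfubini _ _ (measurableTypeR R) (measurableTypeR R) R mu mu `[0, A]%classic D f
  (measurable_itv _) mD mf foo i1 i2.
clear foo i1 i2 sw wI.
pose r x := expR (- (x * A)) * (x * sin (A * y) + y * cos (A * y)) / (x ^+ 2 + y ^+ 2).
have mn : measurable_fun D (fun x : R => (x ^+ 2 + y ^+ 2)^-1).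
  apply: measurable_funTS; apply: continuous_measurable_fun => x.
  apply: cvgV; first exact: lt0r_neq0.
  by apply: cvgD; [exact: exprn_continuous|exact: cvg_cst].
have me : measurable_fun D (fun x : R => expR (- (x * A))).
  apply: measurable_funTS; apply: continuous_measurable_fun => x.
  by apply: differentiable_continuous; apply/derivable1_diffP; exact: ex_derive.
have iexp : mu.-integrable D (EFin \o (fun x => expR (- (x * A)))).
  apply: ge0_Rintegrable; [exact: me|by move=> x _; exact: expR_ge0|].
  by rewrite (integral_expRN A0) ltry.
have ie : mu.-integrable D (EFin \o (fun x => 2 / y * expR (- (x * A)))).
  by apply: (eq_integrable mD _ _ _ (integrableZl mD (2 / y) iexp)) => x _ /=; rewrite EFinM.
have rle x : D x -> `|r x| <= 2 / y * expR (- (x * A)).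
  by rewrite /D/= in_itv/= andbT => x0; exact: dirichlet_remainder_le.
have mr : measurable_fun D r.
  apply: measurable_funM; last exact: mn.
  apply: measurable_funM; first exact: me.
  apply: measurable_funTS; apply: continuous_measurable_fun => x.
  by apply: differentiable_continuous; apply/derivable1_diffP; exact: ex_derive.
have ir : mu.-integrable D (EFin \o r).
  apply: (le_integrable mD _ _ ie); first by apply/measurable_EFinP; exact: mr.
  by move=> x Dx; rewrite /= lee_fin (le_trans (rle _ Dx)) ?ler_norm.
have ic : mu.-integrable D (EFin \o (fun x => y / (x ^+ 2 + y ^+ 2))).
  apply: ge0_Rintegrable; [|by move=> x _; rewrite divr_ge0 ?(ltW y0) ?(ltW (n0 x))|].
    by apply: measurable_funM; [exact: measurable_cst|exact: mn].
  by rewrite (integral_cauchy y0) ltry.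
have -> : \int[mu]_(w in `[0, A]) (sin (w * y) / w) =
    \int[mu]_(w in `[0, A]) \int[mu]_(x in D) f (w, x).
  apply: eq_Rintegral => w; rewrite inE/= in_itv/= => /andP[w0 _].
  rewrite /f/=; move: w0; rewrite le_eqVlt => /predU1P[<-|w0].
    rewrite invr0 mulr0; transitivity (\int[mu]_(x in D) (0 : R)).
      by rewrite (Rintegral_cst _ mD) mul0r.
    by apply: eq_Rintegral => x _; rewrite mul0r sin0 mul0r.
  rewrite RintegralZl; [by rewrite /Rintegral integral_expRN|exact: mD|].
  apply: ge0_Rintegrable; [|by move=> x _; exact: expR_ge0|].
    apply: measurable_funTS; apply: continuous_measurable_fun => x.
    by apply: differentiable_continuous; apply/derivable1_diffP; exact: ex_derive.
  by rewrite (integral_expRN w0) ltry.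
rewrite FE.
have -> : \int[mu]_(x in D) \int[mu]_(w in `[0, A]) f (w, x) =
    \int[mu]_(x in D) (y / (x ^+ 2 + y ^+ 2) - r x).
  apply: eq_Rintegral => x _; rewrite /f/=.
  by rewrite (integral_sin_expRN x (ltW A0) y0) mulrBl.
rewrite (RintegralB mD ic ir) {1}/Rintegral (integral_cauchy y0) /=.
rewrite addrAC subrr sub0r normrN.
apply: (le_trans (le_normr_Rintegral mD ir)).
apply: (@le_trans _ _ (\int[mu]_(x in D) (2 / y * expR (- (x * A))))).
  by apply: (le_Rintegral mD _ ie rle); exact: integrable_norm.
by rewrite (RintegralZl _ mD iexp) /Rintegral (integral_expRN A0).
Qed.

End dirichlet.

Section dirichlet_kernel.
Context {R : realType}.
Notation mu := (@lebesgue_measure R).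

Definition dirichlet_int (A y : R) := \int[mu]_(w in `[0, A]) (sin (w * y) / w).

Lemma measurable_dirichlet_kernel :
  measurable_fun [set: measurableTypeR R * measurableTypeR R]
    (fun z => sin (z.2 * z.1) / z.2 : R).
Proof.
apply: measurable_funM.
  apply: measurableT_comp; first exact: measurable_fun_sin.
  exact: measurable_funM.
by apply: measurableT_comp; first exact: measurable_fun_inv.
Qed.

Lemma measurable_dirichlet_int (A : R) :
  measurable_fun [set: measurableTypeR R] (dirichlet_int A).
Proof.
exact: (@measurable_fun_Rintegral _ _ (measurableTypeR R) (measurableTypeR R) R mu
  _ _ (measurable_itv _) measurable_dirichlet_kernel).
Qed.

Lemma ler_norm_dirichlet_kernel (w y : R) : `|sin (w * y) / w| <= `|y|.
Proof.
have [->|w0] := eqVneq w 0; first by rewrite invr0 mulr0 normr0.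
rewrite normrM normfV ler_pdivrMr ?normr_gt0//.
by rewrite (le_trans (ler_norm_sin _))// normrM mulrC.
Qed.

Lemma lebesgue_measure_itvcc_lty (a b : R) : (mu `[a, b]%classic < +oo)%E.
Proof. by rewrite lebesgue_measure_itv/=; case: ifP; rewrite -?EFinD ltry. Qed.

Lemma integrable_dirichlet_kernel (A y : R) :
  mu.-integrable `[0, A] (EFin \o (fun w => sin (w * y) / w)).
Proof.
apply: (@Rintegral_bounded _ _ _ _ _ _ `|y|).
- exact: measurable_itv.
- exact: lebesgue_measure_itvcc_lty.
- apply: measurable_funTS.
  exact: (measurableT_comp measurable_dirichlet_kernel (measurable_pair1 y)).
- by move=> w _; exact: ler_norm_dirichlet_kernel.
Qed.

Lemma dirichlet_intN (A y : R) : dirichlet_int A (- y) = - dirichlet_int A y.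
Proof.
rewrite /dirichlet_int -[RHS]mulN1r -RintegralZl//; last exact: integrable_dirichlet_kernel.
by apply: eq_Rintegral => w _; rewrite mulrN sinN mulNr mulN1r.
Qed.

Lemma dirichlet_int0 (A : R) : dirichlet_int A 0 = 0.
Proof.
rewrite /dirichlet_int; transitivity (\int[mu]_(w in `[0, A]) (0 : R)).
  by apply: eq_Rintegral => w _; rewrite mulr0 sin0 mul0r.
by rewrite Rintegral_cst// mul0r.
Qed.

(** Uniform in [A] and [y], hence usable for domination. If y A < 1, the kernel is at most y on an
    interval of length A; otherwise the value differs from pi/2 < 2 by at most 2. *)
Lemma ler_norm_dirichlet_int (A y : R) : `|dirichlet_int A y| <= 4.
Proof.
have [A0|A0] := leP A 0.
  rewrite /dirichlet_int; move: A0; rewrite le_eqVlt => /predU1P[->|A0].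
    by rewrite set_itv1 Rintegral_set1 normr0.
  by rewrite set_itv_ge ?Rintegral_set0 ?normr0// bnd_simp -ltNge.
wlog y0 : y / 0 < y.
  move=> h; have [|y0|<-] := ltgtP 0 y; first exact: h.
    by rewrite -[y]opprK dirichlet_intN normrN h// oppr_gt0.
  by rewrite dirichlet_int0 normr0.
have [yA|yA] := leP 1 (y * A); last first.
  apply: (@le_trans _ _ (y * A)); last by rewrite (le_trans (ltW yA))// ler1n.
  have -> : y * A = `|y| * fine (mu `[0, A]%classic).
    by rewrite lebesgue_measure_itv/= lte_fin A0/= subr0 gtr0_norm.
  apply: ler_norm_Rintegral_bounded => //.
  - exact: lebesgue_measure_itvcc_lty.
  - by apply/measurable_EFinP; have /integrableP[] := integrable_dirichlet_kernel A y.
  - by move=> w _; exact: ler_norm_dirichlet_kernel.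
have h := dirichlet_approx y0 A0.
have h1 : 2 / y * A^-1 <= 2.
  by rewrite -mulrA -invfM ler_pdivrMr ?mulr_gt0// ler_peMr.
have h2 := @pihalf_lt2 R; have h3 := @pihalf_ge1 R.
rewrite -/(dirichlet_int A y) in h.
move: h; rewrite !ler_norml => /andP[h4 h5]; apply/andP; split; lra.
Qed.

Lemma dirichlet_int_cvg (u : nat -> R) (y : R) : u n @[n --> \oo] --> +oo ->
  dirichlet_int (u n) y @[n --> \oo] --> pi / 2 * Num.sg y.
Proof.
move=> uoo.
have pos z : 0 < z -> dirichlet_int (u n) z @[n --> \oo] --> pi / 2.
  move=> z0; apply/cvgrPdistC_le => e e0.
  have /cvgryPgt/(_ (Num.max 0 (2 / z / e))) := uoo.
  apply: filterS => n; rewrite gt_max => /andP[un0 une].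
  apply: (le_trans (dirichlet_approx z0 un0)).
  by rewrite ler_pdivrMr// [e * _]mulrC -ler_pdivrMr// ltW.
have [y0|y0|<-] := ltgtP 0 y.
- by rewrite gtr0_sg// mulr1; exact: pos.
- rewrite ltr0_sg// mulrN1 (_ : (fun n => _) = fun n => - dirichlet_int (u n) (- y)).
    by apply: cvgN; apply: pos; rewrite oppr_gt0.
  by apply/funext => n; rewrite dirichlet_intN opprK.
- under eq_fun do rewrite dirichlet_int0.
  by rewrite sgr0 mulr0; exact: cvg_cst.
Qed.

End dirichlet_kernel.

Section levy_inversion.
Context {R : realType} d (T : measurableType d) (P : probability T R).
Notation mu := (@lebesgue_measure R).

Lemma probability_lty (D : set T) : measurable D -> (P D < +oo)%E.
Proof. by move=> mD; rewrite (le_lt_trans (probability_le1 P mD)) ?ltry. Qed.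

Lemma measurable_fun_sg : measurable_fun [set: measurableTypeR R] (@Num.sg R).
Proof.
rewrite (_ : @Num.sg R = (fun x => \1_`]0, +oo[%classic x - \1_`]-oo, 0[%classic x)).
  by apply: measurable_funB; apply: measurable_indic; exact: measurable_itv.
apply/funext => x; rewrite !indicE !mem_setE !in_itv/= andbT.
by have [x0|x0|<-] := ltgtP 0 x; rewrite ?(gtr0_sg x0) ?(ltr0_sg x0) ?sgr0 ?subr0 ?sub0r.
Qed.

Lemma ler_norm_sinB2 (x y : R) : `|sin x - sin y| <= `|x - y|.
Proof.
have [|c _] := @MVT_segment R sin cos (Num.min x y) (Num.max x y) _
    (fun c _ => is_derive_sin c) (continuous_subspaceT (@continuous_sin R)).
  by rewrite ge_min le_max lexx.
have [xy|yx] := leP x y => h.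
  by rewrite distrC h normrM (distrC x) ler_piMl// cos_max.
by rewrite h normrM ler_piMl// cos_max.
Qed.

Lemma measurable_sin_diff (Y : T -> R) (a b : R) : measurable_fun setT Y ->
  measurable_fun setT (fun z : measurableTypeR R * T =>
    (sin (z.1 * (Y z.2 - a)) - sin (z.1 * (Y z.2 - b))) / z.1).
Proof.
move=> mY; apply: measurable_funM; last by apply: measurableT_comp; first exact: measurable_fun_inv.
have ms c : measurable_fun setT (fun z : measurableTypeR R * T => sin (z.1 * (Y z.2 - c))).
  apply: measurableT_comp; first exact: measurable_fun_sin.
  apply: measurable_funM => //.
  by apply: measurable_funB => //; apply: (measurableT_comp mY); exact: measurable_snd.
exact: measurable_funB.
Qed.

Lemma ler_norm_sin_diff (y a b w : R) :
  `|(sin (w * (y - a)) - sin (w * (y - b))) / w| <= `|b - a|.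
Proof.
have [->|w0] := eqVneq w 0; first by rewrite invr0 mulr0 normr0.
rewrite normrM normfV ler_pdivrMr ?normr_gt0//.
apply: (le_trans (ler_norm_sinB2 _ _)).
by rewrite -mulrBr normrM mulrC (_ : y - a - (y - b) = b - a)//; ring.
Qed.

(** The kernel is bounded by |b - a|, so the integrals can be exchanged; the inner one is a
    difference of Dirichlet integrals, which tends to pi/2 times the signs while staying below 8.
    Signs encode the half weight of the endpoints. The set [D] is arbitrary because the formula on
    an event will be compared with the formula on the whole space. *)
Lemma levy_inversion (Y : T -> R) (D : set T) (a b : R) (u : nat -> R) :
  measurable_fun setT Y -> measurable D -> u n @[n --> \oo] --> +oo ->
  \int[mu]_(w in `[0, u n])
     \int[P]_(x in D) ((sin (w * (Y x - a)) - sin (w * (Y x - b))) / w)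
    @[n --> \oo] -->
  pi / 2 * \int[P]_(x in D) (Num.sg (Y x - a) - Num.sg (Y x - b)).
Proof.
move=> mY mD uoo.
have mYc c : measurable_fun setT (fun x => Y x - c) by exact: measurable_funB.
have mJ A c : measurable_fun setT (fun x => dirichlet_int A (Y x - c)).
  by apply: (measurableT_comp (measurable_dirichlet_int A)); exact: mYc.
have mS c : measurable_fun setT (fun x => Num.sg (Y x - c)).
  by apply: (measurableT_comp measurable_fun_sg); exact: mYc.
pose f (z : measurableTypeR R * T) : R :=
  (sin (z.1 * (Y z.2 - a)) - sin (z.1 * (Y z.2 - b))) / z.1.
have mf : measurable_fun setT f := measurable_sin_diff a b mY.
have FE A : \int[mu]_(w in `[0, A])
     \int[P]_(x in D) ((sin (w * (Y x - a)) - sin (w * (Y x - b))) / w) =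
   \int[P]_(x in D) (dirichlet_int A (Y x - a) - dirichlet_int A (Y x - b)).
  have -> := @Rfubini_bounded _ _ _ _ _ mu P `[0, A]%classic D f `|b - a|
    (measurable_itv _) mD (lebesgue_measure_itvcc_lty _ _) (probability_lty mD) mf _.
    apply: eq_Rintegral => x _.
    rewrite /dirichlet_int -RintegralB//; last 2 first.
    - exact: integrable_dirichlet_kernel.
    - exact: integrable_dirichlet_kernel.
    by apply: eq_Rintegral => w _; rewrite /f/= mulrBl.
  by move=> w x _ _; exact: ler_norm_sin_diff.
under eq_fun do rewrite FE.
have -> : pi / 2 * \int[P]_(x in D) (Num.sg (Y x - a) - Num.sg (Y x - b)) =
    \int[P]_(x in D) (pi / 2 * Num.sg (Y x - a) - pi / 2 * Num.sg (Y x - b)).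
  rewrite -RintegralZl//; first by apply: eq_Rintegral => x _; rewrite mulrBr.
  apply: (@Rintegral_bounded _ _ _ _ _ _ 2) => //.
  - exact: probability_lty.
  - by apply: measurable_funTS; exact: measurable_funB.
  - move=> x _; have sg1 (c : R) : `|Num.sg c| <= 1 by rewrite normr_sg lern1 leq_b1.
    by rewrite (le_trans (ler_normB _ _))// -[2]/(1 + 1) lerD.
apply: (@Rdominated_cvg _ _ _ P D _ _ (cst 8)) => //.
- by move=> n; apply: measurable_funTS; exact: measurable_funB.
- by apply: measurable_funTS; apply: measurable_funB; exact: measurable_funM.
- by apply: aeW => x _; apply: cvgB; exact: dirichlet_int_cvg.
- apply: (@Rintegral_bounded _ _ _ _ _ _ 8) => //; first exact: probability_lty.
  by move=> x _; rewrite /= ger0_norm.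
- move=> n x _; rewrite (le_trans (ler_normB _ _))//.
  have h1 := ler_norm_dirichlet_int (u n) (Y x - a).
  have h2 := ler_norm_dirichlet_int (u n) (Y x - b).
  rewrite /=; lra.
Qed.

End levy_inversion.

Section symmetric_integral.
Context {R : realType}.
Notation mu := (@lebesgue_measure R).

Lemma Rintegral_itv_sym (f : R -> R) (A M : R) : 0 <= A ->
  measurable_fun [set: measurableTypeR R] f -> (forall w, `|f w| <= M) ->
  \int[mu]_(w in `[- A, A]) f w = \int[mu]_(w in `[0, A]) (f w + f (- w)).
Proof.
move=> A0 mf fM.
have mfN : measurable_fun [set: measurableTypeR R] (f \o -%R).
  by apply: measurableT_comp.
have ib (g : R -> R) (a b : R) : measurable_fun [set: measurableTypeR R] g ->
    (forall w, `|g w| <= M) -> mu.-integrable `[a, b] (EFin \o g).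
  move=> mg gM; apply: (@Rintegral_bounded _ _ _ _ _ _ M); [exact: measurable_itv| | |].
  - exact: lebesgue_measure_itvcc_lty.
  - exact: measurable_funTS.
  - by move=> x _; exact: gM.
have negE : \int[mu]_(w in `[- A, 0]) f w = \int[mu]_(w in `[0, A]) f (- w).
  rewrite /Rintegral; congr fine.
  pose phi : measurableTypeR R -> measurableTypeR R := -%R.
  have mphi : measurable_fun setT phi by exact: measurable_funN.
  transitivity (\int[pushforward mu phi]_(w in `[(- A)%R, 0%R]) (f w)%:E)%E.
    apply: eq_measure_integral => B mB _; exact/esym/lebesgue_measureN.
  have pE : phi @^-1` `[- A, 0] = `[0, A]%classic.
    apply/seteqP; split => w; rewrite /phi/= !in_itv/= lerN2 oppr_le0;
    by move=> /andP[-> ->].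
  rewrite integral_pushforward ?pE//.
  - by apply/measurable_EFinP.
  - exact: ib.
have AA : mu.-integrable `[- A, A] (EFin \o f) by exact: ib.
have := Rintegral_itvB AA (x := 0); rewrite !bnd_simp oppr_le0 => /(_ A0 A0)/eqP.
rewrite subr_eq negE => /eqP ->.
rewrite Rintegral_itv_obnd_cbnd; last first.
  by apply: (integrableS _ _ _ (ib f 0 A mf fM)) => //; exact: subset_itv_oc_cc.
by rewrite RintegralD//; apply: ib.
Qed.

End symmetric_integral.

(** * Uniform partitions *)

Section grid.
Context {R : realType}.
Implicit Types (a b : R) (n j : nat).

Definition grid a b n j : R := a + (b - a) * (j%:R / n%:R).

Definition cell a b n j : set (measurableTypeR R) :=
  `]grid a b n j, grid a b n j.+1]%classic.

Lemma grid0 a b n : grid a b n 0 = a.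
Proof. by rewrite /grid mul0r mulr0 addr0. Qed.

Lemma grid_end a b n : (0 < n)%N -> grid a b n n = b.
Proof. by move=> n0; rewrite /grid divff ?pnatr_eq0 -?lt0n// mulr1 addrC subrK. Qed.

Lemma gridS a b n j : grid a b n j.+1 - grid a b n j = (b - a) / n%:R.
Proof. by rewrite /grid -natr1; ring. Qed.

Lemma le_grid a b n j k : a <= b -> (j <= k)%N -> grid a b n j <= grid a b n k.
Proof.
move=> ab jk; rewrite /grid lerD2l ler_wpM2l ?subr_ge0//.
by rewrite ler_wpM2r ?invr_ge0// ler_nat.
Qed.

Lemma grid_ge a b n j : a <= b -> a <= grid a b n j.
Proof. by move=> ab; rewrite -{1}(grid0 a b n) le_grid. Qed.

Lemma grid_le a b n j : a <= b -> (j <= n)%N -> grid a b n j <= b.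
Proof.
move=> ab jn; case: n jn => [|n] jn.
  by move: jn; rewrite leqn0 => /eqP ->; rewrite grid0.
by rewrite -{2}(grid_end a b (ltn0Sn n)) le_grid.
Qed.

Lemma measurable_cell a b n j : measurable (cell a b n j).
Proof. exact: measurable_itv. Qed.

Lemma cell_disjoint a b n j k : a <= b -> (j < k)%N ->
  cell a b n j `&` cell a b n k = set0.
Proof.
move=> ab jk; apply/seteqP; split => // r; rewrite /cell/= !in_itv/=.
move=> [/andP[_ rj] /andP[kr _]]; have := le_grid n ab jk.
by rewrite leNgt (lt_le_trans kr rj).
Qed.

Lemma cell_sub a b n j : a <= b -> (j < n)%N -> cell a b n j `<=` `]a, b]%classic.
Proof.
move=> ab jn r; rewrite /cell/= !in_itv/= => /andP[jr rj].
by rewrite (le_lt_trans (grid_ge _ _ ab) jr)/= (le_trans rj)// grid_le.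
Qed.

Lemma cell_cover a b n r : a < b -> (0 < n)%N -> `]a, b]%classic r ->
  exists2 j, (j < n)%N & cell a b n j r.
Proof.
move=> ab n0; rewrite /= in_itv/= => /andP[ar rb].
have ex : exists j, r <= grid a b n j by exists n; rewrite grid_end.
have := ex_minnP ex; case: ex_minnP => -[|j] rj min _.
  by move: rj; rewrite grid0 leNgt ar.
exists j; first by apply: min; rewrite grid_end.
rewrite /cell/= in_itv/= rj andbT ltNge; apply/negP => /min.
by rewrite ltnn.
Qed.

Lemma mesh_cvg0 a b : ((b - a) / n.+1%:R) @[n --> \oo] --> (0 : R).
Proof.
rewrite -(mulr0 (b - a)); apply: cvgMr; exact: cvg_harmonic.
Qed.

Lemma near_mesh_small a b (e : R) : 0 < e ->
  \forall n \near \oo, (b - a) / n.+1%:R < e.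
Proof.
move=> e0; have /cvgr0Pnorm_lt/(_ e e0) := mesh_cvg0 a b.
by apply: filterS => n; exact: le_lt_trans (ler_norm _).
Qed.

(** Stated up to an intermediate node to allow induction on [m]. The measure is left general: the
    lemma serves for Lebesgue measure, for the point configuration and for the law of R_1. *)
Lemma Rintegral_cells (kappa : {measure set (measurableTypeR R) -> \bar R})
    (f : R -> R) a b n m : a <= b -> (m <= n)%N ->
  kappa.-integrable `]a, b] (EFin \o f) ->
  \int[kappa]_(r in `]a, grid a b n m]) f r =
  \sum_(0 <= j < m) \int[kappa]_(r in cell a b n j) f r.
Proof.
move=> ab + fi; elim: m => [_|m IH mn].
  by rewrite big_nil grid0 set_itvoc0 Rintegral_set0.
rewrite big_nat_recr//= -IH ?(ltnW mn)//.
have sE : `]a, grid a b n m.+1]%classic = `]a, grid a b n m]%classic `|` cell a b n m.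
  apply/seteqP; split => r; rewrite /cell/= !in_itv/=.
    move=> /andP[ar rm]; have [rg|rg] := leP r (grid a b n m); first by left; rewrite ar.
    by right.
  move=> [/andP[-> rm]|/andP[rm ->]]; first by rewrite (le_trans rm)// le_grid.
  by rewrite andbT (le_lt_trans _ rm)// grid_ge.
have mI : measurable (`]a, grid a b n m]%classic : set (measurableTypeR R)).
  exact: measurable_itv.
rewrite sE Rintegral_setU//.
- exact: measurable_cell.
- rewrite -sE; apply: (integrableS _ _ _ fi); [exact: measurable_itv|exact: measurable_itv|].
  by apply: subset_itvl; rewrite bnd_simp grid_le.
- apply/disj_setPS => r; rewrite /cell/= !in_itv/= => -[/andP[_ rm] /andP[]].
  by rewrite ltNge rm.
Qed.

(** On a cell the error is at most C times the mesh times the integral of [g] over the cell, and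
    these integrals add up to a fixed number. It is used both with the density [lambda] against
    Lebesgue measure and with [g = 1] against the counting measure of the points. *)
Lemma riemann_cvg (kappa : {measure set (measurableTypeR R) -> \bar R})
    (g phi : R -> R) a b (C : R) : a < b -> 0 <= C ->
  kappa.-integrable `]a, b] (EFin \o g) -> (forall r, a < r -> 0 <= g r) ->
  measurable_fun (`]a, b]%classic : set (measurableTypeR R)) phi ->
  (forall r t, a <= r <= b -> a <= t <= b -> `|phi r - phi t| <= C * `|r - t|) ->
  \sum_(0 <= j < n.+1) phi (grid a b n.+1 j.+1) * \int[kappa]_(r in cell a b n.+1 j) g r
    @[n --> \oo] --> \int[kappa]_(r in `]a, b]) (phi r * g r).
Proof.
move=> ab C0 ig g0 mphi lip.
have mg : measurable_fun (`]a, b]%classic : set (measurableTypeR R)) g.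
  by apply/measurable_EFinP; have /integrableP[] := ig.
pose M := `|phi b| + C * (b - a).
have phiM r : `]a, b]%classic r -> `|phi r| <= M.
  rewrite /= in_itv/= => /andP[ar rb]; have := lip r b; rewrite lexx (ltW ab) rb (ltW ar).
  move=> /(_ isT isT) h; rewrite -[phi r](subrK (phi b)) (le_trans (ler_normD _ _))//.
  rewrite addrC lerD2l (le_trans h)// ler_wpM2l// ler0_norm ?subr_le0//.
  by rewrite opprB lerB// ltW.
have iphi : kappa.-integrable `]a, b] (EFin \o (fun r => phi r * g r)).
  have iM : kappa.-integrable `]a, b] (EFin \o (fun r => M * g r)).
    by apply: (eq_integrable _ _ _ _ (integrableZl _ M ig)) => //; exact: measurable_itv.
  apply: (le_integrable _ _ _ iM); first exact: measurable_itv.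
    by apply/measurable_EFinP; exact: measurable_funM.
  move=> r abr; have := abr; rewrite /= in_itv/= => /andP[ar _]; rewrite lee_fin !normrM ler_wpM2r//.
  by rewrite (le_trans (phiM _ abr))// ler_norm.
apply/cvgrPdist_le => e e0.
pose G := \int[kappa]_(r in `]a, b]) g r.
have G0 : 0 <= G.
  by apply: Rintegral_ge0 => r; rewrite /= in_itv/= => /andP[ar _]; exact: g0.
(* The summand 1 covers the case C G = 0. *)
have e0' : 0 < e / (C * G + 1) by rewrite divr_gt0// ltr_wpDl// mulr_ge0.
near=> n.
have nE : grid a b n.+1 n.+1 = b by rewrite grid_end.
have := Rintegral_cells (ltW ab) (leqnn n.+1) iphi; rewrite nE => ->.
rewrite -sumrB (le_trans (ler_norm_sum _ _ _))//.
have hE : (b - a) / n.+1%:R < e / (C * G + 1).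
  by near: n; exact: near_mesh_small.
have h0 : 0 <= (b - a) / n.+1%:R by rewrite divr_ge0// subr_ge0 ltW.
apply: (@le_trans _ _ (\sum_(0 <= j < n.+1)
    (C * ((b - a) / n.+1%:R)) * \int[kappa]_(r in cell a b n.+1 j) g r)); last first.
  rewrite -mulr_sumr -(Rintegral_cells (ltW ab) (leqnn n.+1) ig) nE -/G.
  move: hE; rewrite ltr_pdivlMr; last by rewrite ltr_wpDl// mulr_ge0.
  rewrite mulrDr mulr1 (mulrCA _ C) mulrA => hE.
  by rewrite (le_trans _ (ltW hE))// lerDl.
rewrite big_nat_cond [leRHS]big_nat_cond; apply: ler_sum => j; rewrite andbT => /= jn.
have sj : cell a b n.+1 j `<=` `]a, b] by exact: cell_sub (ltW ab) jn.
have mj := measurable_cell a b n.+1 j.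
have mab : measurable (`]a, b]%classic : set (measurableTypeR R)) by exact: measurable_itv.
have igj := integrableS mab mj sj ig.
have ipj := integrableS mab mj sj iphi.
rewrite -RintegralZl// -RintegralB//; last first.
  by apply: (eq_integrable _ _ _ _ (integrableZl _ (phi (grid a b n.+1 j.+1)) igj)).
apply: (le_trans (le_normr_Rintegral _ _)) => //.
  apply: (eq_integrable _ _ _ _ (integrableB mj ipj
    (integrableZl mj (phi (grid a b n.+1 j.+1)) igj))) => //.
rewrite -RintegralZl//; apply: le_Rintegral => //.
- apply: integrable_norm; apply: (eq_integrable _ _ _ _ (integrableB mj ipj
    (integrableZl mj (phi (grid a b n.+1 j.+1)) igj))) => //.
- by apply: (eq_integrable _ _ _ _ (integrableZl _ (C * ((b - a) / n.+1%:R)) igj)).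
move=> r rj; have := sj _ rj; rewrite /= in_itv/= => /andP[ar rb].
rewrite -mulrBl normrM (ger0_norm (g0 _ ar)) ler_wpM2r ?g0//.
have gj : a <= grid a b n.+1 j.+1 <= b by rewrite grid_ge ?(ltW ab)// grid_le// ltW.
apply: (le_trans (lip _ _ _ gj)); first by rewrite rb ltW.
rewrite ler_wpM2l// -(gridS a b n.+1 j).
move: rj; rewrite /cell/= in_itv/= => /andP[jr rj1].
by rewrite distrC ger0_norm ?subr_ge0// lerB// ltW.
Unshelve. all: by end_near. Qed.

End grid.

(** * Counts of the Poisson process *)

Section poisson_counts.
Context {R : realType} d (T : measurableType d) (P : probability T R).
Variables (lambda : R -> R) (dist : nat -> {RV P >-> R}).
Hypotheses (dens : bs_density lambda) (pp : poisson_process lambda dist).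
Notation mu := (@lebesgue_measure R).
Import Normc.

Definition mass (B : set R) : R := \int[mu]_(r in B) lambda r.
Definition poisson_weight (m : R) (n : nat) : R := m ^+ n / n`!%:R * expR (- m).
Definition pr (A : set T) : R := fine (P A).
Definition cnt (B : set R) (x : T) : R := fine (bs_count dist B x).

Lemma pr_ge0 A : 0 <= pr A. Proof. exact: fine_ge0. Qed.

Lemma prK A : measurable A -> (pr A)%:E = P A.
Proof. by move=> mA; rewrite /pr fineK// fin_num_measure. Qed.

Lemma pr_setD (A B : set T) : measurable A -> measurable B -> B `<=` A ->
  pr (A `\` B) = pr A - pr B.
Proof.
move=> mA mB BA; rewrite /pr measureD// ?fineB ?fin_num_measure//.
- by rewrite (setIidr BA).
- exact: measurableI.
- by rewrite (le_lt_trans (probability_le1 P mA)) ?ltry.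
Qed.

Lemma pr_setU (A B : set T) : measurable A -> measurable B -> A `&` B = set0 ->
  pr (A `|` B) = pr A + pr B.
Proof.
move=> mA mB AB; rewrite /pr measureU// fineD ?fin_num_measure//.
Qed.

Lemma measurable_density : measurable_fun (`[0, +oo[%classic : set (measurableTypeR R)) lambda.
Proof.
rewrite (_ : `[0, +oo[%classic = \bigcup_n `[0, n%:R]%classic :> set R).
  apply/measurable_fun_bigcup => n; first exact: measurable_itv.
  by apply/measurable_EFinP; have /integrableP[] := dens.2 n%:R (ler0n _ _).
apply/seteqP; split => r; rewrite /= in_itv/= ?andbT.
  move=> r0; exists (Num.truncn r).+1 => //=; rewrite in_itv/= r0/=.
  by have /truncn_itv/andP[_ /ltW] := r0.
by move=> [n _]; rewrite /= in_itv/= => /andP[].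
Qed.

Lemma integrable_density (B : set (measurableTypeR R)) (r : R) : measurable B ->
  0 <= r -> B `<=` `[0, r]%classic -> mu.-integrable B (EFin \o lambda).
Proof. by move=> mB r0 Br; apply: (integrableS _ _ Br (dens.2 r r0)) => //; exact: measurable_itv. Qed.

Lemma finite_mean_bounded (B : set (measurableTypeR R)) (r : R) : measurable B ->
  0 <= r -> B `<=` `[0, r]%classic -> finite_mean lambda B.
Proof.
move=> mB r0 Br; have iB := integrable_density mB r0 Br; split => //.
  by apply: (subset_trans Br) => t; rewrite /= !in_itv/= => /andP[-> _].
by rewrite /mean_measure; have := integrable_fin_num mB iB; rewrite fin_numElt => /andP[].
Qed.

Lemma mass_ge0 (B : set R) : B `<=` `[0, +oo[ -> 0 <= mass B.
Proof.
by move=> B0; apply: Rintegral_ge0 => r /B0; rewrite /= in_itv/= andbT => /dens.1.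
Qed.

Lemma measurable_dist k : measurable_fun [set: T] (dist k).
Proof. exact: measurable_funP. Qed.

Lemma measurable_bs_count (B : set (measurableTypeR R)) : measurable B ->
  measurable_fun setT (bs_count dist B).
Proof.
move=> mB; apply: (@ge0_emeasurable_sum _ _ _ setT
    (fun k x => (\d_(dist k x) B : \bar R)) xpredT) => // k _.
rewrite (_ : (fun x => _) = EFin \o (\1_B \o dist k))//.
apply/measurable_EFinP; apply: measurableT_comp; last exact: measurable_dist.
exact: measurable_indic.
Qed.

Lemma measurable_cnt (B : set (measurableTypeR R)) : measurable B ->
  measurable_fun setT (cnt B).
Proof. by move=> mB; apply: measurableT_comp => //; exact: measurable_bs_count. Qed.

Lemma measurable_count_event (B : set (measurableTypeR R)) n : measurable B ->
  measurable (count_event dist B n).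
Proof.
move=> mB; rewrite -[X in measurable X]setTI.
exact: (measurable_bs_count mB measurableT (emeasurable_set1 _)).
Qed.

Definition cev (s : seq (set R * nat)) : set T :=
  \big[setI/setT]_(q <- s) count_event dist q.1 q.2.

(** Disjointness is required between positions of the list, so the empty set may occur, even
    repeatedly; it does when a set of the later lists degenerates. *)
Definition good (l : seq (set R)) :=
  (forall i, (i < size l)%N -> finite_mean lambda (nth set0 l i)) /\
  (forall i j, (i < j < size l)%N -> nth set0 l i `&` nth set0 l j = set0).

Lemma good_take (l1 l2 : seq (set R)) : good (l1 ++ l2) -> good l1.
Proof.
move=> [gf gd]; split.
  move=> i il; have := gf i; rewrite nth_cat il size_cat; apply.
  by rewrite (leq_trans il)// leq_addr.
move=> i j /andP[ij jl]; have := gd i j; rewrite !nth_cat jl (ltn_trans ij jl) ij size_cat.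
by apply; rewrite (leq_trans jl)// leq_addr.
Qed.

Lemma good_nth (l : seq (set R)) B : good l -> B \in l -> finite_mean lambda B.
Proof. by move=> [gf _] Bl; rewrite -(nth_index set0 Bl); apply: gf; rewrite index_mem. Qed.

Lemma cevP (s : seq (set R * nat)) x : cev s x <->
  (forall i, (i < size s)%N ->
    count_event dist (nth (set0, 0%N) s i).1 (nth (set0, 0%N) s i).2 x).
Proof.
elim: s => [|q s IH]; first by rewrite /cev big_nil; split.
rewrite /cev big_cons; split.
  by move=> [qx /IH sx] [|i] //= il; exact: sx.
move=> h; split; first exact: (h 0%N).
by apply/IH => i il; exact: (h i.+1).
Qed.

Lemma cev_rcons s q : cev (rcons s q) = cev s `&` count_event dist q.1 q.2.
Proof. by rewrite /cev big_rcons/= setIC. Qed.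

Lemma measurable_cev s : good (map fst s) -> measurable (cev s).
Proof.
move=> [gf _]; rewrite /cev; elim: s gf => [|q s IH] gf; first by rewrite big_nil.
rewrite big_cons; apply: measurableI; last by apply: IH => i; exact: (gf i.+1).
by apply: measurable_count_event; have [] := gf 0%N isT.
Qed.

Lemma prob_cev s : good (map fst s) ->
  P (cev s) = (\prod_(q <- s) poisson_weight (mass q.1) q.2)%:E.
Proof.
move=> [gf gd]; pose z0 : set R * nat := (set0, 0%N).
have fE (i : 'I_(size s)) : nth set0 (map fst s) i = (nth z0 s i).1.
  by rewrite (nth_map z0).
have fm (i : 'I_(size s)) : finite_mean lambda (nth z0 s i).1.
  by rewrite -fE; apply: gf; rewrite size_map.
have dj (i j : 'I_(size s)) : i != j -> (nth z0 s i).1 `&` (nth z0 s j).1 = set0.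
  move=> ij; rewrite -!fE; have [ltij|ltji|/val_inj/eqP] := ltngtP i j.
  - by apply: gd; rewrite ltij size_map ltn_ord.
  - by rewrite setIC; apply: gd; rewrite ltji size_map ltn_ord.
  - by move=> ji; rewrite ji in ij.
have -> : cev s = \bigcap_(i : 'I_(size s)) count_event dist (nth z0 s i).1 (nth z0 s i).2.
  apply/seteqP; split => x; first by move=> /cevP h i _; exact: h.
  by move=> h; apply/cevP => i il; exact: (h (Ordinal il)).
rewrite pp.2// (big_nth z0) big_mkord.
rewrite (eq_bigr (fun i : 'I_(size s) => (poisson_weight (mass (nth z0 s i).1) (nth z0 s i).2)%:E)).
  by rewrite prodEFin.
by move=> i _; rewrite pp.1.
Qed.

Lemma pr_cev_rcons s q : good (map fst (rcons s q)) ->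
  pr (cev (rcons s q)) = pr (cev s) * poisson_weight (mass q.1) q.2.
Proof.
move=> g; rewrite /pr prob_cev// prob_cev/=.
  by rewrite big_rcons/= mulrC.
by move: g; rewrite map_rcons -cats1 => /good_take.
Qed.

Lemma poisson_weight0 m : poisson_weight m 0 = expR (- m).
Proof. by rewrite /poisson_weight expr0 fact0 divr1 mul1r. Qed.

Lemma poisson_weight1 m : poisson_weight m 1 = m * expR (- m).
Proof. by rewrite /poisson_weight expr1 factS fact0 muln1 divr1. Qed.

Lemma poisson_weight01_le1 (m : R) : 0 <= m -> expR (- m) * (1 + m) <= 1.
Proof.
move=> m0; rewrite -[leRHS](expRxMexpNx_1 m) mulrC ler_wpM2r ?expR_ge0//.
exact: expR_ge1Dx.
Qed.

(** From exp(-m) >= 1 - m, the two weights add up to at least (1 + m)(1 - m) = 1 - m^2. *)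
Lemma poisson_weight_ge2_le m : 0 <= m -> 1 - poisson_weight m 0 - poisson_weight m 1 <= m ^+ 2.
Proof.
move=> m0; rewrite poisson_weight0 poisson_weight1.
have m1 : 0 <= 1 + m by rewrite addr_ge0.
have := ler_wpM2l m1 (expR_ge1Dx (- m)); rewrite expr2; lra.
Qed.

Definition count_factor (L : seq (set R * R[i])) (x : T) : R[i] :=
  cexp (\sum_(q <- L) q.2 * (cnt q.1 x)%:C).

Lemma cnt_ge0 B x : 0 <= cnt B x.
Proof. by apply: fine_ge0; apply: nneseries_ge0 => k _ _; rewrite lee_fin. Qed.

Lemma normc_count_factor_le1 L x : all (fun q => complex.Re q.2 <= 0) L ->
  normc (count_factor L x) <= 1.
Proof.
move=> hL; apply: normc_cexp_le1; elim: L hL => [|q L IH] /=; first by rewrite big_nil.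
move=> /andP[q0 hL]; rewrite big_cons cReD -[leRHS]addr0 lerD ?IH//.
by rewrite cReM/= mulr0 subr0 mulr_le0_ge0// cnt_ge0.
Qed.

Lemma cmeasurable_count_factor D L : (forall q, q \in L -> measurable (q.1 : set (measurableTypeR R))) ->
  cmeasurable D (count_factor L).
Proof.
move=> mL; apply: cmeasurable_cexp; elim: L mL => [|q L IH] mL.
  rewrite (_ : (fun x => _) = fun=> 0); first exact: cmeasurable_cst.
  by apply/funext => x; rewrite big_nil.
rewrite (_ : (fun x => _) = fun x => q.2 * (cnt q.1 x)%:C + \sum_(q <- L) q.2 * (cnt q.1 x)%:C).
  apply: cmeasurableD; last by apply: IH => p pL; apply: mL; rewrite inE pL orbT.
  apply: cmeasurableM; first exact: cmeasurable_cst.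
  apply: cmeasurable_real; apply: measurable_funTS; apply: measurable_cnt.
  by apply: mL; rewrite mem_head.
by apply/funext => x; rewrite big_cons.
Qed.

(** The logarithm of the expectation of [count_factor L] if the counts are independent Poisson
    variables: a count of mean m contributes m (exp(z) - 1). *)
Definition poisson_exponent (L : seq (set R * R[i])) : R[i] :=
  \sum_(q <- L) (mass q.1)%:C * (cexp q.2 - 1).

Lemma normc_poisson_exponent_le1 L : all (fun q => complex.Re q.2 <= 0) L ->
  (forall q, q \in L -> finite_mean lambda q.1) ->
  normc (cexp (poisson_exponent L)) <= 1.
Proof.
move=> hL fL; apply: normc_cexp_le1; rewrite /poisson_exponent.
elim: L hL fL => [|q L IH] /=; first by rewrite big_nil.
move=> /andP[q0 hL] fL; rewrite big_cons cReD -[leRHS]addr0 lerD//; last first.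
  by apply: IH => // p pL; apply: fL; rewrite inE pL orbT.
rewrite cReM (_ : complex.Im (mass q.1)%:C = 0)// mul0r subr0.
apply: mulr_ge0_le0; first by apply: mass_ge0; have [] := fL q (mem_head _ _).
rewrite cReB subr_le0 (le_trans (ler_norm _))// (le_trans (ler_norm_Re _))//.
exact: normc_cexp_le1.
Qed.

(* Only the events "no point" and "one point" in each cell contribute to the
   main term; the probability of two points or more is quadratically small. *)
Lemma factor_expectation (s : seq (set R * nat)) (L : seq (set R * R[i])) :
  all (fun q => complex.Re q.2 <= 0) L -> good (map fst s ++ map fst L) ->
  normc (Cintegral P (cev s) (count_factor L) - (pr (cev s))%:C * cexp (poisson_exponent L)) <=
  6 * pr (cev s) * \sum_(q <- L) mass q.1 ^+ 2.
Proof.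
(* The induction moves the first cell into the conditioning event, with count 0 or with count 1;
   this is why [s] is arbitrary. *)
elim: L s => [|[J z] L IH] s.
  move=> _; rewrite cats0 => g; have ms := measurable_cev g.
  rewrite /poisson_exponent !big_nil cexp0 mulr1 mulr0.
  rewrite (eq_Cintegral _ (g := fun=> 1)).
    by rewrite Cintegral_cst// mul1r subrr normc0.
  by move=> x _; rewrite /count_factor big_nil cexp0.
move=> /andP[z0 hL] g; have {}z0 : complex.Re z <= 0 := z0; have {}g : good (map fst s ++ J :: map fst L) := g; set p := pr (cev s); set m := mass J; set c := cexp z.
have gs := good_take g; have ms := measurable_cev gs.
have gr n : good (map fst (rcons s (J, n)) ++ map fst L).
  by rewrite map_rcons/= cat_rcons.
have gn n := good_take (gr n); have mr n := measurable_cev (gn n).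
have gJ : finite_mean lambda J by apply: (good_nth g); rewrite mem_cat mem_head orbT.
have mJ : measurable (J : set (measurableTypeR R)) by case: gJ.
have m0 : 0 <= m by apply: mass_ge0; case: gJ.
have p0 : 0 <= p by exact: pr_ge0.
have pE n : pr (cev (rcons s (J, n))) = p * poisson_weight m n by rewrite pr_cev_rcons.
have mL q : q \in (J, z) :: L -> measurable (q.1 : set (measurableTypeR R)).
  move=> qL; suff [] : finite_mean lambda q.1 by [].
  by apply: (good_nth g); rewrite mem_cat -[_ :: _]/(map fst ((J, z) :: L)); apply/orP; right; apply/mapP; exists q.
have mL' q : q \in L -> measurable (q.1 : set (measurableTypeR R)).
  by move=> qL; apply: mL; rewrite inE qL orbT.
pose E n := cev (rcons s (J, n)).
have Es n : E n `<=` cev s by rewrite /E cev_rcons; exact: subIsetl.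
have E01 : E 0%N `&` E 1%N = set0.
  apply/seteqP; split => // x; rewrite /E !cev_rcons /count_event/=.
  by move=> [[_ ->] [_ /eqP]]; rewrite eqe eqr_nat.
have EF n x : E n x -> count_factor ((J, z) :: L) x = cexp (z * n%:R%:C) * count_factor L x.
  rewrite /E cev_rcons => -[_]; rewrite /count_event/= => JE.
  by rewrite /count_factor big_cons cexpD /cnt/= JE.
have F1 x : normc (count_factor ((J, z) :: L) x) <= 1 by apply: normc_count_factor_le1; rewrite /= z0.
have F1' x : normc (count_factor L x) <= 1 by exact: normc_count_factor_le1.
have mF D := @cmeasurable_count_factor D _ mL.
have mF' D := @cmeasurable_count_factor D _ mL'.
have PD D : measurable D -> (P D < +oo)%E by exact: probability_lty.
have iF D : measurable D -> Cintegrable P D (count_factor ((J, z) :: L)).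
  by move=> mD; apply: (@Cintegrable_bounded _ _ _ _ _ _ 1) => //; exact: PD.
have iF' D : measurable D -> Cintegrable P D (count_factor L).
  by move=> mD; apply: (@Cintegrable_bounded _ _ _ _ _ _ 1) => //; exact: PD.
pose rest := cev s `\` (E 0%N `|` E 1%N).
have mE01 : measurable (E 0%N `|` E 1%N) by apply: measurableU; exact: mr.
have mrest : measurable rest by exact: measurableD.
have prest : pr rest <= p * m ^+ 2.
  rewrite pr_setD//; last by move=> x [/Es|/Es].
  rewrite pr_setU//; [|exact: mr|exact: mr].
  rewrite !pE -/p (_ : p - _ = p * (1 - poisson_weight m 0 - poisson_weight m 1)); last by ring.
  by rewrite ler_wpM2l// poisson_weight_ge2_le.
have split : Cintegral P (cev s) (count_factor ((J, z) :: L)) =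
    Cintegral P (E 0%N) (count_factor L) + c * Cintegral P (E 1%N) (count_factor L) +
    Cintegral P rest (count_factor ((J, z) :: L)).
  have sE : cev s = (E 0%N `|` E 1%N) `|` rest.
    by rewrite /rest setDE setUIr setUCr setIT; apply/esym/setUidr => x [/Es|/Es].
  rewrite [in LHS]sE Cintegral_setU//; last 2 first.
  - by apply/disj_setPS => x [h [_]]; exact.
  - by rewrite -sE; exact: iF.
  rewrite Cintegral_setU//; [|exact: mr|exact: mr|by apply/disj_setPS; rewrite E01|exact: iF].
  congr (_ + _ + _).
    by apply: eq_Cintegral => x; rewrite inE => /EF ->; rewrite rmorph0 mulr0 cexp0 mul1r.
  rewrite -CintegralZl//; [|exact: mr|by apply: iF'; exact: mr].
  by apply: eq_Cintegral => x; rewrite inE => /EF ->; rewrite rmorph1 mulr1.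
set W := cexp (poisson_exponent L).
have W1 : normc W <= 1.
  apply: normc_poisson_exponent_le1 => // q qL; apply: (good_nth g).
  rewrite mem_cat -[_ :: _]/(map fst ((J, z) :: L)); apply/orP; right; apply/mapP.
  by exists q => //; rewrite inE qL orbT.
set S := \sum_(q <- L) mass q.1 ^+ 2.
have S0 : 0 <= S by apply: sumr_ge0 => q _; exact: sqr_ge0.
have c1 : normc c <= 1 by exact: normc_cexp_le1.
have h0 := IH (rcons s (J, 0%N)) hL (gr 0%N).
have h1 := IH (rcons s (J, 1%N)) hL (gr 1%N).
rewrite -/S -/W pE poisson_weight0 in h0; rewrite -/S -/W pE poisson_weight1 in h1.
have hr : normc (Cintegral P rest (count_factor ((J, z) :: L))) <= 2 * (p * m ^+ 2).
  apply: (le_trans (@normc_Cintegral_le _ _ _ _ _ _ 1 mrest (PD _ mrest) (mF _) _)) => //.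
  by rewrite mulr1 ler_wpM2l.
(* The two retained terms give exp(-m)(1 + c m) in place of exp(m (c - 1)). Their difference is
   exp(-m) times the second-order remainder of exp at c m, whose factor exp(m) cancels exp(-m). *)
have hm : normc ((p * expR (- m))%:C * (1 + c * m%:C) * W - p%:C * (cexp (m%:C * (c - 1)) * W)) <=
    4 * p * m ^+ 2.
  have -> : (p * expR (- m))%:C * (1 + c * m%:C) * W - p%:C * (cexp (m%:C * (c - 1)) * W) =
      - ((p * expR (- m))%:C * (cexp (m%:C * c) - 1 - m%:C * c) * W).
    have -> : m%:C * (c - 1) = (- m)%:C + m%:C * c by rewrite rmorphN/=; ring.
    by rewrite cexpD cexp_real rmorphM/=; ring.
  rewrite normcN 2!normcM normc_real ger0_norm; last by rewrite mulr_ge0 ?expR_ge0.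
  have hc : normc (m%:C * c) <= m.
    by rewrite normcM normc_real (ger0_norm m0) ler_piMr.
  have hB := normc_cexpB1B hc.
  apply: (@le_trans _ _ (p * expR (- m) * (4 * m ^+ 2 * expR m) * 1)).
    have pe : 0 <= p * expR (- m) by rewrite mulr_ge0 ?expR_ge0.
    exact: (ler_pM (mulr_ge0 pe (normc_ge0 _)) (normc_ge0 W) (ler_wpM2l pe hB) W1).
  rewrite [leLHS](_ : _ = 4 * p * m ^+ 2 * (expR m * expR (- m))); last by ring.
  by rewrite expRxMexpNx_1 mulr1.
have expE : poisson_exponent ((J, z) :: L) = m%:C * (c - 1) + poisson_exponent L.
  by rewrite /poisson_exponent big_cons.
have SE : \sum_(q <- (J, z) :: L) mass q.1 ^+ 2 = m ^+ 2 + S by rewrite big_cons.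
rewrite split SE expE cexpD -/W.
set I0 := Cintegral P (E 0%N) _ in h0 *; set I1 := Cintegral P (E 1%N) _ in h1 *.
set I2 := Cintegral P rest _ in hr *.
have -> : I0 + c * I1 + I2 - p%:C * (cexp (m%:C * (c - 1)) * W) =
  (I0 - (p * expR (- m))%:C * W) + c * (I1 - (p * (m * expR (- m)))%:C * W) + I2 +
  ((p * expR (- m))%:C * (1 + c * m%:C) * W - p%:C * (cexp (m%:C * (c - 1)) * W)).
  by rewrite !rmorphM/=; ring.
have h1' : normc (c * (I1 - (p * (m * expR (- m)))%:C * W)) <= 6 * (p * (m * expR (- m))) * S.
  rewrite normcM -[leRHS]mul1r ler_pM ?normc_ge0//.
apply: (le_trans (ler_normcD _ _)).
apply: (le_trans (lerD (le_trans (ler_normcD _ _) (lerD (le_trans (ler_normcD _ _)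
   (lerD h0 h1')) hr)) hm)).
(* The errors inherited from the induction have weights p exp(-m) and p m exp(-m), together at most
   p. The new cell adds 2 p m^2 for its multiple points and 4 p m^2 for the expansion, hence the
   constant 6. *)
have h3 : p * S * (expR (- m) * (1 + m)) <= p * S * 1.
  by rewrite ler_wpM2l ?mulr_ge0// poisson_weight01_le1.
move: h3; rewrite expr2; lra.
Qed.

End poisson_counts.

(** * Sums over the points *)

Section point_sums.
Context {R : realType} d (T : measurableType d) (P : probability T R).
Variables (lambda : R -> R) (dist : nat -> {RV P >-> R}).
Hypotheses (scs : canonical_SCS lambda dist).
Hypothesis PI_fin : {ae P, forall x, (ext_interference dist x < +oo)%E}.
Notation mass := (@mass R lambda).
Notation cnt := (cnt dist).

Let dens : bs_density lambda. Proof. by case: scs. Qed.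
Let pp : poisson_process lambda dist. Proof. by case: scs. Qed.

(** Viewing the configuration as a measure turns sums over the points into integrals, to which the
    lemmas on partitions apply. *)
Definition points (x : T) : {measure set (measurableTypeR R) -> \bar R} :=
  mseries (fun k => dirac (dist k x : measurableTypeR R)) 0.

Definition ext_point_sum (B : set (measurableTypeR R)) (x : T) : \bar R :=
  (\int[points x]_(r in B) (r^-1)%:E)%E.

Definition point_sum (B : set (measurableTypeR R)) (x : T) : R :=
  \int[points x]_(r in B) r^-1.

Lemma ext_point_sumE (B : set (measurableTypeR R)) x : measurable B ->
  B `<=` `[0, +oo[ ->
  ext_point_sum B x = (\sum_(k <oo) (\1_B (dist k x) * (dist k x)^-1)%:E)%E.
Proof.
move=> mB B0; rewrite /ext_point_sum ge0_integral_measure_series//.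
- apply: eq_eseriesr => k _; rewrite integral_dirac//.
  by apply/measurable_EFinP; apply: measurable_funTS; exact: measurable_fun_inv.
- by move=> r /B0; rewrite /= in_itv/= andbT lee_fin invr_ge0.
- by apply/measurable_EFinP; apply: measurable_funTS; exact: measurable_fun_inv.
Qed.

Lemma measurable_ext_point_sum (B : set (measurableTypeR R)) : measurable B ->
  B `<=` `[0, +oo[ -> measurable_fun setT (ext_point_sum B).
Proof.
move=> mB B0.
rewrite (_ : ext_point_sum B = fun x => (\sum_(k <oo) (\1_B (dist k x) * (dist k x)^-1)%:E)%E);
  last by apply/funext => x; exact: ext_point_sumE.
apply: (@ge0_emeasurable_sum _ _ _ setT
    (fun k x => (\1_B (dist k x) * (dist k x)^-1)%:E : \bar R) xpredT).
  move=> k x _ _; rewrite lee_fin indicE.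
  have [/set_mem/B0|_] := boolP (dist k x \in B); last by rewrite mul0r.
  by rewrite /= in_itv/= andbT mul1r invr_ge0.
move=> k _; apply/measurable_EFinP; apply: measurable_funM.
  apply: measurableT_comp; last exact: measurable_dist.
  exact: measurable_indic.
apply: measurableT_comp; first exact: measurable_fun_inv.
exact: measurable_dist.
Qed.

Lemma measurable_point_sum (B : set (measurableTypeR R)) : measurable B ->
  B `<=` `[0, +oo[ -> measurable_fun setT (point_sum B).
Proof.
by move=> mB B0; apply: measurableT_comp => //; exact: measurable_ext_point_sum.
Qed.

Lemma point_sum_ge0 (B : set (measurableTypeR R)) x : B `<=` `[0, +oo[ ->
  0 <= point_sum B x.
Proof.
move=> B0; apply: Rintegral_ge0 => r /B0.
by rewrite /= in_itv/= andbT invr_ge0.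
Qed.

(** The sample points on which the pathwise arguments run. A point at the origin has to be excluded
    because its inverse would be the default value 0. *)
Definition regular (x : T) := [/\ (forall k, 0 <= dist k x <= dist k.+1 x),
  bs_count dist [set 0] x = 0%E & (ext_interference dist x < +oo)%E].

Lemma mass_set1 (a : R) : mass [set a] = 0.
Proof. exact: Rintegral_set1. Qed.

Lemma finite_mean_set0 : finite_mean lambda [set 0].
Proof.
apply: (finite_mean_bounded dens (r := 0)) => //.
by move=> r ->; rewrite /= in_itv/= lexx.
Qed.

(** The only clause that is not assumed is the absence of a point at the origin: the singleton has
    mass 0, so the Poisson law gives count 0 with probability 1. *)
Lemma ae_regular : {ae P, forall x, regular x}.
Proof.
have sorted : {ae P, forall x k, 0 <= dist k x <= dist k.+1 x} by case: scs.
have zero : {ae P, forall x, bs_count dist [set 0] x = 0%E}.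
  have fm := finite_mean_set0.
  have m0 : measurable ([set 0] : set (measurableTypeR R)) by exact: measurable_set1.
  have mc := measurable_count_event dist 0 m0.
  have Pc : P (count_event dist [set 0] 0) = 1%E.
    have m0E : fine (mean_measure lambda [set 0]) = 0 by exact: mass_set1.
    by rewrite pp.1// m0E oppr0 expR0 expr0 fact0 divr1 mulr1.
  exists (~` count_event dist [set 0] 0); split.
  - exact: measurableC.
  - by rewrite probability_setC// Pc subee.
  - by move=> x; apply: contra_not.
by apply: filterS3 sorted zero PI_fin => x.
Qed.

Lemma regular_gt0 x k : regular x -> 0 < dist k x.
Proof.
move=> [s z _]; have /andP[k0 _] := s k; rewrite lt_neqAle k0 andbT; apply/eqP => k0'.
have : (1 <= bs_count dist [set 0%R] x)%E.
  rewrite /bs_count (nneseriesD1 (n := k))//.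
  rewrite diracE -k0' mem_set// leeDl//.
  by apply: nneseries_ge0 => i _ _; rewrite lee_fin.
by rewrite z lee_fin ler10.
Qed.

Lemma regular_le x j k : regular x -> (j <= k)%N -> dist j x <= dist k x.
Proof.
move=> [s _ _]; elim: k => [|k IH]; first by rewrite leqn0 => /eqP ->.
rewrite leq_eqVlt => /predU1P[->//|]; rewrite ltnS => /IH/le_trans; apply.
by have /andP[] := s k.
Qed.

(** The sum over [B] is at most 1/R_1 plus the interference, whose series starts at the second
    point. *)
Lemma regular_ext_point_sum x (B : set (measurableTypeR R)) : regular x ->
  measurable B -> B `<=` `[0, +oo[ -> (ext_point_sum B x < +oo)%E.
Proof.
move=> rx mB B0; have [_ _ pi] := rx.
have p k := regular_gt0 k rx.
apply: (@le_lt_trans _ _ (((dist 0%N x)^-1)%:E + ext_interference dist x)%E); last first.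
  by rewrite lte_add_pinfty// ltry.
rewrite ext_point_sumE// /ext_interference -(nneseries_recl (P := xpredT)
  (f := fun k => ((dist k x)^-1)%:E))//; last first.
  by move=> k _; rewrite lee_fin invr_ge0 ltW.
apply: lee_nneseries => k _.
  by rewrite lee_fin mulr_ge0// invr_ge0 ltW.
by rewrite lee_fin ler_piMl ?invr_ge0 ?(ltW (p k))// indicE lern1 leq_b1.
Qed.

Lemma regular_integrable x (B : set (measurableTypeR R)) : regular x ->
  measurable B -> B `<=` `[0, +oo[ ->
  (points x).-integrable B (EFin \o (fun r => r^-1)).
Proof.
move=> rx mB B0; apply: ge0_Rintegrable.
- by apply: measurable_funTS; exact: measurable_fun_inv.
- by move=> r /B0; rewrite /= in_itv/= andbT invr_ge0.
- exact: regular_ext_point_sum.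
Qed.

(** Each point of []a, b]] contributes at least 1/b to a finite sum of inverses. *)
Lemma regular_count_lty x (a b : R) : regular x -> 0 <= a ->
  (points x `]a, b]%classic < +oo)%E.
Proof.
move=> rx a0; have [ab|ab] := leP b a.
  by rewrite set_itv_ge ?measure0// bnd_simp -leNgt.
have mI : measurable (`]a, b]%classic : set (measurableTypeR R)) by exact: measurable_itv.
have I0 : (`]a, b]%classic : set R) `<=` `[0, +oo[%classic.
  by move=> r; rewrite /= !in_itv/= andbT => /andP[/ltW + _]; exact: le_trans.
have b0 : 0 < b by exact: le_lt_trans ab.
have : (b^-1%:E * points x `]a, b]%classic < +oo)%E.
  apply: le_lt_trans (regular_ext_point_sum rx mI I0).
  rewrite -integral_cst// /ext_point_sum; apply: ge0_le_integral => //.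
  - by move=> r _; rewrite lee_fin invr_ge0 ltW.
  - by apply/measurable_EFinP; apply: measurable_funTS; exact: measurable_fun_inv.
  - move=> r; rewrite /= in_itv/= => /andP[ar rb]; rewrite lee_fin lef_pV2//.
    by rewrite posrE (le_lt_trans a0).
move=> h; rewrite ltNge leye_eq; apply/eqP => e; move: h.
by rewrite e gt0_muley ?lte_fin ?invr_gt0// ltxx.
Qed.

Lemma regular_riemann x (b M : R) : regular x -> 0 < b -> b < M ->
  \sum_(0 <= j < n.+1) (grid b M n.+1 j.+1)^-1 * cnt (cell b M n.+1 j) x
    @[n --> \oo] --> point_sum `]b, M] x.
Proof.
move=> rx b0 bM.
have mI : measurable (`]b, M]%classic : set (measurableTypeR R)) by exact: measurable_itv.
(* Integrating 1 over a cell against [points x] gives its count, and the inverse is Lipschitz with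
   constant b^-2 on [b, M]. *)
have := @riemann_cvg _ (points x) (cst 1) (fun r => r^-1) b M (b ^- 2) bM.
rewrite invr_ge0 sqr_ge0 => /(_ isT).
rewrite (_ : (fun n => _) = fun n => \sum_(0 <= j < n.+1) (grid b M n.+1 j.+1)^-1 *
    cnt (cell b M n.+1 j) x); last first.
  apply/funext => n; apply: eq_bigr => j _; rewrite Rintegral_cst ?mul1r//.
  exact: measurable_cell.
have -> : \int[points x]_(r in `]b, M]) (r^-1 * cst 1 r) = point_sum `]b, M] x.
  by apply: eq_Rintegral => r _; rewrite mulr1.
apply=> //.
- apply: (@Rintegral_bounded _ _ _ _ _ _ 1) => //.
    exact: regular_count_lty (ltW b0).
  by move=> r _; rewrite /= normr1.
- by apply: measurable_funTS; exact: measurable_fun_inv.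
- move=> r t /andP[br _] /andP[bt _].
  have r0 := lt_le_trans b0 br; have t0 := lt_le_trans b0 bt.
  have -> : r^-1 - t^-1 = (r * t)^-1 * (t - r).
    by field; rewrite !lt0r_neq0.
  rewrite normrM distrC ler_wpM2r// gtr0_norm ?invr_gt0 ?mulr_gt0//.
  by rewrite lef_pV2 ?posrE ?exprn_gt0 ?mulr_gt0// expr2 ler_pM// ltW.
Qed.

End point_sums.

(** * Campbell's formula *)

Section campbell.
Context {R : realType} d (T : measurableType d) (P : probability T R).
Variables (lambda : R -> R) (dist : nat -> {RV P >-> R}).
Hypotheses (scs : canonical_SCS lambda dist).
Hypothesis PI_fin : {ae P, forall x, (ext_interference dist x < +oo)%E}.
Notation mu := (@lebesgue_measure R).
Notation mass := (@mass R lambda).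
Notation cnt := (cnt dist).
Notation good := (good lambda).
Notation cev := (cev dist).
Notation point_sum := (point_sum dist).
Notation pr := (pr P).
Import Normc.

Let dens : bs_density lambda. Proof. by case: scs. Qed.
Let pp : poisson_process lambda dist. Proof. by case: scs. Qed.

Lemma integrable_density_oc (a b : R) : 0 <= a ->
  mu.-integrable `]a, b] (EFin \o lambda).
Proof.
move=> a0; have [ab|ab] := leP b a.
  by rewrite set_itv_ge ?bnd_simp -?leNgt//; exact: integrable_set0.
apply: (@integrable_density _ _ dens _ b); first exact: measurable_itv.
  by rewrite (le_trans a0)// ltW.
by move=> r; rewrite /= !in_itv/= => /andP[ar ->]; rewrite (le_trans a0)// ltW.
Qed.

(** Absolute continuity of the integral of [lambda]; the bound is uniform in [j] because all cells
    have the same length. *)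
Lemma near_mass_cells_small (a b e : R) : 0 <= a -> a < b -> 0 < e ->
  \forall n \near \oo, forall j, (j < n.+1)%N -> mass (cell a b n.+1 j) <= e.
Proof.
move=> a0 ab e0; pose f := lambda \_ `]a, b].
have mI : measurable (`]a, b]%classic : set (measurableTypeR R)) by exact: measurable_itv.
have fi : mu.-integrable setT (EFin \o f).
  have := integrable_density_oc b a0; rewrite integrable_mkcond//.
  by apply: eq_integrable => // r _; rewrite /f/= restrict_EFin.
have [dl [dl0 h]] := integral_normr_continuous fi e0.
have := near_mesh_small a b dl0; apply: filterS => n nh j jn.
have mc := measurable_cell a b n.+1 j.
have gj : grid a b n.+1 j < grid a b n.+1 j.+1.
  by rewrite -subr_gt0 gridS divr_gt0// subr_gt0.
have muE : mu (cell a b n.+1 j) = ((b - a) / n.+1%:R)%:E.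
  by rewrite /cell lebesgue_measure_itv/= lte_fin gj -EFinD gridS.
have mudl : (mu (cell a b n.+1 j) < dl%:E)%E by rewrite muE lte_fin.
have /ltW := h _ mc mudl; apply: le_trans.
rewrite le_eqVlt; apply/orP; left; apply/eqP; apply: eq_Rintegral => r; rewrite inE.
move=> /(cell_sub (ltW ab) jn) rab.
rewrite /f patchE mem_set// ger0_norm//; apply: dens.1.
by move: rab; rewrite /= in_itv/= => /andP[ar _]; rewrite (le_trans a0)// ltW.
Qed.

Lemma mass_cell_ge0 (a b : R) n j : 0 <= a -> a < b -> 0 <= mass (cell a b n j).
Proof.
move=> a0 ab; apply: (mass_ge0 dens) => r.
rewrite /cell/= !in_itv/= andbT => /andP[jr _].
by rewrite (le_trans a0)// (le_trans (grid_ge n j (ltW ab)))// ltW.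
Qed.

Lemma sum_mass_cells (a b : R) n : 0 <= a -> a < b ->
  \sum_(0 <= j < n.+1) mass (cell a b n.+1 j) = mass `]a, b].
Proof.
move=> a0 ab; have := Rintegral_cells (ltW ab) (leqnn n.+1) (integrable_density_oc b a0).
by rewrite grid_end.
Qed.

(** The sum of squares is at most the largest mass of a cell times the total mass. *)
Lemma sum_mass_sqr_cvg0 (a b : R) : 0 <= a -> a < b ->
  \sum_(0 <= j < n.+1) mass (cell a b n.+1 j) ^+ 2 @[n --> \oo] --> 0.
Proof.
move=> a0 ab; apply/cvgr0Pnorm_le => e e0.
have m0 : 0 <= mass `]a, b].
  apply: (mass_ge0 dens) => r; rewrite /= !in_itv/= andbT => /andP[ar _].
  by rewrite (le_trans a0)// ltW.
have e0' : 0 < e / (mass `]a, b] + 1) by rewrite divr_gt0// ltr_wpDl.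
have := near_mass_cells_small a0 ab e0'; apply: filterS => n h.
rewrite ger0_norm; last by apply: sumr_ge0 => j _; exact: sqr_ge0.
apply: (@le_trans _ _ (\sum_(0 <= j < n.+1) e / (mass `]a, b] + 1) * mass (cell a b n.+1 j))).
  rewrite big_nat_cond [leRHS]big_nat_cond; apply: ler_sum => j; rewrite andbT => /= jn.
  by rewrite expr2 ler_wpM2r ?h ?mass_cell_ge0.
rewrite -mulr_sumr sum_mass_cells// mulrAC ler_pdivrMr ?ltr_wpDl//.
by rewrite ler_pM2l// lerDl.
Qed.

Lemma good_cat (l1 l2 : seq (set R)) : good l1 -> good l2 ->
  (forall A B, A \in l1 -> B \in l2 -> A `&` B = set0) -> good (l1 ++ l2).
Proof.
move=> [f1 d1] [f2 d2] d12; split.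
  move=> i; rewrite nth_cat size_cat; case: (ltnP i (size l1)) => [il _|il il2].
    exact: f1.
  by apply: f2; rewrite ltn_subLR.
move=> i j /andP[ij]; rewrite size_cat !nth_cat; case: (ltnP j (size l1)) => jl jl2.
  by rewrite (ltn_trans ij jl); apply: d1; rewrite ij.
case: (ltnP i (size l1)) => il.
  by apply: d12; apply: mem_nth => //; rewrite ltn_subLR.
by apply: d2; rewrite ltn_sub2r ?(leq_ltn_trans il)//= ltn_subLR.
Qed.

Lemma finite_mean_cell (a b : R) n j : 0 <= a -> a < b -> (j < n)%N ->
  finite_mean lambda (cell a b n j).
Proof.
move=> a0 ab jn; apply: (finite_mean_bounded dens (r := b)).
- exact: measurable_cell.
- by rewrite (le_trans a0)// ltW.
move=> r /(cell_sub (ltW ab) jn); rewrite /= !in_itv/= => /andP[ar ->].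
by rewrite (le_trans a0)// ltW.
Qed.

Lemma good_cells (a b : R) n : 0 <= a -> a < b ->
  good [seq cell a b n j | j <- index_iota 0 n].
Proof.
move=> a0 ab; split.
  move=> i; rewrite size_map size_iota subn0 => il.
  rewrite (nth_map 0%N) ?size_iota ?subn0// nth_iota ?subn0// add0n.
  exact: finite_mean_cell.
move=> i j; rewrite size_map size_iota subn0 => /andP[ij jl].
rewrite !(nth_map 0%N) ?size_iota ?subn0 ?(ltn_trans ij)//.
rewrite !nth_iota ?subn0 ?(ltn_trans ij)// !add0n.
exact: cell_disjoint (ltW ab) ij.
Qed.

(** Weights for which [count_factor] is the exponential of z times a Riemann sum of the sum of 1/r
    over the points of []b, M]]. *)
Definition cell_weights (b M : R) (z : R[i]) n : seq (set R * R[i]) :=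
  [seq (cell b M n.+1 j : set R, z / (grid b M n.+1 j.+1)%:C) | j <- index_iota 0 n.+1].

Lemma Re_scaled (z : R[i]) (r : R) : complex.Re (z * r%:C) = complex.Re z * r.
Proof. by rewrite cReM mulr0 subr0. Qed.

Lemma inv_real (r : R) : (r%:C)^-1 = (r^-1)%:C.
Proof. by rewrite fmorphV. Qed.

(** The logarithm of the expectation of exp(z S), where S is the sum of 1/r over the points of [B].
    Imaginary z gives characteristic functions; z = -1 will give the integrability of
    lambda(r)/r. *)
Definition campbell_exponent (B : set (measurableTypeR R)) (z : R[i]) : R[i] :=
  Cintegral mu B (fun r => (cexp (z / r%:C) - 1) * (lambda r)%:C).

Lemma normc_cexp_div_le1 (z : R[i]) (r : R) : complex.Re z <= 0 -> 0 < r ->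
  normc (cexp (z / r%:C)) <= 1.
Proof.
move=> z0 r0; apply: normc_cexp_le1.
by rewrite inv_real Re_scaled mulr_le0_ge0// invr_ge0 ltW.
Qed.

Lemma normc_cexp_div_lip (z : R[i]) (b r t : R) : complex.Re z <= 0 -> 0 < b ->
  b <= r -> b <= t ->
  normc (cexp (z / r%:C) - cexp (z / t%:C)) <= 3 * normc z / b ^+ 2 * `|r - t|.
Proof.
move=> z0 b0 br bt; have r0 := lt_le_trans b0 br; have t0 := lt_le_trans b0 bt.
apply: (le_trans (normc_cexpB _ _)).
- by rewrite inv_real Re_scaled mulr_le0_ge0// invr_ge0 ltW.
- by rewrite inv_real Re_scaled mulr_le0_ge0// invr_ge0 ltW.
rewrite -mulrBr normcM !inv_real.
have -> : (r^-1)%:C - (t^-1)%:C = (r^-1 - t^-1)%:C by rewrite rmorphB.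
rewrite normc_real.
have -> : r^-1 - t^-1 = (r * t)^-1 * (t - r) by field; rewrite !lt0r_neq0.
rewrite normrM [`|t - r|]distrC (gtr0_norm (x := (r * t)^-1)) ?invr_gt0 ?mulr_gt0//.
rewrite !mulrA ler_wpM2r// ler_wpM2l ?mulr_ge0 ?normc_ge0//.
by rewrite lef_pV2 ?posrE ?exprn_gt0 ?mulr_gt0// expr2 ler_pM// ltW.
Qed.

Lemma cmeasurable_cexp_div (B : set (measurableTypeR R)) (z : R[i]) :
  cmeasurable B (fun r => cexp (z / r%:C)).
Proof.
apply: cmeasurable_cexp.
rewrite (_ : (fun r => _) = fun r => z * (r^-1)%:C); last first.
  by apply/funext => r; rewrite inv_real.
apply: cmeasurableM; first exact: cmeasurable_cst.
by apply: cmeasurable_real; apply: measurable_funTS; exact: measurable_fun_inv.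
Qed.

Lemma poisson_exponent_cvg (b M : R) (z : R[i]) : 0 < b -> b < M -> complex.Re z <= 0 ->
  ccvg (fun n => poisson_exponent lambda (cell_weights b M z n)) (campbell_exponent `]b, M] z).
Proof.
move=> b0 bM z0; have b0' := ltW b0.
have mc : cmeasurable (`]b, M]%classic : set (measurableTypeR R))
    (fun r => cexp (z / r%:C) - 1).
  by apply: cmeasurableB; [exact: cmeasurable_cexp_div|exact: cmeasurable_cst].
have PE n : poisson_exponent lambda (cell_weights b M z n) =
    \sum_(0 <= j < n.+1) (cexp (z / (grid b M n.+1 j.+1)%:C) - 1) *
      (\int[mu]_(r in cell b M n.+1 j) lambda r)%:C.
  by rewrite /poisson_exponent big_map; apply: eq_bigr => j _; rewrite mulrC.
have C0 : 0 <= 3 * normc z / b ^+ 2.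
  by rewrite divr_ge0 ?mulr_ge0 ?normc_ge0 ?sqr_ge0.
have lam0 r : b < r -> 0 <= lambda r by move=> br; apply: dens.1; rewrite (le_trans b0')// ltW.
have il := integrable_density_oc M b0'.
have cexpB1B r t : (cexp (z / r%:C) - 1) - (cexp (z / t%:C) - 1) =
    cexp (z / r%:C) - cexp (z / t%:C) by ring.
split.
- rewrite (_ : (fun n => _) = fun n => \sum_(0 <= j < n.+1)
      (fun r => complex.Re (cexp (z / r%:C) - 1)) (grid b M n.+1 j.+1) *
      (\int[mu]_(r in cell b M n.+1 j) lambda r)); last first.
    apply/funext => n; rewrite PE; elim/big_ind2 : _ => // [x1 y1 x2 y2 <- <-|j _].
      by rewrite cReD.
    by rewrite Re_scaled.
  have -> : complex.Re (campbell_exponent `]b, M] z) =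
      \int[mu]_(r in `]b, M]) (complex.Re (cexp (z / r%:C) - 1) * lambda r).
    by apply: eq_Rintegral => r _; rewrite Re_scaled.
  apply: (riemann_cvg bM C0 il lam0 mc.1) => r t /andP[br _] /andP[bt _].
  apply: (le_trans _ (normc_cexp_div_lip z0 b0 br bt)).
  rewrite -(cexpB1B r t); apply: (le_trans _ (ler_norm_Re _)).
  by rewrite cReB.
- rewrite (_ : (fun n => _) = fun n => \sum_(0 <= j < n.+1)
      (fun r => complex.Im (cexp (z / r%:C) - 1)) (grid b M n.+1 j.+1) *
      (\int[mu]_(r in cell b M n.+1 j) lambda r)); last first.
    apply/funext => n; rewrite PE; elim/big_ind2 : _ => // [x1 y1 x2 y2 <- <-|j _].
      by rewrite cImD.
    by rewrite cImM mulr0 add0r.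
  have -> : complex.Im (campbell_exponent `]b, M] z) =
      \int[mu]_(r in `]b, M]) (complex.Im (cexp (z / r%:C) - 1) * lambda r).
    by apply: eq_Rintegral => r _; rewrite cImM mulr0 add0r.
  apply: (riemann_cvg bM C0 il lam0 mc.2) => r t /andP[br _] /andP[bt _].
  apply: (le_trans _ (normc_cexp_div_lip z0 b0 br bt)).
  rewrite -(cexpB1B r t); apply: (le_trans _ (ler_norm_Im _)).
  by rewrite cImB.
Qed.

Lemma factor_cell_weights (b M : R) (z : R[i]) n x :
  count_factor dist (cell_weights b M z n) x =
  cexp (z * (\sum_(0 <= j < n.+1) (grid b M n.+1 j.+1)^-1 * cnt (cell b M n.+1 j) x)%:C).
Proof.
rewrite /count_factor big_map rmorph_sum mulr_sumr; congr cexp; apply: eq_bigr => j _.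
by rewrite rmorphM/= -inv_real mulrA.
Qed.

Lemma good_cev_cells (s : seq (set R * nat)) (b M : R) (z : R[i]) n : 0 <= b -> b < M ->
  good (map fst s) -> (forall B, B \in map fst s -> B `<=` `[0, b]) ->
  good (map fst s ++ map fst (cell_weights b M z n)).
Proof.
move=> b0 bM gs sb; rewrite -map_comp; apply: good_cat => //; first exact: good_cells.
move=> A B /sb Ab /mapP[j]; rewrite mem_index_iota => /andP[_ jn] ->.
apply/seteqP; split => // r [/Ab + /(cell_sub (ltW bM) jn)].
by rewrite /= !in_itv/= => /andP[_ rb] /andP[]; rewrite ltNge rb.
Qed.

(** Campbell's formula jointly with an event on the counts inside [0, b]; the product form expresses
    that the points beyond [b] are independent of it. Both sides are limits of discretizations over
    the cells of []b, M]], which differ by a multiple of the sum of the squared masses. *)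
Lemma point_sum_char (s : seq (set R * nat)) (b M : R) (z : R[i]) :
  0 < b -> b < M -> complex.Re z <= 0 ->
  good (map fst s) -> (forall B, B \in map fst s -> B `<=` `[0, b]) ->
  Cintegral P (cev s) (fun x => cexp (z * (point_sum `]b, M] x)%:C)) =
  (pr (cev s))%:C * cexp (campbell_exponent `]b, M] z).
Proof.
move=> b0 bM z0 gs sb; have ms := measurable_cev dist gs.
have allz n : all (fun q => complex.Re q.2 <= 0) (cell_weights b M z n).
  apply/allP => q /mapP[j _ ->] /=; rewrite inv_real Re_scaled mulr_le0_ge0// invr_ge0.
  by rewrite (le_trans (ltW b0))// grid_ge// ltW.
have mI : measurable (`]b, M]%classic : set (measurableTypeR R)) by exact: measurable_itv.
have I0 : (`]b, M]%classic : set R) `<=` `[0, +oo[%classic.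
  by move=> r; rewrite /= !in_itv/= andbT => /andP[br _]; rewrite (le_trans (ltW b0))// ltW.
have gc n := good_cev_cells z n (ltW b0) bM gs sb.
apply: (ccvg_eq (u := fun n => Cintegral P (cev s) (count_factor dist (cell_weights b M z n)))
  (v := fun n => (pr (cev s))%:C * cexp (poisson_exponent lambda (cell_weights b M z n)))
  (e := fun n => 6 * pr (cev s) * \sum_(0 <= j < n.+1) mass (cell b M n.+1 j) ^+ 2)).
- apply: (@Cdominated_cvg _ _ _ P (cev s) _ _ (cst 1)) => //.
  + move=> n; apply: cmeasurable_count_factor => q qL; suff [] : finite_mean lambda q.1 by [].
    by apply: (good_nth (gc n)); rewrite mem_cat; apply/orP; right; apply/mapP; exists q.
  + apply: cmeasurable_cexp; apply: cmeasurableM; first exact: cmeasurable_cst.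
    by apply: cmeasurable_real; apply: measurable_funTS; exact: measurable_point_sum.
  + apply: filterS (ae_regular scs PI_fin) => x rx _.
    under [X in ccvg X _]eq_fun do rewrite factor_cell_weights.
    apply: ccvg_cexp; apply: ccvgM; first exact: ccvg_cst.
    by apply: ccvg_real; exact: regular_riemann.
  + apply: (@Rintegral_bounded _ _ _ _ _ _ 1) => //; first exact: probability_lty.
    by move=> x _; rewrite /= normr1.
  + by move=> n x _; exact: normc_count_factor_le1.
- apply: ccvgM; first exact: ccvg_cst.
  by apply: ccvg_cexp; exact: poisson_exponent_cvg.
- move=> n; apply: (le_trans (factor_expectation dens pp (allz n) (gc n))).
  by rewrite big_map.
- rewrite -[X in _ --> X](mulr0 (6 * pr (cev s))); apply: cvgM; first exact: cvg_cst.
  exact: (sum_mass_sqr_cvg0 (ltW b0) bM).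
Qed.

End campbell.

Section dominated_convergence_on_sets.
Context d (T : measurableType d) (R : realType) (m : {measure set T -> \bar R}).
Import Normc.

Lemma le_Cintegrable (D : set T) (f : T -> R[i]) (g : T -> R) :
  measurable D -> cmeasurable D f -> m.-integrable D (EFin \o g) ->
  (forall x, D x -> normc (f x) <= g x) -> Cintegrable m D f.
Proof.
move=> mD [fr fi] ig fg; split; apply: (le_integrable mD _ _ ig); try exact/measurable_EFinP.
- move=> x Dx; apply: (@le_trans _ _ (normc (f x))%:E); rewrite lee_fin ?ler_norm_Re//.
  by rewrite (le_trans (fg _ Dx))// ler_norm.
- move=> x Dx; apply: (@le_trans _ _ (normc (f x))%:E); rewrite lee_fin ?ler_norm_Im//.
  by rewrite (le_trans (fg _ Dx))// ler_norm.
Qed.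

Lemma Cintegral_real (D : set T) (h : T -> R) : measurable D ->
  Cintegral m D (fun x => (h x)%:C) = (\int[m]_(x in D) h x)%:C.
Proof. by move=> mD; apply: complex_ext => //=; rewrite Rintegral_cst// mul0r. Qed.

Lemma Cintegral_subset (A D : set T) (f : T -> R[i]) : A `<=` D ->
  Cintegral m A f = Cintegral m D (fun x => (\1_A x)%:C * f x).
Proof.
move=> AD; rewrite -{1}(setIidr AD).
apply: complex_ext => /=; rewrite Rintegral_mkcondr; apply: eq_Rintegral => x _;
  rewrite ?cReM ?cImM /= indicE patchE; case: (x \in A); rewrite /= ?mul1r ?mul0r ?subr0 ?addr0//.
Qed.

(** Dominated convergence with domains that vary with [n]: the indicator of [A n] is absorbed in the
    integrand, and it is eventually 1 at each point of [D]. *)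
Lemma Cdominated_cvg_sets (D : set T) (A : nat -> set T) (f_ : nat -> T -> R[i])
    (f : T -> R[i]) (g : T -> R) :
  measurable D -> (forall n, measurable (A n)) -> (forall n, A n `<=` D) ->
  (forall n, cmeasurable D (f_ n)) -> cmeasurable D f ->
  (forall x, D x -> \forall n \near \oo, A n x) ->
  (forall x, D x -> ccvg (f_ ^~ x) (f x)) ->
  m.-integrable D (EFin \o g) ->
  (forall n x, A n x -> normc (f_ n x) <= g x) -> (forall x, D x -> 0 <= g x) ->
  ccvg (fun n => Cintegral m (A n) (f_ n)) (Cintegral m D f).
Proof.
move=> mD mA AD mf_ mf nA cf ig fg g0.
under [X in ccvg X _]eq_fun do rewrite (Cintegral_subset _ (AD _)).
apply: (@Cdominated_cvg _ _ _ m D _ _ g) => //.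
- move=> n; apply: cmeasurableM => //; apply: cmeasurable_real.
  by apply: measurable_funTS; exact: measurable_indic.
- apply: aeW => x Dx; rewrite -[f x]mul1r; apply: ccvgM; last exact: cf.
  apply: (@ccvg_real R (fun n => \1_(A n) x) 1).
  apply: cvg_near_cst; move: (nA x Dx); apply: filterS => n Ax.
  by rewrite indicE mem_set.
- move=> n x Dx; rewrite normcM normc_real indicE.
  have [/set_mem Ax|_] := boolP (x \in A n); last by rewrite normr0 mul0r g0.
  by rewrite normr1 mul1r fg.
Qed.

End dominated_convergence_on_sets.

(** * Scaling of Lebesgue measure: the substitution s = u r *)

Definition rescale {R : realType} (r : R) (u : measurableTypeR R) : measurableTypeR R :=
  u * r.

Lemma measurable_rescale {R : realType} (r : R) : measurable_fun setT (rescale r).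
Proof. exact: measurable_funM. Qed.

Section lebesgue_scaling.
Context {R : realType}.
Notation mu := (@lebesgue_measure R).

Definition rescaled_lebesgue (r : R) : {measure set (measurableTypeR R) -> \bar R} :=
  measure_function_pushforward__canonical__measure_function_Measure mu
    (measurable_rescale r).

(** By uniqueness of Lebesgue measure it suffices to compare the two measures on the intervals []a,
    b]]. *)
Lemma lebesgue_measure_scale (r : {posnum R}) (A : set (measurableTypeR R)) :
  measurable A -> mu A = mscale r%:num%:nng (rescaled_lebesgue r%:num) A.
Proof.
move=> mA; apply: lebesgue_measure_unique => //.
move=> _ [[a b]] _ <-; have preE : rescale r%:num @^-1` `]a, b]%classic = `]a / r%:num, b / r%:num]%classic.
  by apply/seteqP; split => u; rewrite /rescale /= !in_itv/= ltr_pdivrMr// ler_pdivlMr.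
transitivity (r%:num%:E * mu (rescale r%:num @^-1` `]a, b]%classic))%E; last by [].
rewrite preE !lebesgue_measure_itv/= !lte_fin ltr_pM2r ?invr_gt0//.
case: ifP => _; last by rewrite mule0.
by rewrite -!EFinB -EFinM -mulrBl mulrC divfK.
Qed.

Lemma ge0_integral_scale (r : R) (g : R -> \bar R) : 0 < r ->
  measurable_fun (`[r, +oo[%classic : set (measurableTypeR R)) g ->
  (forall s, r <= s -> (0 <= g s)%E) ->
  (\int[mu]_(s in `[r, +oo[) g s = r%:E * \int[mu]_(u in `[1%R, +oo[) g (u * r)%R)%E.
Proof.
move=> r0 mg g0; pose rp := PosNum r0.
rewrite (eq_measure_integral (mscale rp%:num%:nng (rescaled_lebesgue rp%:num)));
  last by move=> A mA _; exact: lebesgue_measure_scale.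
rewrite ge0_integral_mscale//; last first.
  by move=> s; rewrite /= in_itv/= andbT; exact: g0.
rewrite /rescaled_lebesgue ge0_integral_pushforward//; last 2 first.
- exact: measurable_rescale.
- by move=> s; rewrite inE/= in_itv/= andbT; exact: g0.
rewrite (_ : _ @^-1` _ = `[1, +oo[%classic)//.
apply/seteqP; split => u; rewrite /rescale /= !in_itv/= !andbT.
  by rewrite -ler_pdivrMr// divff// lt0r_neq0.
by rewrite -ler_pdivrMr// divff// lt0r_neq0.
Qed.

Lemma Rintegral_scale (r : R) (g : R -> R) : 0 < r ->
  mu.-integrable `[r, +oo[ (EFin \o g) ->
  \int[mu]_(s in `[r, +oo[) g s = r * \int[mu]_(u in `[1, +oo[) g (u * r).
Proof.
move=> r0 ig; have mg := measurable_int mu ig.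
have mI : measurable (`[r, +oo[%classic : set (measurableTypeR R)) by exact: measurable_itv.
have ip := integrable_pos_fin_num mI ig.
have im := integrable_neg_fin_num mI ig.
have pE := ge0_integral_scale r0 (measurable_funepos mg) (fun s _ => funepos_ge0 _ s).
have mE := ge0_integral_scale r0 (measurable_funeneg mg) (fun s _ => funeneg_ge0 _ s).
rewrite pE in ip; rewrite mE in im.
(* Both parts must be finite before [fine] can be distributed over the difference and the factor
   [r]. *)
have fK a : (r%:E * a)%E \is a fin_num -> a \is a fin_num.
  by case: a => [//| |]; rewrite ?gt0_muley ?gt0_muleNy.
have {}ip := fK _ ip; have {}im := fK _ im.
rewrite /Rintegral integralE pE mE.
set a := (\int[mu]_(u in _) _)%E in ip *; set b := (\int[mu]_(u in _) _)%E in im *.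
have -> : (\int[mu]_(u in `[1%R, +oo[) (g (u * r))%:E = a - b)%E.
  rewrite integralE; congr (_ - _)%E; apply: eq_integral => u _;
    by rewrite ?funeposE ?funenegE.
by move: ip im; case: a => // a _; case: b => // b _; rewrite /= mulrBr.
Qed.

End lebesgue_scaling.

(** * Integrability of lambda(r)/r at infinity *)

Section interference_transform.
Context {R : realType} d (T : measurableType d) (P : probability T R).
Variables (lambda : R -> R) (dist : nat -> {RV P >-> R}).
Hypotheses (scs : canonical_SCS lambda dist).
Hypothesis PI_fin : {ae P, forall x, (ext_interference dist x < +oo)%E}.
Notation mu := (@lebesgue_measure R).
Notation cev := (cev dist).
Notation point_sum := (point_sum dist).
Notation pr := (pr P).
Notation campbell_exponent := (campbell_exponent lambda).

Let dens : bs_density lambda. Proof. by case: scs. Qed.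

Lemma subset_oy_cy (b : R) : 0 <= b -> (`]b, +oo[%classic : set R) `<=` `[0, +oo[%classic.
Proof. by move=> b0 r; rewrite /= !in_itv/= !andbT => /ltW; exact: le_trans. Qed.

Lemma subset_oc_oy (b M : R) : (`]b, M]%classic : set R) `<=` `]b, +oo[%classic.
Proof. by move=> r; rewrite /= !in_itv/= andbT => /andP[]. Qed.

Lemma itv_oy_bigcup (b : R) :
  \bigcup_n (`]b, b + n.+1%:R]%classic : set R) = `]b, +oo[%classic.
Proof.
apply/seteqP; split => r; first by move=> [n _]; exact: subset_oc_oy.
rewrite /= in_itv/= andbT => br; exists (Num.truncn (r - b)) => //=.
rewrite in_itv/= br -lerBlDl.
by have /truncn_itv/andP[_ /ltW] : 0 <= r - b by rewrite subr_ge0 ltW.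
Qed.

Lemma nondecreasing_itv_oc (b : R) :
  nondecreasing_seq (fun n => `]b, b + n.+1%:R]%classic : set (measurableTypeR R)).
Proof.
move=> m n mn; rewrite subsetEset => r; rewrite /= !in_itv/= => /andP[-> rm].
by rewrite (le_trans rm)// lerD2l ler_nat.
Qed.

Lemma near_itv_oc (b r : R) : b < r -> \forall n \near \oo, `]b, b + n.+1%:R]%classic r.
Proof.
move=> br; have [N _ rN] : (\bigcup_n (`]b, b + n.+1%:R]%classic : set R)) r.
  by rewrite itv_oy_bigcup /= in_itv/= br.
exists N => // n /= Nn; have := nondecreasing_itv_oc b Nn.
by rewrite subsetEset; exact.
Qed.

Lemma cvg_point_sum (x : T) (b : R) : regular dist x -> 0 <= b ->
  point_sum `]b, b + n.+1%:R] x @[n --> \oo] --> point_sum `]b, +oo[ x.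
Proof.
move=> rx b0; have mI (i : interval R) : measurable ([set` i] : set (measurableTypeR R)).
  exact: measurable_itv.
apply: fine_cvg; rewrite fineK; last first.
  rewrite ge0_fin_numE.
    by apply: (regular_ext_point_sum rx (mI _)); exact: subset_oy_cy.
  apply: integral_ge0 => r; rewrite /= in_itv/= andbT lee_fin invr_ge0 => br.
  by rewrite (le_trans b0)// ltW.
rewrite -itv_oy_bigcup; apply: ge0_nondecreasing_set_cvg_integral.
- exact: nondecreasing_itv_oc.
- by move=> n; exact: mI.
- by move=> n; apply/measurable_EFinP; apply: measurable_funTS; exact: measurable_fun_inv.
- move=> n r; rewrite /= in_itv/= => /andP[br _].
  by rewrite lee_fin invr_ge0 (le_trans b0)// ltW.
Qed.

Lemma le_point_sum (x : T) (A B : set (measurableTypeR R)) : regular dist x ->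
  measurable A -> measurable B -> A `<=` B -> B `<=` `[0, +oo[ ->
  point_sum A x <= point_sum B x.
Proof.
move=> rx mA mB AB B0; have A0 := subset_trans AB B0.
have iA := regular_integrable rx mA A0; have iB := regular_integrable rx mB B0.
apply: fine_le; [exact: integrable_fin_num iA|exact: integrable_fin_num iB|].
apply: ge0_subset_integral => //.
  by apply/measurable_EFinP; apply: measurable_funTS; exact: measurable_fun_inv.
by move=> r /B0; rewrite /= in_itv/= andbT lee_fin invr_ge0.
Qed.

Lemma cev_nil : cev [::] = setT. Proof. exact: big_nil. Qed.

Lemma pr_setT : pr setT = 1.
Proof. by rewrite /pr probability_setT. Qed.

Lemma point_sum_char_setT (b M : R) (z : R[i]) : 0 < b -> b < M -> complex.Re z <= 0 ->
  Cintegral P setT (fun x => cexp (z * (point_sum `]b, M] x)%:C)) =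
  cexp (campbell_exponent `]b, M] z).
Proof.
move=> b0 bM z0; have := @point_sum_char _ _ _ _ _ _ scs PI_fin [::] b M z b0 bM z0.
rewrite cev_nil pr_setT mul1r; apply => //.
by split => // i j; rewrite ltn0 andbF.
Qed.

(** A nonnegative function of zero integral vanishes almost everywhere, which an exponential never
    does. *)
Lemma integral_expRN_point_sum_gt0 (b : R) : 0 < b ->
  0 < \int[P]_x expR (- point_sum `]b, +oo[ x).
Proof.
move=> b0; have b0' := ltW b0.
have mp : measurable_fun setT (fun x => expR (- point_sum `]b, +oo[ x)).
  apply: measurableT_comp => //; apply: measurableT_comp => //.
  by apply: measurable_point_sum; [exact: measurable_itv|exact: subset_oy_cy].
rewrite lt_neqAle Rintegral_ge0 ?andbT; last by move=> x _; exact: expR_ge0.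
apply/eqP => e0.
have i1 : P.-integrable setT (EFin \o (fun x => expR (- point_sum `]b, +oo[ x))).
  apply: (@Rintegral_bounded _ _ _ _ _ _ 1) => //.
    by apply: probability_lty.
  move=> x _; rewrite ger0_norm ?expR_ge0// -expR0 ler_expR oppr_le0.
  by apply: point_sum_ge0; exact: subset_oy_cy.
have : (\int[P]_x `|(expR (- point_sum `]b, +oo[ x))%:E| = 0)%E.
  under eq_integral do rewrite gee0_abs ?lee_fin ?expR_ge0//.
  by rewrite -[LHS]fineK ?(integrable_fin_num _ i1)// -/(Rintegral P setT _) -e0.
have mE : measurable_fun setT (EFin \o (fun x => expR (- point_sum `]b, +oo[ x))).
  exact/measurable_EFinP.
move=> /(ae_eq_integral_abs P measurableT mE) [N [mN N0 sN]].
have NT : N = setT.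
  apply/seteqP; split => // x _; apply: sN => /= /(_ I) [] /eqP.
  by rewrite expR_eq0.
have : P setT = 0%E by rewrite -NT.
by rewrite probability_setT => /eqP; rewrite onee_eq0.
Qed.

Lemma integrable_density_inv_oc (b M : R) : 0 < b ->
  mu.-integrable `]b, M] (EFin \o (fun r => r^-1 * lambda r)).
Proof.
move=> b0; have mI : measurable (`]b, M]%classic : set (measurableTypeR R)).
  exact: measurable_itv.
have il := integrable_density_oc scs M (ltW b0).
have ml : measurable_fun (`]b, M]%classic : set (measurableTypeR R)) lambda.
  by apply/measurable_EFinP; have /integrableP[] := il.
have := integrableZl mI b^-1 il; apply: (le_integrable mI).
  apply/measurable_EFinP; apply: measurable_funM => //.
  by apply: measurable_funTS; exact: measurable_fun_inv.
move=> r; rewrite /= in_itv/= => /andP[br _]; have r0 := lt_trans b0 br.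
by rewrite lee_fin !normrM ler_wpM2r// !gtr0_norm ?invr_gt0// lef_pV2 ?posrE// ltW.
Qed.

(** Let c > 0 be the expectation of exp(-S) for the sum S over all points beyond [b]. The sum over
    []b, M]] is smaller, so Campbell's formula at z = -1 gives c <= exp(a), where a is the integral
    of (exp(-1/r) - 1) lambda(r) over []b, M]]. Hence the integral of (1 - exp(-1/r)) lambda(r) is
    at most -ln c for every [M], and on r > b the factor 1/r is at most exp(1/b) (1 - exp(-1/r)). *)
Lemma integral_density_inv_le (b : R) : 0 < b -> exists K : R, forall M, b < M ->
  \int[mu]_(r in `]b, M]) (r^-1 * lambda r) <= K.
Proof.
move=> b0; have b0' := ltW b0.
set c := \int[P]_x expR (- point_sum `]b, +oo[ x).
have c0 : 0 < c by exact: integral_expRN_point_sum_gt0.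
exists (expR b^-1 * - ln c) => M bM.
have mI (i : interval R) : measurable ([set` i] : set (measurableTypeR R)).
  exact: measurable_itv.
have il : mu.-integrable `]b, M] (EFin \o lambda).
  exact: (integrable_density_oc scs).
have ml : measurable_fun (`]b, M]%classic : set (measurableTypeR R)) lambda.
  by apply/measurable_EFinP; have /integrableP[] := il.
have l0 r : b < r -> 0 <= lambda r by move=> br; apply: dens.1; rewrite (le_trans b0')// ltW.
have minv : measurable_fun (`]b, M]%classic : set (measurableTypeR R)) (fun r : R => r^-1).
  by apply: measurable_funTS; exact: measurable_fun_inv.
have me : measurable_fun (`]b, M]%classic : set (measurableTypeR R)) (fun r : R => expR (- r^-1) - 1).
  apply: measurable_funB => //; apply: measurableT_comp => //.
  by apply: measurableT_comp => //.
have i1 : mu.-integrable `]b, M] (EFin \o (fun r => (expR (- r^-1) - 1) * lambda r)).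
  apply: (le_integrable (mI _) _ _ il); first by apply/measurable_EFinP; exact: measurable_funM.
  move=> r; rewrite /= in_itv/= => /andP[br _]; rewrite lee_fin normrM ler_piMl//.
  have e1 : expR (- r^-1) <= 1.
    by rewrite -expR0 ler_expR oppr_le0 invr_ge0 (le_trans b0')// ltW.
  by rewrite ler0_norm ?subr_le0// opprB lerBlDr lerDl expR_ge0.
have i2 := integrable_density_inv_oc M b0.
set a := \int[mu]_(r in `]b, M]) ((expR (- r^-1) - 1) * lambda r).
have : c <= expR a.
  have := point_sum_char_setT b0 bM (z := - 1%:C); rewrite lerN10 => /(_ isT).
  move=> /(congr1 (@complex.Re R)).
  have e1 : campbell_exponent `]b, M] (- 1%:C) = a%:C.
    have e2 r : (cexp (- 1%:C / r%:C) - 1) * (lambda r)%:C =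
        ((expR (- r^-1) - 1) * lambda r)%:C.
      have -> : - 1%:C / r%:C = (- r^-1)%:C.
        by rewrite inv_real rmorph1 mulN1r rmorphN.
      by rewrite cexp_real rmorphM rmorphB rmorph1.
    rewrite -Cintegral_real; last exact: mI.
    by apply: eq_Cintegral => r _; exact: e2.
  rewrite e1 cexp_real => eE; rewrite -[expR a]/(complex.Re (expR a)%:C) -eE.
  have -> : Cintegral P setT (fun x => cexp (- 1%:C * (point_sum `]b, M] x)%:C)) =
      (\int[P]_x expR (- point_sum `]b, M] x))%:C.
    rewrite -Cintegral_real; last exact: measurableT.
    apply: eq_Cintegral => x _.
    have -> : - 1%:C * (point_sum `]b, M] x)%:C = (- point_sum `]b, M] x)%:C.
      by rewrite rmorph1 mulN1r rmorphN.
    by rewrite cexp_real.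
  have mp (i : interval R) : ([set` i] `<=` `[0%R, +oo[) ->
      measurable_fun setT (fun x => expR (- point_sum [set` i] x)).
    move=> i0; apply: measurableT_comp => //; apply: measurableT_comp => //.
    exact: measurable_point_sum.
  have ip (i : interval R) : ([set` i] `<=` `[0%R, +oo[) ->
      P.-integrable setT (EFin \o (fun x => expR (- point_sum [set` i] x))).
    move=> i0; apply: (@Rintegral_bounded _ _ _ _ _ _ 1) => //.
    - exact: probability_lty.
    - exact: mp.
    - move=> x _; rewrite ger0_norm ?expR_ge0// -expR0 ler_expR oppr_le0.
      exact: point_sum_ge0.
  have s1 := @subset_oy_cy b b0'; have s2 := subset_trans (@subset_oc_oy b M) s1.
  apply: fine_le; [exact: integrable_fin_num (ip _ s1)|exact: integrable_fin_num (ip _ s2)|].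
  apply: ae_ge0_le_integral => //.
  - by apply/measurable_EFinP; exact: (mp _ s1).
  - by apply/measurable_EFinP; exact: (mp _ s2).
  apply: filterS (ae_regular scs PI_fin) => x rx _.
  rewrite lee_fin ler_expR lerN2.
  exact: (le_point_sum rx (mI _) (mI _) (@subset_oc_oy b M) s1).
move=> ca; have lca : ln c <= a by rewrite -(expRK a) ler_ln ?posrE ?expR_gt0.
apply: (@le_trans _ _ (expR b^-1 * - a)); last by rewrite ler_wpM2l ?expR_ge0// lerN2.
rewrite /a -[- _]mulN1r -RintegralZl// -RintegralZl//; last first.
  have := integrableZl (mI _) (-1) i1; apply: eq_integrable => // r _ /=; rewrite EFinM//.
apply: le_Rintegral => //.
  have := integrableZl (mI _) (expR b^-1) (integrableZl (mI _) (-1) i1).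
  by apply: eq_integrable => // r _ /=; rewrite !EFinM.
move=> r; rewrite /= in_itv/= => /andP[br _]; have r0 := lt_trans b0 br.
rewrite mulN1r -mulNr opprB mulrA ler_wpM2r ?l0//.
(* These inequalities combine as 1/r <= exp(1/b) exp(-1/r) / r <= exp(1/b) (1 - exp(-1/r)). *)
have h1 : expR (- r^-1) * (1 + r^-1) <= 1.
  by rewrite -[leRHS](expRxMexpNx_1 r^-1) mulrC ler_wpM2r ?expR_ge0// expR_ge1Dx.
have h2 : 1 <= expR b^-1 * expR (- r^-1).
  by rewrite -expRD -expR0 ler_expR subr_ge0 lef_pV2 ?posrE// ltW.
have h3 : 0 <= r^-1 by rewrite invr_ge0 ltW.
apply: (@le_trans _ _ (expR b^-1 * (expR (- r^-1) * r^-1))).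
  by rewrite mulrA ler_peMl.
by rewrite ler_wpM2l ?expR_ge0//; move: h1; rewrite mulrDr mulr1; lra.
Qed.

End interference_transform.

(** * Campbell's formula on half-lines *)

Section tail_transform.
Context {R : realType} d (T : measurableType d) (P : probability T R).
Variables (lambda : R -> R) (dist : nat -> {RV P >-> R}).
Hypotheses (scs : canonical_SCS lambda dist).
Hypothesis PI_fin : {ae P, forall x, (ext_interference dist x < +oo)%E}.
Notation mu := (@lebesgue_measure R).
Notation good := (good lambda).
Notation cev := (cev dist).
Notation point_sum := (point_sum dist).
Notation pr := (pr P).
Notation campbell_exponent := (campbell_exponent lambda).
Import Normc.

Let dens : bs_density lambda. Proof. by case: scs. Qed.

Let mI (i : interval R) : measurable ([set` i] : set (measurableTypeR R)).
Proof. exact: measurable_itv. Qed.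

Lemma density_gt_ge0 (b r : R) : 0 <= b -> b < r -> 0 <= lambda r.
Proof. by move=> b0 br; apply: dens.1; rewrite (le_trans b0)// ltW. Qed.

Lemma measurable_density_oy (b : R) : 0 <= b ->
  measurable_fun (`]b, +oo[%classic : set (measurableTypeR R)) lambda.
Proof.
move=> b0; apply: (measurable_funS _ _ (measurable_density dens)); first exact: mI.
exact: subset_oy_cy.
Qed.

(** Provides the dominating function for the exponents on half-lines, since |exp(z/r) - 1| is at
    most 3|z|/r. It follows from the uniform bound on []b, M]] by monotone convergence. *)
Lemma integrable_density_inv (b : R) : 0 < b ->
  mu.-integrable `]b, +oo[ (EFin \o (fun r => r^-1 * lambda r)).
Proof.
move=> b0; have b0' := ltW b0.
have mf : measurable_fun (`]b, +oo[%classic : set (measurableTypeR R)) (fun r => r^-1 * lambda r).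
  apply: measurable_funM; last exact: measurable_density_oy.
  by apply: measurable_funTS; exact: measurable_fun_inv.
have f0 r : b < r -> 0 <= r^-1 * lambda r.
  move=> br; rewrite mulr_ge0 ?(density_gt_ge0 b0')// invr_ge0 (le_trans b0')// ltW//.
apply: ge0_Rintegrable => //; first by move=> r; rewrite /= in_itv/= andbT; exact: f0.
have [K hK] := integral_density_inv_le scs PI_fin b0.
apply: (@le_lt_trans _ _ K%:E); last exact: ltry.
have cv : (\int[mu]_(r in `]b, (b + n.+1%:R)%R]) (r^-1 * lambda r)%:E)%E @[n --> \oo] -->
    (\int[mu]_(r in \bigcup_n `]b, (b + n.+1%:R)%R]%classic) (r^-1 * lambda r)%:E)%E.
  apply: ge0_nondecreasing_set_cvg_integral.
  - exact: nondecreasing_itv_oc.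
  - by move=> n; exact: mI.
  - move=> n; apply/measurable_EFinP; apply: (measurable_funS (mI _) _ mf).
    exact: subset_oc_oy.
  - by move=> n r; rewrite /= in_itv/= => /andP[br _]; rewrite lee_fin f0.
rewrite -itv_oy_bigcup; apply: (cvge_to_le cv).
apply: nearW => n; rewrite -[leLHS]fineK.
  by rewrite lee_fin; apply: hK; rewrite ltrDl.
by apply: (integrable_fin_num (mI _)); exact: (integrable_density_inv_oc scs).
Qed.

Lemma normc_cexpB1_div (z : R[i]) (r : R) : complex.Re z <= 0 -> 0 < r ->
  normc (cexp (z / r%:C) - 1) <= 3 * normc z * r^-1.
Proof.
move=> z0 r0; rewrite inv_real -mulrA; apply: (le_trans (normc_cexpB1_npos _)).
  by rewrite Re_scaled mulr_le0_ge0// invr_ge0 ltW.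
by rewrite normcM normc_real gtr0_norm ?invr_gt0.
Qed.

Lemma normc_campbell_le (z : R[i]) (C r : R) : complex.Re z <= 0 -> normc z <= C -> 0 < r ->
  normc ((cexp (z / r%:C) - 1) * (lambda r)%:C) <= 3 * C * (r^-1 * lambda r).
Proof.
move=> z0 zC r0; have l0 : 0 <= lambda r by apply: dens.1; exact: ltW.
rewrite normcM normc_real (ger0_norm l0) mulrA ler_wpM2r//.
apply: (le_trans (normc_cexpB1_div z0 r0)); rewrite ler_wpM2r ?invr_ge0 ?(ltW r0)//.
by rewrite ler_wpM2l.
Qed.

Lemma cmeasurable_campbell (B : set (measurableTypeR R)) (z : R[i]) :
  B `<=` `[0, +oo[ -> measurable B ->
  cmeasurable B (fun r => (cexp (z / r%:C) - 1) * (lambda r)%:C).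
Proof.
move=> B0 mB; apply: cmeasurableM.
  by apply: cmeasurableB; [exact: cmeasurable_cexp_div|exact: cmeasurable_cst].
apply: cmeasurable_real; apply: (measurable_funS _ B0 (measurable_density dens)).
exact: mI.
Qed.

(** The ends [u n] approach [r] from above only, so all domains lie in []r, +oo[], where a single
    function dominates; each s > r is eventually beyond [u n]. *)
Lemma campbell_exponent_cvg (b r : R) (z : R[i]) (u : nat -> R) (zn : nat -> R[i]) (C : R) :
  0 < b -> b <= r -> (forall n, b <= u n) -> u n @[n --> \oo] --> r ->
  (forall n, r <= u n) ->
  complex.Re z <= 0 -> (forall n, complex.Re (zn n) <= 0) ->
  (forall n, normc (zn n) <= C) -> ccvg zn z ->
  ccvg (fun n => campbell_exponent `]u n, +oo[ (zn n)) (campbell_exponent `]r, +oo[ z).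
Proof.
move=> b0 br bu ur ru z0 zn0 znC znz; have r0 := lt_le_trans b0 br.
have C0 : 0 <= C := le_trans (normc_ge0 _) (znC 0%N).
have sub n : (`]u n, +oo[%classic : set R) `<=` `]r, +oo[%classic.
  by move=> s; rewrite /= !in_itv/= !andbT; exact: le_lt_trans.
have s0 := subset_oy_cy (ltW r0).
apply: (@Cdominated_cvg_sets _ _ _ mu `]r, +oo[%classic (fun n => `]u n, +oo[%classic) _ _
  (fun s => 3 * C * (s^-1 * lambda s))) => //.
- by move=> n; exact: cmeasurable_campbell.
- exact: cmeasurable_campbell.
- move=> s; rewrite /= in_itv/= andbT => rs.
  have /cvgrPdistC_lt/(_ (s - r)) := ur; rewrite subr_gt0 => /(_ rs).
  apply: filterS => n; rewrite in_itv/= andbT => h.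
  by rewrite -(ltrD2r (- r)) (le_lt_trans (ler_norm _)).
- move=> s rs; apply: ccvgM; last exact: ccvg_cst.
  apply: ccvgD; last exact: ccvg_cst.
  by apply: ccvg_cexp; apply: ccvgM => //; exact: ccvg_cst.
- apply: eq_integrable (integrableZl (mI _) (3 * C) (integrable_density_inv r0)) => //.
- move=> n s; rewrite /= in_itv/= andbT => us.
  by apply: normc_campbell_le => //; exact: lt_trans (lt_le_trans b0 (bu n)) us.
- move=> s; rewrite /= in_itv/= andbT => rs.
  by rewrite !mulr_ge0// ?invr_ge0 ?(density_gt_ge0 (ltW r0))// ltW// (lt_trans r0).
Qed.

Lemma point_sum_char_oy (s : seq (set R * nat)) (b : R) (z : R[i]) :
  0 < b -> complex.Re z <= 0 -> good (map fst s) ->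
  (forall B, B \in map fst s -> B `<=` `[0, b]) ->
  Cintegral P (cev s) (fun x => cexp (z * (point_sum `]b, +oo[ x)%:C)) =
  (pr (cev s))%:C * cexp (campbell_exponent `]b, +oo[ z).
Proof.
move=> b0 z0 gs sb; have b0' := ltW b0; have ms := measurable_cev dist gs.
have s1 := @subset_oy_cy _ b b0'.
have mp (i : interval R) : ([set` i] `<=` `[0%R, +oo[) ->
    cmeasurable (cev s) (fun x => cexp (z * (point_sum [set` i] x)%:C)).
  move=> i0; apply: cmeasurable_cexp; apply: cmeasurableM; first exact: cmeasurable_cst.
  apply: cmeasurable_real; apply: measurable_funTS.
  by apply: measurable_point_sum; first exact: mI.
(* The identity is exact on each []b, b + n.+1%:R]], so the error sequence is 0. *)
apply: (ccvg_eq
  (u := fun n => Cintegral P (cev s) (fun x => cexp (z * (point_sum `]b, b + n.+1%:R] x)%:C)))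
  (v := fun n => (pr (cev s))%:C * cexp (campbell_exponent `]b, b + n.+1%:R] z))
  (e := fun=> 0)).
- have s2 n := subset_trans (@subset_oc_oy _ b (b + n.+1%:R)) s1.
  apply: (@Cdominated_cvg _ _ _ P (cev s) _ _ (cst 1)) => //.
  + by move=> n; exact: (mp _ (s2 n)).
  + exact: (mp _ s1).
  + apply: filterS (ae_regular scs PI_fin) => x rx _.
    apply: ccvg_cexp; apply: ccvgM; first exact: ccvg_cst.
    by apply: ccvg_real; exact: cvg_point_sum.
  + apply: (@Rintegral_bounded _ _ _ _ _ _ 1) => //; first exact: probability_lty.
    by move=> x _; rewrite /= normr1.
  + move=> n x _; apply: normc_cexp_le1; rewrite Re_scaled mulr_le0_ge0//.
    exact: (point_sum_ge0 _ _ (s2 n)).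
- apply: ccvgM; first exact: ccvg_cst.
  apply: ccvg_cexp.
  apply: (@Cdominated_cvg_sets _ _ _ mu `]b, +oo[%classic (fun n => `]b, b + n.+1%:R]%classic)
    (fun _ r => (cexp (z / r%:C) - 1) * (lambda r)%:C) _
    (fun r => 3 * normc z * (r^-1 * lambda r))).
  + exact: mI.
  + by move=> n; exact: mI.
  + by move=> n; exact: subset_oc_oy.
  + by move=> n; apply: cmeasurable_campbell; first exact: s1.
  + by apply: cmeasurable_campbell; first exact: s1.
  + by move=> r; rewrite /= in_itv/= andbT; exact: near_itv_oc.
  + by move=> r _; exact: ccvg_cst.
  + apply: eq_integrable (integrableZl (mI _) (3 * normc z) (integrable_density_inv b0)) => //.
  + move=> n r; rewrite /= in_itv/= => /andP[br _]; apply: normc_campbell_le => //.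
    exact: lt_trans br.
  + move=> r; rewrite /= in_itv/= andbT => br.
    by rewrite !mulr_ge0 ?normc_ge0 ?invr_ge0 ?(density_gt_ge0 b0')// ltW// (lt_trans b0).
- move=> n; rewrite (point_sum_char scs PI_fin b0 _ z0 gs sb) ?ltrDl//.
  by rewrite subrr normc0.
- exact: cvg_cst.
Qed.

End tail_transform.

(** * The nearest point *)

Section nearest_point.
Context {R : realType} d (T : measurableType d) (P : probability T R).
Variables (lambda : R -> R) (dist : nat -> {RV P >-> R}).
Hypotheses (scs : canonical_SCS lambda dist).
Hypothesis PI_fin : {ae P, forall x, (ext_interference dist x < +oo)%E}.
Notation mu := (@lebesgue_measure R).
Notation mass := (@mass R lambda).
Notation pr := (pr P).
Notation campbell_exponent := (campbell_exponent lambda).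
Import Normc.

Let dens : bs_density lambda. Proof. by case: scs. Qed.
Let pp : poisson_process lambda dist. Proof. by case: scs. Qed.

Let mI (i : interval R) : measurable ([set` i] : set (measurableTypeR R)).
Proof. exact: measurable_itv. Qed.

Lemma bs_count_eq0 (B : set R) x : (forall k, ~ B (dist k x)) -> bs_count dist B x = 0%E.
Proof. by move=> h; apply: eseries0 => k _ _; rewrite /= diracE memNset. Qed.

Lemma bs_count_ge2 (B : set R) x j k : j != k -> B (dist j x) -> B (dist k x) ->
  (2%:E <= bs_count dist B x)%E.
Proof.
move=> jk Bj Bk; rewrite /bs_count (nneseriesD1 (n := j))//.
rewrite (nneseriesD1 (n := k) (P := fun i => true && (i != j)))//; last by rewrite eq_sym.
rewrite !diracE !mem_set//= -[2%R]/(1 + 1)%R EFinD leeD2l// leeDl//.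
by apply: nneseries_ge0 => i _ _; rewrite lee_fin.
Qed.

Lemma bs_count_ge1 (B : set R) x k : B (dist k x) -> (1 <= bs_count dist B x)%E.
Proof.
move=> Bk; rewrite /bs_count (nneseriesD1 (n := k))//.
rewrite !diracE mem_set//= leeDl//.
by apply: nneseries_ge0 => i _ _; rewrite lee_fin.
Qed.

Lemma count_event0 (B : set R) x k : count_event dist B 0 x -> ~ B (dist k x).
Proof. by rewrite /count_event/= => h /bs_count_ge1; rewrite h lee_fin ler10. Qed.

Lemma count_event1 (B : set R) x : count_event dist B 1 x ->
  exists2 k, B (dist k x) & forall j, j != k -> ~ B (dist j x).
Proof.
rewrite /count_event/= => h; have [k Bk] : exists k, B (dist k x).
  apply: contrapT => hn; have /eqP := h; rewrite bs_count_eq0.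
    by rewrite eqe eq_sym oner_eq0.
  by move=> k Bk; apply: hn; exists k.
exists k => // j jk Bj; have := bs_count_ge2 jk Bj Bk.
by rewrite h lee_fin ler_nat.
Qed.

Lemma count_event_single (B : set R) x k : B (dist k x) ->
  (forall j, j != k -> ~ B (dist j x)) -> count_event dist B 1 x.
Proof.
move=> Bk uk; rewrite /count_event/= /bs_count (nneseriesD1 (n := k))//.
rewrite diracE mem_set//= eseries0 ?adde0// => i _ /= ik.
by rewrite diracE memNset//; exact: uk.
Qed.

Definition several (B : set R) : set T :=
  ~` (count_event dist B 0 `|` count_event dist B 1).

Lemma measurable_several (B : set (measurableTypeR R)) :
  measurable B -> measurable (several B).
Proof.
by move=> mB; apply: measurableC; apply: measurableU; exact: measurable_count_event.
Qed.

Lemma pr_several_le (B : set (measurableTypeR R)) : finite_mean lambda B ->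
  pr (several B) <= mass B ^+ 2.
Proof.
move=> fB; have [mB B0 _] := fB.
have mc n := measurable_count_event dist n mB.
have pc n : pr (count_event dist B n) = poisson_weight (mass B) n by rewrite /pr pp.1.
rewrite /several -setTD pr_setD//; last exact: measurableU.
rewrite pr_setU//; last first.
  apply/seteqP; split => // x; rewrite /count_event/= => -[-> /eqP].
  by rewrite eqe eq_sym oner_eq0.
rewrite !pc pr_setT opprD addrA; apply: poisson_weight_ge2_le.
exact: (mass_ge0 dens).
Qed.

(** The single point of []a, b]] must have index 0: no point lies below it, hence R_1 is in the same
    cell. All other points are then beyond [b], and the interference is the sum over them. *)
Lemma nearest_in_cell x (a b : R) : regular dist x -> 0 <= a -> a < b ->
  count_event dist `[0, a] 0 x -> count_event dist `]a, b] 1 x ->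
  `]a, b]%classic (dist 0 x) /\ ext_interference dist x = ext_point_sum dist `]b, +oo[ x.
Proof.
move=> rx a0 ab c0 /count_event1[k kab uk].
have ga j : a < dist j x.
  rewrite ltNge; apply/negP => ja; apply: (count_event0 (k := j) c0).
  by rewrite /= in_itv/= ja andbT ltW// regular_gt0.
have d0 : `]a, b]%classic (dist 0 x).
  move: kab; rewrite /= !in_itv/= => /andP[_ kb].
  by rewrite ga/= (le_trans _ kb)// regular_le.
have k0 : k = 0%N by apply: contrapT => /eqP; rewrite eq_sym => /uk; exact.
split => //.
have gb j : (0 < j)%N -> b < dist j x.
  move=> j0; rewrite ltNge; apply/negP => jb.
  have : j != k by rewrite k0 -lt0n.
  by move=> /uk; apply; rewrite /= in_itv/= ga jb.
have b0 : 0 <= b by rewrite (le_trans a0)// ltW.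
rewrite ext_point_sumE; [|exact: mI|exact: subset_oy_cy].
rewrite nneseries_recl//; last first.
  move=> j _; rewrite lee_fin mulr_ge0// invr_ge0 ltW// regular_gt0//.
rewrite indicE memNset; last first.
  by move: d0; rewrite /= !in_itv/= andbT => /andP[_ h]; apply/negP; rewrite -leNgt.
rewrite mul0r add0e; apply: congr_lim; apply/funext => n.
rewrite big_nat_cond [RHS]big_nat_cond; apply: eq_bigr => j /andP[/andP[j0 _] _].
by rewrite indicE mem_set ?mul1r//= in_itv/= andbT gb.
Qed.

(** A converse at the level of counts, outside [several]. The set [B] localizes R_1 inside the cell,
    as required for its law on Borel sets; B = [setT] is enough for characteristic functions. *)
Lemma nearest_cell_events x (B : set R) (a b : R) : regular dist x -> 0 <= a ->
  (`]a, b]%classic `&` B) (dist 0 x) -> ~ several `]a, b] x ->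
  [/\ count_event dist `[0, a] 0 x, count_event dist (`]a, b]%classic `&` B) 1 x &
    count_event dist (`]a, b]%classic `\` B) 0 x].
Proof.
move=> rx a0 [d0 B0] /contrapT [|] h; first by have := count_event0 (k := 0%N) h.
have [k kab uk] := count_event1 h.
have k0 : k = 0%N by apply: contrapT => /eqP; rewrite eq_sym => /uk; exact.
rewrite k0 in uk.
split.
- apply: bs_count_eq0 => k'; rewrite /= in_itv/= => /andP[_].
  move: d0; rewrite /= in_itv/= => /andP[ad _]; rewrite leNgt => /negP; apply.
  by rewrite (lt_le_trans ad)// regular_le.
- by apply: (count_event_single (k := 0%N)) => // i /uk ni [/ni].
- apply: bs_count_eq0 => k' [kab' kB].
  have [k'0|/uk] := eqVneq k' 0%N; last exact.
  by apply: kB; rewrite k'0.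
Qed.

Lemma tail_exponent_scale (w r : R) : 0 < r ->
  campbell_exponent `]r, +oo[ ('i%C * (w * r)%:C) =
  r%:C * Cintegral mu `[1, +oo[
     (fun u => (cexp ('i%C * w%:C / u%:C) - 1) * (lambda (u * r))%:C).
Proof.
move=> r0; set z := 'i%C * (w * r)%:C.
have z0 : complex.Re z <= 0 by rewrite /z mul_i_real.
pose f s := (cexp (z / s%:C) - 1) * (lambda s)%:C.
(* Integrability is known on open half-lines, while the substitution is stated on [[r, +oo[];
   starting from r / 2 covers the endpoint. *)
have r20 : 0 < r / 2 by rewrite divr_gt0.
have sub : (`[r, +oo[%classic : set R) `<=` `]r / 2, +oo[%classic.
  move=> s; rewrite /= !in_itv/= !andbT; apply: lt_le_trans.
  by rewrite ltr_pdivrMr// ltr_pMr// ltr1n.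
have s0 : (`]r / 2, +oo[%classic : set R) `<=` `[0, +oo[%classic.
  by apply: subset_oy_cy; exact: ltW.
have id : mu.-integrable `]r / 2, +oo[ (EFin \o (fun s => 3 * normc z * (s^-1 * lambda s))).
  by apply: eq_integrable (integrableZl (mI _) _ (integrable_density_inv scs PI_fin r20)).
have fle s : (`]r / 2, +oo[%classic : set R) s -> normc (f s) <= 3 * normc z * (s^-1 * lambda s).
  rewrite /= in_itv/= andbT => rs.
  exact: (normc_campbell_le scs z0 (lexx _) (lt_trans r20 rs)).
have [ire iim] : Cintegrable mu `[r, +oo[ f.
  apply: (CintegrableS (mI _) (mI _) sub).
  exact: (le_Cintegrable (mI _) (cmeasurable_campbell scs z s0 (mI _)) id fle).
have suboc : (`]r, +oo[%classic : set R) `<=` `[r, +oo[%classic.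
  by move=> s; rewrite /= !in_itv/= !andbT => /ltW.
have fE u : 1 <= u -> f (u * r) = (cexp ('i%C * w%:C / u%:C) - 1) * (lambda (u * r))%:C.
  move=> u1; rewrite /f /z; congr ((cexp _ - 1) * _).
  rewrite -!mulrA; congr (_ * _); rewrite !inv_real -!rmorphM/=; congr (_%:C).
  by rewrite invfM mulrACA (divff (lt0r_neq0 r0)) mulr1.
have u1E (u : R) : u \in (`[1, +oo[%classic : set R) -> 1 <= u.
  by rewrite inE/= in_itv/= andbT.
apply: complex_ext.
- rewrite cReM mul0r subr0.
  transitivity (\int[mu]_(s in `[r, +oo[) complex.Re (f s)).
    rewrite -Rintegral_itv_obnd_cbnd//.
    exact: (integrableS (mI _) (mI _) suboc ire).
  rewrite (Rintegral_scale r0 ire); congr (_ * _).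
  by apply: eq_Rintegral => u u1; congr (complex.Re _); apply: fE; exact: u1E u1.
- rewrite cImM mul0r addr0.
  transitivity (\int[mu]_(s in `[r, +oo[) complex.Im (f s)).
    rewrite -Rintegral_itv_obnd_cbnd//.
    exact: (integrableS (mI _) (mI _) suboc iim).
  rewrite (Rintegral_scale r0 iim); congr (_ * _).
  by apply: eq_Rintegral => u u1; congr (complex.Im _); apply: fE; exact: u1E u1.
Qed.

End nearest_point.

(** Convergence is not assumed: where the lower and upper limits differ, [limn] takes the default
    value [point], so it is measurable in all cases. *)
Lemma measurable_fun_limn {R : realType} d (T : measurableType d) (f : (T -> \bar R)^nat) :
  (forall n, measurable_fun setT (f n)) -> measurable_fun setT (fun x => limn (f ^~ x)).
Proof.
move=> mf.
have ms := measurable_fun_limn_esup mf.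
have mi : measurable_fun setT (fun x => limn_einf (f ^~ x)).
  rewrite /limn_einf; apply: measurableT_comp => //.
  by apply: measurable_fun_limn_esup => n; exact: measurableT_comp.
have mE : measurable_fun setT (fun x => limn_einf (f ^~ x) == limn_esup (f ^~ x)).
  exact: measurable_fun_eqe.
rewrite (_ : (fun x => limn (f ^~ x)) = (fun x =>
   if limn_einf (f ^~ x) == limn_esup (f ^~ x) then limn_esup (f ^~ x) else point)).
  by apply: measurable_fun_ifT.
apply/funext => x; case: eqP => h; last first.
  by apply: dvgP => c; apply: h; rewrite is_cvg_limn_einfE// is_cvg_limn_esupE.
apply/cvg_lim => //.
apply: (@squeeze_cvge _ _ _ _ (einfs (f ^~ x)) _ (esups (f ^~ x))).
- apply: nearW => n; apply/andP; split.
    by apply: ereal_inf_lbound; exists n => /=.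
  by apply: ereal_sup_ubound; exists n => /=.
- rewrite -h limn_einf_lim; exact: is_cvg_einfs.
- rewrite limn_esup_lim; exact: is_cvg_esups.
Qed.

(** * Measurability and positivity of the interference *)

Section interference.
Context {R : realType} d (T : measurableType d) (P : probability T R).
Variables (lambda : R -> R) (dist : nat -> {RV P >-> R}).

Lemma measurable_ext_interference : measurable_fun setT (ext_interference dist).
Proof.
apply: measurable_fun_limn => n; apply: emeasurable_sum => k.
apply/measurable_EFinP; apply: measurableT_comp => //; exact: measurable_fun_inv.
Qed.

Lemma measurable_interference : measurable_fun setT (interference dist).
Proof. by apply: measurableT_comp => //; exact: measurable_ext_interference. Qed.

Lemma measurable_SINR (eta : R) : measurable_fun setT (SINR eta dist).
Proof.
apply: measurable_funM.
  by apply: measurableT_comp => //; exact: measurable_fun_inv.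
apply: measurableT_comp; first exact: measurable_fun_inv.
by apply: measurable_funD => //; exact: measurable_interference.
Qed.

Lemma invSINR (eta : R) x : (SINR eta dist x)^-1 = dist 0%N x * (interference dist x + eta).
Proof. by rewrite /SINR invf_div invrK mulrC. Qed.

Hypotheses (scs : canonical_SCS lambda dist).
Hypothesis PI_fin : {ae P, forall x, (ext_interference dist x < +oo)%E}.

Lemma null_irregular : exists N, [/\ measurable N, P N = 0%E & forall x, ~ N x -> regular dist x].
Proof.
have [N [mN N0 sN]] := ae_regular scs PI_fin.
by exists N; split => // x Nx; apply: contrapT => rx; apply/Nx/sN.
Qed.

(** The second station alone contributes a positive power; the denominator of the SINR is therefore
    positive even when there is no noise. *)
Lemma regular_interference_gt0 x : regular dist x -> 0 < interference dist x.
Proof.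
move=> rx; have p k := regular_gt0 k rx; have [_ _ pi] := rx.
have pos k : (0 <= ((dist k x)^-1)%:E)%E by rewrite lee_fin invr_ge0 ltW.
rewrite /interference fine_gt0// pi andbT.
rewrite /ext_interference (nneseries_split 1 1); last by move=> k _; exact: pos.
rewrite big_nat1 (@lt_le_trans _ _ ((dist 1%N x)^-1)%:E)//.
  by rewrite lte_fin invr_gt0.
by rewrite leeDl//; apply: nneseries_ge0 => k _ _; exact: pos.
Qed.

End interference.

(** * Discretization of a random variable *)

Section discretization.
Context {R : realType} d (T : measurableType d) (P : probability T R).
Variable Y : T -> R.
Hypothesis mY : measurable_fun setT Y.
Import Normc.

Let mI (i : interval R) : measurable ([set` i] : set (measurableTypeR R)).
Proof. exact: measurable_itv. Qed.

Let mpre (B : set (measurableTypeR R)) : measurable B -> measurable (Y @^-1` B).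
Proof. by move=> mB; rewrite -[_ @^-1` _]setTI; exact: mY. Qed.

(* [Y] is rounded up to the right endpoint of its cell. *)
Definition step (M : R) n (h : R -> T -> R[i]) (x : T) : R[i] :=
  \sum_(0 <= j < n.+1) (\1_(cell 0 M n.+1 j) (Y x))%:C * h (grid 0 M n.+1 j.+1) x.

(** Continuity in [t] is asked only along bounded sequences from the right of [Y x], since [Y] is
    rounded up. The bound is 2 and not 1 because it must cover conditional characteristic functions,
    which are estimated through [normc_Cintegral_le]. *)
Definition admissible (h : R -> T -> R[i]) :=
  [/\ forall t, 0 < t -> cmeasurable setT (h t),
      forall t x, 0 < t -> normc (h t x) <= 2 &
      forall x (u : nat -> R) (M : R), 0 < Y x -> (forall n, Y x <= u n <= M) -> u n @[n --> \oo] --> Y x ->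
        ccvg (fun n => h (u n) x) (h (Y x) x)].

Lemma grid_gt0 (M : R) n j : 0 < M -> 0 < grid 0 M n.+1 j.+1.
Proof. by move=> M0; rewrite /grid add0r subr0 mulr_gt0// divr_gt0// ltr0n. Qed.

Lemma stepE (M : R) n j h x : 0 < M -> (j < n.+1)%N -> cell 0 M n.+1 j (Y x) ->
  step M n h x = h (grid 0 M n.+1 j.+1) x.
Proof.
move=> M0 jn cj; rewrite /step (bigD1_seq j) ?iota_uniq ?mem_index_iota//=.
rewrite indicE mem_set// mul1r big_seq_cond big1 ?addr0// => k /andP[_ kj].
rewrite indicE memNset ?mul0r// => ck.
move: kj; rewrite neq_ltn => /orP[kj|jk].
  by have := cell_disjoint n.+1 (ltW M0) kj => /seteqP[/(_ (Y x))+ _]; apply.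
by have := cell_disjoint n.+1 (ltW M0) jk => /seteqP[/(_ (Y x))+ _]; apply.
Qed.

Lemma step_cvg (M : R) h x : 0 < M -> admissible h -> `]0, M]%classic (Y x) ->
  ccvg (fun n => step M n h x) (h (Y x) x).
Proof.
move=> M0 [_ _ hc] YM.
have ex n : exists j, (j < n.+1)%N /\ cell 0 M n.+1 j (Y x).
  by have [j] := cell_cover M0 (ltn0Sn n) YM; exists j.
pose j n := projT1 (cid (ex n)).
have jP n : (j n < n.+1)%N /\ cell 0 M n.+1 (j n) (Y x) by exact: projT2 (cid (ex n)).
rewrite (_ : (fun n => _) = (fun n => h (grid 0 M n.+1 (j n).+1) x)); last first.
  by apply/funext => n; apply: stepE => //; apply jP.
have Yle n : Y x <= grid 0 M n.+1 (j n).+1.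
  by have [_] := jP n; rewrite /cell/= in_itv/= => /andP[].
apply: (hc _ _ M); first by move: YM; rewrite /= in_itv/= => /andP[].
  by move=> n; rewrite Yle grid_le ?(ltW M0)//; apply (jP n).1.
apply: (@squeeze_cvgr _ _ _ _ (cst (Y x)) (fun n => Y x + (M - 0) / n.+1%:R)).
- apply: nearW => n; rewrite Yle/= -(gridS 0 M n.+1 (j n)).
  have [_] := jP n; rewrite /cell/= in_itv/= => /andP[h1 _].
  by rewrite addrCA lerDl subr_ge0 ltW.
- exact: cvg_cst.
- by rewrite -[X in _ --> X]addr0; apply: cvgD; [exact: cvg_cst|exact: mesh_cvg0].
Qed.

Lemma normc_step_le (M : R) n h x : 0 < M -> admissible h -> `]0, M]%classic (Y x) ->
  normc (step M n h x) <= 2.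
Proof.
move=> M0 [_ h1 _] YM; have [j jn cj] := cell_cover M0 (ltn0Sn n) YM.
by rewrite (stepE _ M0 jn cj); apply: h1; exact: grid_gt0.
Qed.

Lemma cmeasurable_indicM (A : set T) (f : T -> R[i]) : measurable A -> cmeasurable setT f ->
  cmeasurable setT (fun x => (\1_A x)%:C * f x).
Proof. by move=> mA mf; apply: cmeasurableM => //; exact: cmeasurable_real. Qed.

Lemma cmeasurable_step (M : R) n h : 0 < M -> admissible h -> cmeasurable setT (step M n h).
Proof.
move=> M0 [mh _ _]; apply: cmeasurable_sum => j.
apply: (cmeasurable_indicM (A := Y @^-1` cell 0 M n.+1 j)); last by apply: mh; exact: grid_gt0.
by apply: mpre; exact: measurable_cell.
Qed.

Lemma cmeasurable_cvg (D : set T) (f_ : nat -> T -> R[i]) (f : T -> R[i]) : measurable D ->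
  (forall n, cmeasurable D (f_ n)) -> (forall x, D x -> ccvg (f_ ^~ x) (f x)) ->
  cmeasurable D f.
Proof.
move=> mD mf cf; split.
  by apply: (measurable_fun_cvg (fun n => (mf n).1)) => x Dx; exact: (cf x Dx).1.
by apply: (measurable_fun_cvg (fun n => (mf n).2)) => x Dx; exact: (cf x Dx).2.
Qed.

Lemma cmeasurableS (A D : set T) (f : T -> R[i]) : measurable D -> A `<=` D ->
  cmeasurable D f -> cmeasurable A f.
Proof. by move=> mD AD [f1 f2]; split; exact: measurable_funS mD AD _. Qed.

(** [h] is only measurable in [x] for fixed [t] and right-continuous in [t]; the diagonal is
    measurable as the limit of its roundings. *)
Lemma cmeasurable_diag (M : R) h : 0 < M -> admissible h ->
  cmeasurable (Y @^-1` `]0, M]) (fun x => h (Y x) x).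
Proof.
move=> M0 ah; apply: (cmeasurable_cvg (f_ := fun n => step M n h)).
- by apply: mpre.
- by move=> n; apply: (cmeasurableS measurableT) => //; exact: cmeasurable_step.
- by move=> x; exact: step_cvg.
Qed.

Lemma Cintegral_sum (D : set T) (f : nat -> T -> R[i]) m : measurable D ->
  (forall j, Cintegrable P D (f j)) ->
  Cintegral P D (fun x => \sum_(0 <= j < m) f j x) = \sum_(0 <= j < m) Cintegral P D (f j) /\
  Cintegrable P D (fun x => \sum_(0 <= j < m) f j x).
Proof.
move=> mD fi; elim: m => [|m [IH1 IH2]].
  rewrite big_nil; under eq_fun do rewrite big_nil.
  split; first by rewrite Cintegral_cst// mul0r.
  by split; [exact: integrable0|exact: integrable0].
rewrite big_nat_recr//= -IH1; under eq_fun do rewrite big_nat_recr//=.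
by split; [exact: CintegralD|exact: CintegrableD].
Qed.

Lemma Cintegral_step (M : R) n h : 0 < M -> admissible h ->
  Cintegral P (Y @^-1` `]0, M]) (step M n h) =
  \sum_(0 <= j < n.+1) Cintegral P (Y @^-1` cell 0 M n.+1 j) (h (grid 0 M n.+1 j.+1)).
Proof.
move=> M0 [mh h1 _]; have g0 j := grid_gt0 n j M0.
transitivity (Cintegral P setT (step M n h)).
  rewrite Cintegral_mkcond; apply: eq_Cintegral => x _.
  have [xM|xM] := pselect (`]0, M]%classic (Y x)); first by rewrite indicE mem_set// mul1r.
  rewrite indicE memNset// mul0r /step big_seq big1// => j; rewrite mem_index_iota => /andP[_ jn].
  rewrite indicE memNset ?mul0r// => cj; apply: xM.
  exact: (cell_sub (ltW M0) jn).
have ci j : Cintegrable P setT (fun x => (\1_(cell 0 M n.+1 j) (Y x))%:C * h (grid 0 M n.+1 j.+1) x).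
  apply: (@Cintegrable_bounded _ _ _ _ _ _ 2); [exact: measurableT|exact: probability_lty| |].

  - apply: (cmeasurable_indicM (A := Y @^-1` cell 0 M n.+1 j)); last exact: mh.
    by apply: mpre; exact: measurable_cell.
  - move=> x _; rewrite normcM normc_real -[leRHS]mul1r ler_pM ?normc_ge0 ?h1//.
    by rewrite ger0_norm// indicE lern1 leq_b1.
rewrite (Cintegral_sum n.+1 measurableT ci).1; apply: eq_bigr => j _.
by rewrite [RHS]Cintegral_mkcond; apply: eq_Cintegral.
Qed.

Lemma Cintegral_step_cvg (M : R) h : 0 < M -> admissible h ->
  ccvg (fun n => Cintegral P (Y @^-1` `]0, M]) (step M n h))
       (Cintegral P (Y @^-1` `]0, M]) (fun x => h (Y x) x)).
Proof.
move=> M0 ah; have mD : measurable (Y @^-1` `]0, M]) by exact: mpre.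
apply: (Cdominated_cvg (g := cst 2)) => //.
- by move=> n; apply: (cmeasurableS measurableT) => //; exact: cmeasurable_step.
- exact: cmeasurable_diag.
- by apply: aeW => x; exact: step_cvg.
- by apply: (Rintegral_bounded (M := 2)) => //; rewrite ?probability_lty// => x _; rewrite ger0_norm.
- by move=> n x; exact: normc_step_le.
Qed.

(** Reduces an identity between functions of [Y] and the sample point to a comparison on each cell
    with [Y] frozen at the right endpoint; only the sum of the errors over the cells has to
    vanish. *)
Lemma Cintegral_discretize (M : R) (e : nat -> nat -> R) h1 h2 : 0 < M ->
  admissible h1 -> admissible h2 ->
  (forall n j, (j < n.+1)%N ->
     normc (Cintegral P (Y @^-1` cell 0 M n.+1 j) (h1 (grid 0 M n.+1 j.+1)) -
            Cintegral P (Y @^-1` cell 0 M n.+1 j) (h2 (grid 0 M n.+1 j.+1))) <= e n j) ->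
  \sum_(0 <= j < n.+1) e n j @[n --> \oo] --> 0 ->
  Cintegral P (Y @^-1` `]0, M]) (fun x => h1 (Y x) x) =
  Cintegral P (Y @^-1` `]0, M]) (fun x => h2 (Y x) x).
Proof.
move=> M0 a1 a2 he e0.
apply: (ccvg_eq (Cintegral_step_cvg M0 a1) (Cintegral_step_cvg M0 a2) _ e0) => n.
rewrite !Cintegral_step// -sumrB.
rewrite !big_seq; elim/big_ind2 : _ => [|a b a' b' ab ab'|j].
- by rewrite normc_real normr0.
- by rewrite (le_trans (ler_normcD _ _))// lerD.
- by rewrite mem_index_iota => /andP[_ jn]; exact: he.
Qed.

Lemma Cintegral_discretizeT (N : set T) (e : R -> nat -> nat -> R) h1 h2 :
  measurable N -> P N = 0%E -> (forall x, ~ N x -> 0 < Y x) ->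
  admissible h1 -> admissible h2 ->
  (forall M n j, 0 < M -> (j < n.+1)%N ->
     normc (Cintegral P (Y @^-1` cell 0 M n.+1 j) (h1 (grid 0 M n.+1 j.+1)) -
            Cintegral P (Y @^-1` cell 0 M n.+1 j) (h2 (grid 0 M n.+1 j.+1))) <= e M n j) ->
  (forall M, 0 < M -> \sum_(0 <= j < n.+1) e M n j @[n --> \oo] --> 0) ->
  Cintegral P setT (fun x => h1 (Y x) x) = Cintegral P setT (fun x => h2 (Y x) x).
Proof.
move=> mN N0 Y0 a1 a2 he e0.
have M0 n : 0 < n.+1%:R :> R by rewrite ltr0n.
have eqM n := Cintegral_discretize (M0 n) a1 a2 (fun m j => @he _ m j (M0 n)) (e0 _ (M0 n)).
have mD n : measurable (Y @^-1` `]0, n.+1%:R]) by exact: mpre.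
have mpos : measurable (Y @^-1` `]0, +oo[) by exact: mpre.
have sub n : Y @^-1` `]0, n.+1%:R] `<=` Y @^-1` `]0, +oo[.
  by move=> x; rewrite /= !in_itv/= andbT => /andP[].
have big x : (Y @^-1` `]0, +oo[) x -> \forall n \near \oo, (Y @^-1` `]0, n.+1%:R]) x.
  rewrite /= in_itv/= andbT => Yx.
  have [n _ hn] := nbhs_infty_ger (Y x); exists n => // m nm.
  rewrite /= in_itv/= Yx/=; apply: (le_trans (hn m nm)).
  by rewrite ler_nat.
have mpos_diag h : admissible h -> cmeasurable (Y @^-1` `]0, +oo[) (fun x => h (Y x) x).
  move=> ah; have -> : Y @^-1` `]0, +oo[ = \bigcup_n Y @^-1` `]0, n.+1%:R].
    apply/seteqP; split => x; last by case=> n _; exact: sub.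
    by move=> /big[n _ hn]; exists n => //; exact: hn (leqnn n).
  by split; apply/measurable_fun_bigcup => // n; have [] := cmeasurable_diag (M0 n) ah.
have cv h : admissible h -> ccvg (fun n => Cintegral P (Y @^-1` `]0, n.+1%:R]) (fun x => h (Y x) x))
    (Cintegral P (Y @^-1` `]0, +oo[) (fun x => h (Y x) x)).
  move=> ah; apply: (Cdominated_cvg_sets (g := cst 2)) => //.
  - by move=> n; exact: mpos_diag.
  - exact: mpos_diag.
  - by move=> x _; exact: ccvg_cst.
  - by apply: (Rintegral_bounded (M := 2)) => //; rewrite ?probability_lty// => x _; rewrite ger0_norm.
  - by move=> n x; rewrite /= in_itv/= => /andP[Yx _]; have [_ bh _] := ah; exact: bh.
(* Off [N] the variable is positive, so restricting to []0, +oo[] changes nothing; no measurability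
   outside that set is involved. *)
have off h : Cintegral P setT (fun x => h (Y x) x) = Cintegral P (Y @^-1` `]0, +oo[) (fun x => h (Y x) x).
  rewrite [RHS]Cintegral_mkcond; apply: (Cintegral_off_null mN N0) => x /Y0 Yx.
  by rewrite indicE mem_set ?mul1r//= in_itv/= andbT.
rewrite !off; apply: (ccvg_eq (cv _ a1) (cv _ a2) (e := fun=> 0)); last exact: cvg_cst.
by move=> n; rewrite eqM subrr normc_real normr0.
Qed.

End discretization.

(** * Law of the nearest point and of the interference *)

(** The two cut-off integrands agree outside [S] and [N]. Their difference is bounded by 2, and
    [normc_Cintegral_le] contributes another factor 2. *)
Lemma normc_CintegralB_le {R : realType} d (T : measurableType d) (P : probability T R)
    (A B S N : set T) (f g : T -> R[i]) :
  measurable A -> measurable B -> measurable S -> measurable N -> P N = 0%E ->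
  cmeasurable setT f -> cmeasurable setT g ->
  (forall x, Normc.normc (f x) <= 1) -> (forall x, Normc.normc (g x) <= 1) ->
  (forall x, ~ N x -> ~ S x -> (A x <-> B x) /\ (A x -> f x = g x)) ->
  Normc.normc (Cintegral P A f - Cintegral P B g) <= 4 * pr P S.
Proof.
move=> mA mB mS mN N0 mf mg f1 g1 fg.
have le1 C (h : T -> R[i]) x : Normc.normc (h x) <= 1 -> Normc.normc ((\1_C x)%:C * h x) <= 1.
  move=> h1; rewrite Normc.normcM normc_real -[leRHS]mul1r ler_pM ?normc_ge0//.
  by rewrite ger0_norm// indicE lern1 leq_b1.
have ci C h : measurable C -> cmeasurable setT h -> (forall x, Normc.normc (h x) <= 1) ->
    Cintegrable P setT (fun x => (\1_C x)%:C * h x).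
  move=> mC mh h1; apply: (@Cintegrable_bounded _ _ _ _ _ _ 1); [exact: measurableT|exact: probability_lty| |].
    exact: cmeasurable_indicM.
  by move=> x _; exact: le1.
rewrite (Cintegral_mkcond _ A) (Cintegral_mkcond _ B).
rewrite -CintegralB//; try exact: ci.
pose h x := (\1_A x)%:C * f x - (\1_B x)%:C * g x.
have mSN : measurable (S `|` N) by exact: measurableU.
have -> : Cintegral P setT (fun x => (\1_A x)%:C * f x - (\1_B x)%:C * g x) = Cintegral P (S `|` N) h.
  rewrite [RHS]Cintegral_mkcond; apply: eq_Cintegral => x _.
  have [SN|/not_orP[nS nN]] := pselect ((S `|` N) x); first by rewrite [\1_(_ `|` _) x]indicE mem_set// mul1r.
  have [AB fgx] := fg x nN nS.
  rewrite [\1_(_ `|` _) x]indicE memNset; last by case.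
  rewrite mul0r !indicE; have [Ax|Ax] := pselect (A x).
    by rewrite mem_set// (mem_set (AB.1 Ax)) fgx// subrr.
  by rewrite memNset// memNset ?mul0r ?subrr// => /AB.2.
have pSN : fine (P (S `|` N)) = pr P S.
  congr fine; apply/eqP; rewrite eq_le; apply/andP; split.
    have := measureU2 P mS mN; rewrite [X in (_ + X)%E](_ : _ = 0%E)//.
    by rewrite adde0.
  by rewrite le_measure ?inE//; exact: subsetUl.
rewrite -pSN (_ : 4 = 2 * 2); last by rewrite -natrM.
apply: normc_Cintegral_le => //.
- exact: probability_lty.
- apply: (cmeasurableS measurableT) => //; apply: cmeasurableB; exact: cmeasurable_indicM.
- by move=> x _; rewrite (le_trans (ler_normcB _ _))// -[leRHS]/(1 + 1) lerD// le1.
Qed.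

Section nearest_law.
Context {R : realType} d (T : measurableType d) (P : probability T R).
Variables (lambda : R -> R) (dist : nat -> {RV P >-> R}).
Hypotheses (scs : canonical_SCS lambda dist).
Hypothesis PI_fin : {ae P, forall x, (ext_interference dist x < +oo)%E}.
Notation mass := (@mass R lambda).
Notation good := (good lambda).
Notation cev := (cev dist).
Notation point_sum := (point_sum dist).
Notation pr := (pr P).
Notation several := (several dist).

Let dens : bs_density lambda. Proof. by case: scs. Qed.
Let pp : poisson_process lambda dist. Proof. by case: scs. Qed.

Let mI (i : interval R) : measurable ([set` i] : set (measurableTypeR R)).
Proof. exact: measurable_itv. Qed.

(** Outside [several], this prescription of counts means that R_1 belongs to the part of []a, b]]
    inside [B]. With B = [setT] the last set is empty. *)
Definition nearest_counts (a b : R) (B : set R) : seq (set R * nat) :=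
  [:: (`[0, a]%classic, 0%N); (`]a, b] `&` B, 1%N); (`]a, b] `\` B, 0%N)].

Lemma subset_oc_cc (a b : R) : 0 <= a -> (`]a, b]%classic : set R) `<=` `[0, b]%classic.
Proof. by move=> a0 r; rewrite /= !in_itv/= => /andP[/ltW/(le_trans a0) -> ->]. Qed.

Lemma good_nearest_counts (a b : R) (B : set (measurableTypeR R)) : 0 <= a -> a < b ->
  measurable B -> good (map fst (nearest_counts a b B)).
Proof.
move=> a0 ab mB; have b0 := le_trans a0 (ltW ab).
have fm (C : set (measurableTypeR R)) : measurable C -> C `<=` `]a, b] -> finite_mean lambda C.
  move=> mC sC; apply: (finite_mean_bounded dens mC b0).
  exact: (subset_trans sC (subset_oc_cc a0)).
have dis (C : set R) : C `<=` `]a, b] -> `[0, a] `&` C = set0.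
  move=> sC; apply/seteqP; split => // r [/= ra /sC /=]; move: ra.
  by rewrite !in_itv/= => /andP[_ ra] /andP[+ _]; rewrite ltNge ra.
split=> /=.
- case=> [|[|[|//]]] _ /=.
  + exact: (finite_mean_bounded dens (mI _) a0).
  + apply: fm; [exact: measurableI (mI _) mB|exact: subIsetl].
  + apply: fm; [exact: measurableD (mI _) mB|exact: subDsetl].
- case=> [|[|[|i]]] [|[|[|j]]] //=; rewrite ?andbF//= => _.
  + by apply: dis; exact: subIsetl.
  + by apply: dis; exact: subDsetl.
  + by rewrite setDE setIACA setICr setI0.
Qed.

Lemma nearest_counts_sub (a b : R) (B : set R) : 0 <= a -> a < b ->
  forall C, C \in map fst (nearest_counts a b B) -> C `<=` `[0, b].
Proof.
move=> a0 ab C; rewrite !inE => /or3P[]/eqP ->.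
- by move=> r; rewrite /= !in_itv/= => /andP[-> /le_trans]; apply; exact: ltW.
- by apply: subset_trans (subset_oc_cc a0); exact: subIsetl.
- by apply: subset_trans (subset_oc_cc a0); exact: subDsetl.
Qed.

Lemma mass_itv_oc_split (a b : R) (B : set (measurableTypeR R)) : 0 <= a -> a < b -> measurable B ->
  mass (`]a, b] `&` B) + mass (`]a, b] `\` B) = mass `]a, b].
Proof.
move=> a0 ab mB; rewrite /mass -Rintegral_setU//.
- by rewrite setUIDK.
- exact: measurableI.
- exact: measurableD.
- by rewrite setUIDK; exact: (integrable_density_oc scs).
- by apply/disj_setPS => r [[_ Br] [_ /(_ Br)]].
Qed.

Lemma mass_itv_cc_split (a b : R) : 0 <= a -> a < b ->
  mass `[0, a] + mass `]a, b] = mass `[0, b].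
Proof.
move=> a0 ab; have b0 := le_trans a0 (ltW ab).
have U : (`[0, a] `|` `]a, b])%classic = (`[0, b]%classic : set R).
  by rewrite -itv_bndbnd_setU// bnd_simp// ltW.
rewrite /mass -Rintegral_setU ?U//.
- exact: (integrable_density dens (mI _) b0).
- apply/disj_setPS => r [/=]; rewrite !in_itv/= => /andP[_ ra] /andP[+ _].
  by rewrite ltNge ra.
Qed.

Lemma pr_nearest_counts (a b : R) (B : set (measurableTypeR R)) : 0 <= a -> a < b ->
  measurable B ->
  pr (cev (nearest_counts a b B)) = mass (`]a, b] `&` B) * expR (- mass `[0, b]).
Proof.
move=> a0 ab mB.
rewrite /pr (prob_cev pp (good_nearest_counts a0 ab mB)) /= !big_cons big_nil mulr1/=.
rewrite !poisson_weight0 poisson_weight1 -(mass_itv_cc_split a0 ab) -(mass_itv_oc_split a0 ab mB).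
by rewrite !opprD !expRD; ring.
Qed.

Lemma nearest_countsP x (a b : R) (B : set R) : regular dist x -> 0 <= a -> a < b ->
  ~ several `]a, b] x ->
  (dist 0 @^-1` (`]a, b] `&` B)) x <-> cev (nearest_counts a b B) x.
Proof.
move=> rx a0 ab sx; rewrite /cev !big_cons big_nil; split.
  by move=> /(nearest_cell_events rx a0)/(_ sx)[].
move=> [h0 [h1 [h2 _]]].
have [k [kab kB] _] := count_event1 h1.
have d0 := count_event0 (k := 0%N) h0.
have d0ab : `]a, b]%classic (dist 0 x).
  move: kab; rewrite /= !in_itv/= => /andP[_ kb]; rewrite (le_trans (regular_le rx (leq0n k)) kb).
  rewrite andbT ltNge; apply/negP => da; apply: d0; rewrite /= in_itv/= da andbT.
  by rewrite ltW// regular_gt0.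
split => //; apply: contrapT => nB; apply: (count_event0 (k := 0%N) h2).
by split.
Qed.

Lemma interference_nearest x (a b : R) : regular dist x -> 0 <= a -> a < b ->
  ~ several `]a, b] x -> `]a, b]%classic (dist 0 x) ->
  interference dist x = point_sum `]b, +oo[ x.
Proof.
move=> rx a0 ab sx xab.
have xT : (`]a, b]%classic `&` setT) (dist 0 x) by rewrite setIT.
have [h0 + _] := nearest_cell_events rx a0 xT sx; rewrite setIT => h1.
have [_] := nearest_in_cell rx a0 ab h0 h1.
by rewrite /interference => ->.
Qed.

End nearest_law.

(** * The characteristic function of 1/SINR *)

Section characteristic_function.
Context {R : realType} d (T : measurableType d) (P : probability T R).
Variables (lambda : R -> R) (dist : nat -> {RV P >-> R}).
Hypotheses (scs : canonical_SCS lambda dist).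
Hypothesis PI_fin : {ae P, forall x, (ext_interference dist x < +oo)%E}.
Variables (eta w : R).
Notation mu := (@lebesgue_measure R).
Notation mass := (@mass R lambda).
Notation cev := (cev dist).
Notation point_sum := (point_sum dist).
Notation pr := (pr P).
Notation several := (several dist).
Notation campbell := (campbell_exponent lambda).
Import Normc.

Let dens : bs_density lambda. Proof. by case: scs. Qed.

Let mI (i : interval R) : measurable ([set` i] : set (measurableTypeR R)).
Proof. exact: measurable_itv. Qed.

(** The conditional characteristic function of 1/SINR at [w], given R_1 = t. *)
Definition char_given (t : R) : R[i] :=
  cexp ('i%C * (w * t * eta)%:C) * cexp (campbell `]t, +oo[ ('i%C * (w * t)%:C)).

(** R_1 (P_I + eta) with the factor R_1 frozen at [t] and the interference left random. *)
Definition char_at (t : R) (x : T) : R[i] := cexp ('i%C * (w * t * (interference dist x + eta))%:C).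

(** The real part of exp(z/r) - 1 is nonpositive when Re z <= 0, and [lambda] is nonnegative. *)
Lemma Re_campbell_le0 (b : R) (z : R[i]) : 0 < b -> complex.Re z <= 0 ->
  complex.Re (campbell `]b, +oo[ z) <= 0.
Proof.
move=> b0 z0.
have fle s : (`]b, +oo[%classic : set R) s ->
    normc ((cexp (z / s%:C) - 1) * (lambda s)%:C) <= 3 * normc z * (s^-1 * lambda s).
  rewrite /= in_itv/= andbT => bs.
  exact: (normc_campbell_le scs z0 (lexx _) (lt_trans b0 bs)).
have id : mu.-integrable `]b, +oo[ (EFin \o (fun s => 3 * normc z * (s^-1 * lambda s))).
  by apply: eq_integrable (integrableZl (mI _) _ (integrable_density_inv scs PI_fin b0)).
have [ire _] := le_Cintegrable (mI _) (cmeasurable_campbell scs z (subset_oy_cy (ltW b0)) (mI _)) id fle.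
have <- : \int[mu]_(s in `]b, +oo[) (0 : R) = 0 by rewrite /Rintegral integral0.
apply: (le_Rintegral (mI _) ire); first exact: integrable0.
have bE s : (`]b, +oo[%classic : set R) s -> b < s by rewrite /= in_itv/= andbT.
move=> s /bE bs; change (complex.Re ((cexp (z / s%:C) - 1) * (lambda s)%:C) <= 0).
rewrite Re_scaled mulr_le0_ge0 ?(density_gt_ge0 scs (ltW b0) bs)//.
rewrite cReB subr_le0; apply: (le_trans (ler_norm _)).
by apply: (le_trans (ler_norm_Re _)); exact: (normc_cexp_div_le1 z0 (lt_trans b0 bs)).
Qed.

Lemma Re_imaginary_le0 (r : R) : complex.Re ('i%C * r%:C) <= 0.
Proof. by rewrite mul_i_real. Qed.

Lemma normc_char_given_le1 t : 0 < t -> normc (char_given t) <= 1.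
Proof.
move=> t0; rewrite /char_given normcM -[leRHS]mul1r ler_pM ?normc_ge0//.
  by apply: normc_cexp_le1; exact: Re_imaginary_le0.
by apply: normc_cexp_le1; apply: Re_campbell_le0 => //; exact: Re_imaginary_le0.
Qed.

Lemma admissible_char_given : admissible (dist 0) (fun t _ => char_given t).
Proof.
split.
- by move=> t _; exact: cmeasurable_cst.
- by move=> t _ t0; rewrite (le_trans (normc_char_given_le1 t0))// ler1n.
- move=> x u M x0 ux cu.
  have czn : ccvg (fun n => 'i%C * (w * u n)%:C) ('i%C * (w * dist 0 x)%:C).
    apply: ccvgM; first exact: ccvg_cst.
    by apply: ccvg_real; apply: cvgM => //; exact: cvg_cst.
  apply: ccvgM.
    apply: ccvg_cexp; apply: ccvgM; first exact: ccvg_cst.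
    apply: ccvg_real; apply: cvgM; last exact: cvg_cst.
    by apply: cvgM => //; exact: cvg_cst.
  apply: ccvg_cexp; apply: (campbell_exponent_cvg scs PI_fin (b := dist 0 x) (C := `|w| * M)) => //.
  + by move=> n; have /andP[] := ux n.
  + by move=> n; have /andP[] := ux n.
  + exact: Re_imaginary_le0.
  + by move=> n; exact: Re_imaginary_le0.
  + move=> n; have /andP[xu uM] := ux n.
    rewrite mul_i_real /normc expr0n/= add0r sqrtr_sqr normrM ler_wpM2l//.
    by rewrite ger0_norm// (le_trans (ltW x0) xu).
Qed.

Lemma admissible_char_at : admissible (dist 0) char_at.
Proof.
have mI' := measurable_interference dist.
split.
- move=> t _; apply: cmeasurable_cexp; apply: cmeasurableM; first exact: cmeasurable_cst.
  apply: cmeasurable_real; apply: measurable_funM; first exact: measurable_cst.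
  by apply: measurable_funD => //; exact: measurable_cst.
- move=> t x _; apply: (@le_trans _ _ 1); last by rewrite ler1n.
  by apply: normc_cexp_le1; rewrite mul_i_real.
- move=> x u M x0 ux cu; apply: ccvg_cexp; apply: ccvgM; first exact: ccvg_cst.
  apply: ccvg_real; apply: cvgM; last exact: cvg_cst.
  by apply: cvgM => //; exact: cvg_cst.
Qed.

(** Both integrals are moved to the count event [cev s], at the cost of 4 times the probability of
    [several] each; there the interference is replaced by the sum over the points beyond [b], and
    Campbell's formula makes them equal. Hence 8 = 4 + 4. *)
Lemma char_at_cell (a b : R) : 0 <= a -> a < b ->
  normc (Cintegral P (dist 0 @^-1` `]a, b]) (char_at b) -
         Cintegral P (dist 0 @^-1` `]a, b]) (fun=> char_given b)) <= 8 * mass `]a, b] ^+ 2.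
Proof.
move=> a0 ab; have b0 : 0 < b := le_lt_trans a0 ab.
have [N [mN N0 Nr]] := null_irregular scs PI_fin.
have mT := good_nearest_counts scs a0 ab (@measurableT _ (measurableTypeR R)).
set s := nearest_counts a b setT in mT.
have mA : measurable (dist 0 @^-1` `]a, b]) by rewrite -[_ @^-1` _]setTI; exact: measurable_dist.
have mC : measurable (cev s) by exact: (measurable_cev dist mT).
have mS : measurable (several `]a, b]) by exact: (measurable_several dist (mI _)).
have fm : finite_mean lambda `]a, b].
  by apply: (finite_mean_bounded dens (mI _) (ltW b0)); exact: subset_oc_cc.
have key x : ~ N x -> ~ several `]a, b] x ->
    ((dist 0 @^-1` `]a, b]) x <-> cev s x) /\
    ((dist 0 @^-1` `]a, b]) x -> interference dist x = point_sum `]b, +oo[ x).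
  move=> /Nr rx sx; split.
    by have := nearest_countsP setT rx a0 ab sx; rewrite setIT.
  exact: (interference_nearest rx a0 ab sx).
pose f x := cexp ('i%C * (w * b * eta)%:C) * cexp ('i%C * (w * b)%:C * (point_sum `]b, +oo[ x)%:C).
have mf : cmeasurable setT (fun x => cexp ('i%C * (w * b)%:C * (point_sum `]b, +oo[ x)%:C)).
  apply: cmeasurable_cexp; apply: cmeasurableM; first exact: cmeasurable_cst.
  by apply: cmeasurable_real; apply: measurable_point_sum => //; exact: subset_oy_cy (ltW b0).
have fle x : normc (cexp ('i%C * (w * b)%:C * (point_sum `]b, +oo[ x)%:C)) <= 1.
  by apply: normc_cexp_le1; rewrite Re_scaled mul_i_real mul0r.
have [mh _ _] := admissible_char_at.
have h1 : normc (Cintegral P (dist 0 @^-1` `]a, b]) (char_at b) - Cintegral P (cev s) f) <=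
    4 * pr (several `]a, b]).
  apply: (normc_CintegralB_le mA mC mS mN N0).
  - exact: mh.
  - by apply: cmeasurableM => //; exact: cmeasurable_cst.
  - by move=> x; apply: normc_cexp_le1; rewrite mul_i_real.
  - move=> x; rewrite normcM -[leRHS]mul1r ler_pM ?normc_ge0//.
    by apply: normc_cexp_le1; exact: Re_imaginary_le0.
  - move=> x Nx sx; have [k1 k2] := key x Nx sx; split=> // /k2 e.
    rewrite /char_at /f -cexpD e -['i%C * (w * b)%:C * _]mulrA -mulrDr -rmorphM -rmorphD.
    by rewrite mulrDr addrC.
have h2 : normc (Cintegral P (dist 0 @^-1` `]a, b]) (fun=> char_given b) -
    Cintegral P (cev s) (fun=> char_given b)) <= 4 * pr (several `]a, b]).
  apply: (normc_CintegralB_le mA mC mS mN N0).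
  - exact: cmeasurable_cst.
  - exact: cmeasurable_cst.
  - by move=> x; exact: normc_char_given_le1.
  - by move=> x; exact: normc_char_given_le1.
  - by move=> x Nx sx; have [k1 _] := key x Nx sx.
have eqs : Cintegral P (cev s) f = Cintegral P (cev s) (fun=> char_given b).
  rewrite Cintegral_cst// /f CintegralZl//; last first.
    apply: (@Cintegrable_bounded _ _ _ _ _ _ 1) => //.
    + exact: probability_lty.
    + exact: (cmeasurableS measurableT).
  rewrite (point_sum_char_oy scs PI_fin b0 _ mT (nearest_counts_sub a0 ab)); last exact: Re_imaginary_le0.
  by rewrite /char_given -/(pr (cev s)) mulrCA mulrC.
have sv := pr_several_le scs fm.
set A1 := Cintegral _ _ _ in h1 *; set A2 := Cintegral _ _ _ in h2 *.
rewrite eqs in h1; set A3 := Cintegral _ _ _ in h1 h2.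
have -> : A1 - A2 = (A1 - A3) - (A2 - A3) by rewrite opprB addrA subrK.
rewrite (le_trans (ler_normcB _ _))// (le_trans (lerD h1 h2))//.
by rewrite -mulrDl -natrD ler_wpM2l.
Qed.

(** The cellwise errors are 8 times the squared masses, whose sum tends to 0. *)
Lemma charfun_invSINR : charfun P (fun x => (SINR eta dist x)^-1) w =
  Cexpectation P (fun x => char_given (dist 0 x)).
Proof.
have [N [mN N0 Nr]] := null_irregular scs PI_fin.
transitivity (Cintegral P setT (fun x => char_at (dist 0 x) x)).
  apply: eq_Cintegral => x _; rewrite /char_at invSINR -['i%C * _ * _]mulrA -rmorphM.
  by rewrite mulrA.
apply: (@Cintegral_discretizeT _ _ _ P (dist 0) (measurable_dist dist 0) N (fun M n j => 8 * mass (cell 0 M n.+1 j) ^+ 2)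
    char_at (fun t _ => char_given t)) => //.
- by move=> x /Nr; exact: regular_gt0.
- exact: admissible_char_at.
- exact: admissible_char_given.
- move=> M n j M0 jn; apply: char_at_cell; first exact: (grid_ge _ _ (ltW M0)).
  by rewrite -subr_gt0 gridS subr0 divr_gt0// ltr0n.
- move=> M M0.
  rewrite (_ : (fun n => _) = (fun n => 8 * \sum_(0 <= j < n.+1) mass (cell 0 M n.+1 j) ^+ 2)).
    rewrite -[X in _ --> X](mulr0 8); apply: cvgM; first exact: cvg_cst.
    exact: (sum_mass_sqr_cvg0 scs (lexx 0) M0).
  by apply/funext => n; rewrite mulr_sumr.
Qed.

End characteristic_function.

Lemma Rintegral_setI_indic {R : realType} d (T : measurableType d)
    (nu : {measure set T -> \bar R}) (D B : set T) (f : T -> R) :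
  \int[nu]_(x in D `&` B) f x = \int[nu]_(x in D) (\1_B x * f x).
Proof.
rewrite /Rintegral integral_mkcondr; congr fine; apply: eq_integral => x _.
by rewrite patchE indicE; case: (x \in B); rewrite ?mul1r ?mul0r.
Qed.

Lemma pr_near {R : realType} d (T : measurableType d) (P : probability T R) (A B S N : set T) :
  measurable A -> measurable B -> measurable S -> measurable N -> P N = 0%E ->
  (forall x, ~ N x -> ~ S x -> (A x <-> B x)) -> `|pr P A - pr P B| <= 4 * pr P S.
Proof.
move=> mA mB mS mN N0 AB; rewrite -[leLHS]normc_real rmorphB.
have := @normc_CintegralB_le _ _ _ P A B S N (fun=> 1) (fun=> 1) mA mB mS mN N0
  (cmeasurable_cst _ _) (cmeasurable_cst _ _).
rewrite !Cintegral_cst// !mul1r; apply => [x|x|x Nx Sx].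
- by rewrite normc_real normr1.
- by rewrite normc_real normr1.
- by split; [exact: AB|].
Qed.

(** * The density of R_1 *)

Section nearest_density.
Context {R : realType} d (T : measurableType d) (P : probability T R).
Variables (lambda : R -> R) (dist : nat -> {RV P >-> R}).
Hypotheses (scs : canonical_SCS lambda dist).
Hypothesis PI_fin : {ae P, forall x, (ext_interference dist x < +oo)%E}.
Notation mu := (@lebesgue_measure R).
Notation cev := (cev dist).
Notation pr := (pr P).
Notation several := (several dist).
Notation pdf := (nearest_pdf lambda).

Let dens : bs_density lambda. Proof. by case: scs. Qed.

Let mI (i : interval R) : measurable ([set` i] : set (measurableTypeR R)).
Proof. exact: measurable_itv. Qed.

Definition nearest_law : {measure set (measurableTypeR R) -> \bar R} :=
  measure_function_pushforward__canonical__measure_function_Measure P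
    (measurable_dist dist 0 : measurable_fun setT (dist 0 : T -> measurableTypeR R)).

(** Monotonicity is also what makes the cumulative mass, and so the density of R_1, measurable. *)
Lemma cumulative_mass_homo : {homo (fun r => mass lambda `[0, r]) : r s / r <= s}.
Proof.
move=> r s; rewrite le_eqVlt => /predU1P[->//|rs].
have ge0 t : 0 <= mass lambda `[0, t].
  by apply: (mass_ge0 dens) => u; rewrite /= !in_itv/= andbT => /andP[].
have [r0|r0] := ltP r 0.
  by rewrite {1}/mass set_itv_ge ?Rintegral_set0// bnd_simp -ltNge.
rewrite -(mass_itv_cc_split scs r0 rs) lerDl; apply: (mass_ge0 dens) => u.
by rewrite /= !in_itv/= andbT => /andP[/ltW/(le_trans r0)].
Qed.

Lemma pdf_gt0E (r : R) : 0 < r -> pdf r = lambda r * expR (- mass lambda `[0, r]).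
Proof. by move=> r0; rewrite /nearest_pdf ltW. Qed.

Lemma pdf_ge0 (r : R) : 0 <= pdf r.
Proof.
by rewrite /nearest_pdf; case: ifPn => // r0; rewrite mulr_ge0 ?expR_ge0// (dens.1 r r0).
Qed.

Lemma measurable_pdf : measurable_fun (`]0, +oo[%classic : set (measurableTypeR R)) pdf.
Proof.
apply: (eq_measurable_fun (fun r => lambda r * expR (- mass lambda `[0, r]))).
  by move=> r; rewrite inE/= in_itv/= andbT => r0; rewrite pdf_gt0E.
apply: measurable_funM; first exact: (measurable_density_oy scs (lexx 0)).
apply: measurableT_comp => //; apply: measurableT_comp => //.
by apply: nondecreasing_measurable => // r s; exact: cumulative_mass_homo.
Qed.

Lemma subset_oc0_oy (a b : R) : 0 <= a -> (`]a, b]%classic : set R) `<=` `]0, +oo[%classic.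
Proof.
by move=> a0 r; rewrite /= !in_itv/= andbT => /andP[+ _]; exact: le_lt_trans.
Qed.

Lemma integrable_indic_density (a b : R) (B : set (measurableTypeR R)) : 0 <= a -> measurable B ->
  mu.-integrable `]a, b] (EFin \o (fun r => \1_B r * lambda r)).
Proof.
move=> a0 mB; apply: (le_integrable (mI _) _ _ (integrable_density_oc scs b a0)).
  apply/measurable_EFinP; apply: measurable_funM.
    by apply: measurable_funTS; exact: measurable_indic.
  by have /integrableP[/measurable_EFinP] := integrable_density_oc scs b a0.
move=> r _; rewrite /= lee_fin normrM ler_piMl// ger0_norm// indicE lern1.
Qed.

Lemma integrable_indic_pdf (a b : R) (B : set (measurableTypeR R)) : 0 <= a -> measurable B ->
  mu.-integrable `]a, b] (EFin \o (fun r => \1_B r * pdf r)).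
Proof.
move=> a0 mB; apply: (le_integrable (mI _) _ _ (integrable_density_oc scs b a0)).
  apply/measurable_EFinP; apply: measurable_funM.
    by apply: measurable_funTS; exact: measurable_indic.
  by apply: (measurable_funS (mI _) _ measurable_pdf); exact: subset_oc0_oy.
move=> r /(subset_oc0_oy a0); rewrite /= in_itv/= andbT => r0.
rewrite lee_fin normrM (le_trans (_ : _ <= 1 * `|pdf r|))//.
  by rewrite ler_wpM2r// ger0_norm// indicE lern1 leq_b1.
rewrite mul1r pdf_gt0E// normrM ler_piMr// ger0_norm ?expR_ge0// -expR0 ler_expR oppr_le0.
by apply: (mass_ge0 dens) => u; rewrite /= !in_itv/= andbT => /andP[].
Qed.

(** Replacing exp(-Lambda(r)) by exp(-Lambda(b)), with Lambda the cumulative mass, costs at most the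
    mass of []a, b]], because exp is 1-Lipschitz on the negative half-line; integrating against
    [lambda] gives a second factor of the same mass. *)
Lemma pdf_cell_near (a b : R) (B : set (measurableTypeR R)) : 0 <= a -> a < b -> measurable B ->
  `|\int[mu]_(r in `]a, b]) (\1_B r * pdf r) - mass lambda (`]a, b] `&` B) * expR (- mass lambda `[0, b])|
    <= mass lambda `]a, b] ^+ 2.
Proof.
move=> a0 ab mB; have b0 := le_lt_trans a0 ab.
have id := integrable_indic_density b a0 mB.
have ip := integrable_indic_pdf b a0 mB.
have m0 : 0 <= mass lambda `]a, b].
  by apply: (mass_ge0 dens) => u /(subset_oc0_oy a0); rewrite /= !in_itv/= !andbT => /ltW.
have idc (c : R) : mu.-integrable `]a, b] (EFin \o (fun r => c * (\1_B r * lambda r))).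
  by apply: eq_integrable (integrableZl (mI _) _ id).
have il (c : R) : mu.-integrable `]a, b] (EFin \o (fun r => c * lambda r)).
  by apply: eq_integrable (integrableZl (mI _) _ (integrable_density_oc scs b a0)).
rewrite /mass Rintegral_setI_indic mulrC -RintegralZl// -RintegralB//.
have idif : mu.-integrable `]a, b] (EFin \o
    (fun r => \1_B r * pdf r - expR (- mass lambda `[0, b]) * (\1_B r * lambda r))).
  apply: (@eq_integrable _ _ _ mu _ (mI _) _ _ _ (integrableB (mI _) ip (idc (expR (- mass lambda `[0, b]))))).
  by move=> r _; rewrite /= EFinB.
apply: (le_trans (le_normr_Rintegral (mI _) idif)).
rewrite expr2 -[in leRHS]RintegralZl//; last exact: (integrable_density_oc scs b a0).
apply: le_Rintegral => //.
  exact: (integrable_norm idif).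
move=> r rab; have rab' := rab; have := subset_oc0_oy a0 rab.
rewrite /= in_itv/= andbT => r0; move: rab'; rewrite /= in_itv/= => /andP[ar rb].
have l0 : 0 <= lambda r by apply: dens.1; exact: ltW.
have Lr : mass lambda `[0, b] - mass lambda `[0, r] <= mass lambda `]a, b].
  rewrite -(mass_itv_cc_split scs a0 ab) addrAC gerDr subr_le0.
  by apply: cumulative_mass_homo; exact: ltW.
have L0 : 0 <= mass lambda `[0, r].
  by apply: (mass_ge0 dens) => u; rewrite /= !in_itv/= andbT => /andP[].
have Lrb : mass lambda `[0, r] <= mass lambda `[0, b] by apply: cumulative_mass_homo.
rewrite pdf_gt0E//.
set x := mass lambda `[0, r] in Lr L0 Lrb *; set y := mass lambda `[0, b] in Lr Lrb *.
have -> : \1_B r * (lambda r * expR (- x)) - expR (- y) * (\1_B r * lambda r) =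
    \1_B r * lambda r * (expR (- x) - expR (- y)).
  by rewrite mulrBr; congr (_ - _); [rewrite mulrA|rewrite mulrC].
rewrite normrM mulrC ler_pM ?normr_ge0//; last first.
  by rewrite normrM (ger0_norm l0) ler_piMl// ger0_norm// indicE lern1 leq_b1.
apply: le_trans Lr; rewrite ger0_norm ?subr_ge0 ?ler_expR ?lerN2//.
have -> : expR (- x) - expR (- y) = expR (- x) * (1 - expR (- (y - x))).
  by rewrite mulrBr mulr1 -expRD; congr (_ - expR _); ring.
rewrite -[leRHS]mul1r ler_pM ?expR_ge0//.
- by rewrite subr_ge0 -[leRHS]expR0 ler_expR oppr_le0 subr_ge0.
- by rewrite -[leRHS]expR0 ler_expR oppr_le0.
- by rewrite lerBlDr addrC -lerBlDr expR_ge1Dx.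
Qed.

(** Both terms are compared with the probability of [nearest_counts]: 4 from multiple points in the
    cell, 1 from [pdf_cell_near]. *)
Lemma law_cell_near (a b : R) (B : set (measurableTypeR R)) : 0 <= a -> a < b -> measurable B ->
  `|\int[nearest_law]_(r in `]a, b]) (\1_B r * 1) - \int[mu]_(r in `]a, b]) (\1_B r * pdf r)|
    <= 5 * mass lambda `]a, b] ^+ 2.
Proof.
move=> a0 ab mB; have b0 := le_lt_trans a0 ab.
have [N [mN N0 Nr]] := null_irregular scs PI_fin.
have mT := good_nearest_counts scs a0 ab mB.
have mIB : measurable (`]a, b] `&` B) by exact: measurableI.
have mA : measurable (dist 0 @^-1` (`]a, b] `&` B)).
  by rewrite -[_ @^-1` _]setTI; exact: measurable_dist.
have mS : measurable (several `]a, b]) by exact: (measurable_several dist (mI _)).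
have fm : finite_mean lambda `]a, b].
  by apply: (finite_mean_bounded dens (mI _) (ltW b0)); exact: subset_oc_cc.
have h1 : `|pr (dist 0 @^-1` (`]a, b] `&` B)) - pr (cev (nearest_counts a b B))| <=
    4 * pr (several `]a, b]).
  apply: (pr_near mA (measurable_cev dist mT) mS mN N0) => x /Nr rx sx.
  exact: nearest_countsP.
rewrite (pr_nearest_counts scs a0 ab mB) in h1.
have sv := pr_several_le scs fm.
have -> : \int[nearest_law]_(r in `]a, b]) (\1_B r * 1) = pr (dist 0 @^-1` (`]a, b] `&` B)).
  by rewrite -Rintegral_setI_indic Rintegral_cst// mul1r.
have h2 := pdf_cell_near a0 ab mB.
move: h1 h2; set u := pr _; set v := mass lambda _ * _; set p := Rintegral _ _ _ => h1 h2.
have -> : u - p = (u - v) - (p - v) by rewrite opprB addrA subrK.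
rewrite (le_trans (ler_normB _ _))// (le_trans (lerD h1 h2))//.
rewrite (_ : 5 = 4 + 1); last by rewrite natr1.
rewrite [leRHS]mulrDl [X in _ <= _ + X]mul1r.
by rewrite lerD2r ler_wpM2l.
Qed.

Lemma law_itv (M : R) (B : set (measurableTypeR R)) : 0 < M -> measurable B ->
  \int[nearest_law]_(r in `]0, M]) (\1_B r * 1) = \int[mu]_(r in `]0, M]) (\1_B r * pdf r).
Proof.
move=> M0 mB; apply/eqP; rewrite -subr_eq0 -normr_eq0; apply/eqP.
have gj n j : grid 0 M n.+1 j < grid 0 M n.+1 j.+1.
  by rewrite -subr_gt0 gridS subr0 divr_gt0// ltr0n.
have il : nearest_law.-integrable `]0, M] (EFin \o (fun r => \1_B r * 1)).
  apply: (Rintegral_bounded (M := 1)) => //.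
  - change (P (dist 0%N @^-1` `]0%R, M]) < +oo)%E; apply: probability_lty.
    by rewrite -[_ @^-1` _]setTI; exact: measurable_dist.
  - apply: measurable_funM; last exact: measurable_cst.
    by apply: measurable_funTS; exact: measurable_indic.
  - by move=> r _; rewrite mulr1 ger0_norm// indicE lern1 leq_b1.
have ip := integrable_indic_pdf M (lexx 0) mB.
have cut n : `|\int[nearest_law]_(r in `]0, M]) (\1_B r * 1) - \int[mu]_(r in `]0, M]) (\1_B r * pdf r)| <=
    5 * \sum_(0 <= j < n.+1) mass lambda (cell 0 M n.+1 j) ^+ 2.
  have := @Rintegral_cells _ nearest_law _ _ _ _ _ (ltW M0) (leqnn n.+1) il.
  have := Rintegral_cells (ltW M0) (leqnn n.+1) ip.
  rewrite !grid_end// => -> ->; rewrite -sumrB mulr_sumr.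
  apply: (le_trans (ler_norm_sum _ _ _)); rewrite !big_seq; apply: ler_sum => j _.
  by apply: law_cell_near => //; exact: (grid_ge _ _ (ltW M0)).
apply/eqP; rewrite eq_le normr_ge0 andbT.
have : (fun n => 5 * \sum_(0 <= j < n.+1) mass lambda (cell 0 M n.+1 j) ^+ 2) @ \oo --> (0 : R).
  rewrite -[X in _ --> X](mulr0 5); apply: cvgM; first exact: cvg_cst.
  exact: (sum_mass_sqr_cvg0 scs (lexx 0) M0).
by move=> /cvgr_to_ge; apply; exact: nearW.
Qed.

(** The law and the integral of the density agree on each []0, n.+1%:R]], and both increase to their
    values on []0, +oo[], outside which R_1 lies with probability 0. *)
Lemma nearest_has_density : has_density (dist 0) pdf.
Proof.
move=> B mB.
have [N [mN N0 Nr]] := null_irregular scs PI_fin.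
pose I n : set (measurableTypeR R) := `]0, n.+1%:R]%classic.
pose g r := (\1_B r * pdf r)%:E.
have mg : measurable_fun (`]0, +oo[%classic : set (measurableTypeR R)) g.
  apply/measurable_EFinP; apply: measurable_funM; last exact: measurable_pdf.
  by apply: measurable_funTS; exact: measurable_indic.
have g0 r : (0 <= g r)%E by rewrite lee_fin mulr_ge0 ?pdf_ge0.
have UI : \bigcup_n I n = `]0, +oo[%classic.
  by rewrite -(itv_oy_bigcup 0); apply: eq_bigcupr => n _; rewrite /I add0r.
have ndI : nondecreasing_seq I.
  by move=> m n mn; rewrite /I -[m.+1%:R]add0r -[n.+1%:R]add0r; exact: nondecreasing_itv_oc.
have eqn n : nearest_law (I n `&` B) = (\int[mu]_(r in I n) g r)%E.
  have n0 : 0 < n.+1%:R :> R by rewrite ltr0n.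
  have := law_itv n0 mB; rewrite -Rintegral_setI_indic Rintegral_cst//; last exact: (measurableI _ _ (mI _) mB).
  rewrite mul1r => h.
  have fl : (nearest_law (I n `&` B) < +oo)%E.
    change (P (dist 0%N @^-1` (I n `&` B)) < +oo)%E; apply: probability_lty.
    by rewrite -[_ @^-1` _]setTI; apply: measurable_dist => //; exact: (measurableI _ _ (mI _) mB).
  rewrite -[LHS]fineK; last by rewrite ge0_fin_numE.
  rewrite h fineK//; apply: (integrable_fin_num (mI _)).
  exact: (integrable_indic_pdf _ (lexx 0) mB).
have c1 : nearest_law (I n `&` B) @[n --> \oo] --> nearest_law (`]0, +oo[%classic `&` B).
  rewrite -UI setI_bigcupl; apply: nondecreasing_cvg_mu.
  - by move=> n; exact: (measurableI _ _ (mI _) mB).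
  - by rewrite -setI_bigcupl UI; exact: (measurableI _ _ (mI _) mB).
  - by move=> m n mn; apply/subsetPset; apply: setSI; apply/subsetPset; exact: ndI.
have c2 : (\int[mu]_(r in I n) g r)%E @[n --> \oo] --> (\int[mu]_(r in `]0%R, +oo[) g r)%E.
  rewrite -UI; apply: ge0_nondecreasing_set_cvg_integral => //.
  - by move=> n; exact: mI.
  - by move=> n; apply: (measurable_funS (mI _) _ mg); exact: subset_oc0_oy.
have -> : distribution P (dist 0) B = nearest_law (`]0, +oo[%classic `&` B).
  change (P (dist 0%N @^-1` B) = P (dist 0%N @^-1` (`]0%R, +oo[%classic `&` B)))%E.
  have mp (C : set (measurableTypeR R)) : measurable C -> measurable (dist 0 @^-1` C).
    by move=> mC; rewrite -[_ @^-1` _]setTI; exact: measurable_dist.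
  have m2 : measurable (dist 0 @^-1` (`]0, +oo[%classic `&` B)) by apply: mp; exact: (measurableI _ _ (mI _) mB).
  apply/eqP; rewrite eq_le; apply/andP; split; last first.
    by apply: le_measure; rewrite ?inE//; [exact: mp|exact: preimage_subset (@subIsetr _ _ _)].
  have -> : P (dist 0 @^-1` (`]0, +oo[%classic `&` B)) =
      (P (dist 0%N @^-1` (`]0%R, +oo[%classic `&` B)) + P N)%E by rewrite [P N]N0 adde0.
  apply: (le_trans _ (measureU2 P m2 mN)); apply: le_measure; rewrite ?inE//.
  - exact: mp.
  - exact: measurableU.
  - move=> x Bx; have [Nx|Nx] := pselect (N x); [by right|left; split => //].
    by rewrite /= in_itv/= andbT; apply: regular_gt0; exact: Nr.
(* The density vanishes on the negative reals and may be nonzero at 0, which is a Lebesgue-null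
   set. *)
have -> : (\int[mu]_(r in B) (pdf r)%:E = \int[mu]_(r in `]0%R, +oo[) g r)%E.
  rewrite integral_mkcond [RHS]integral_mkcond.
  refine (@eq_integral_off_null _ (measurableTypeR R) R mu [set 0%R]
    ((fun r => (pdf r)%:E) \_ B) (g \_ `]0, +oo[%classic) _ _ _).
  - exact: measurable_set1.
  - exact: lebesgue_measure_set1.
  move=> r r0; rewrite !patchE /g indicE.
  have [rp|rp] := ltP 0 r.
    by rewrite [r \in `]0, +oo[%classic]mem_set/= ?in_itv/= ?rp//; case: (r \in B); rewrite ?mul1r ?mul0r.
  rewrite [r \in `]0, +oo[%classic]memNset/= ?in_itv/= ?andbT; last by apply/negP; rewrite -leNgt.
  rewrite /nearest_pdf leNgt (_ : r < 0); first by case: (r \in B).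
  by rewrite lt_neqAle rp andbT; apply/eqP.
rewrite -(funext eqn) in c2; exact: (cvg_unique (@ereal_hausdorff R) c1 c2).
Qed.

End nearest_density.

(** * Disintegration along a conditional law *)

Lemma Rintegral_sumn {R : realType} d (T : measurableType d) (nu : {measure set T -> \bar R})
    (D : set T) (h : nat -> T -> R) m : measurable D ->
  (forall j, nu.-integrable D (EFin \o h j)) ->
  \int[nu]_(x in D) \sum_(0 <= j < m) h j x = \sum_(0 <= j < m) \int[nu]_(x in D) h j x /\
  nu.-integrable D (EFin \o (fun x => \sum_(0 <= j < m) h j x)).
Proof.
move=> mD hi; elim: m => [|m [IH1 IH2]].
  rewrite big_nil; under eq_fun do rewrite big_nil.
  by split; [rewrite /Rintegral integral0|exact: integrable0].
rewrite big_nat_recr//= -IH1; under eq_fun do rewrite big_nat_recr//=.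
split; first by rewrite -RintegralD.
by apply: eq_integrable (integrableD mD IH2 (hi m)).
Qed.

Section level_approximation.
Context {R : realType} d (T : measurableType d).
Variable f : T -> R.
Hypotheses (mf : measurable_fun setT f) (f1 : forall x, `|f x| <= 1).

(** Cells are open on the left, so a left end strictly below -1 is needed to cover the range [-1, 1]
    of [f]. The choice -2 makes the mesh 3 / n.+1. *)
Let level n j : set T := f @^-1` cell (-2) 1 n.+1 j.
Let weight n j : R := grid (-2) 1 n.+1 j.+1.

Lemma measurable_level n j : measurable (level n j).
Proof.
by rewrite /level -[_ @^-1` _]setTI; apply: mf => //; exact: measurable_cell.
Qed.

Definition level_sum n (x : T) : R := \sum_(0 <= j < n.+1) weight n j * \1_(level n j) x.

Let lt21 : -2 < 1 :> R. Proof. by rewrite (@lt_trans _ _ 0)// oppr_lt0. Qed.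

Lemma level_sum_near n x : `|f x - level_sum n x| <= 3 / n.+1%:R.
Proof.
have fx : `]-2, 1]%classic (f x).
  have := f1 x; rewrite ler_norml /= in_itv/= => /andP[h ->]; rewrite andbT.
  by apply: lt_le_trans h; rewrite ltrN2 ltr1n.
have [j jn cj] := cell_cover lt21 (ltn0Sn n) fx.
have -> : level_sum n x = weight n j.
  rewrite /level_sum (bigD1_seq j) ?iota_uniq ?mem_index_iota//=.
  rewrite indicE mem_set// mulr1 big_seq_cond big1 ?addr0// => k /andP[_ kj].
  rewrite indicE memNset ?mulr0// => ck.
  move: kj; rewrite neq_ltn => /orP[kj|jk].
    by have := cell_disjoint n.+1 (ltW lt21) kj => /seteqP[/(_ (f x))+ _]; apply.
  by have := cell_disjoint n.+1 (ltW lt21) jk => /seteqP[/(_ (f x))+ _]; apply.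
have -> : (3 : R) = 1 - -2 by ring.
rewrite -(gridS (-2) 1 n.+1 j) distrC.
move: cj; rewrite /cell/= in_itv/= => /andP[h1 h2].
by rewrite ger0_norm ?subr_ge0// lerD2l lerN2 ltW.
Qed.

Lemma measurable_level_sum n : measurable_fun setT (level_sum n).
Proof.
apply: measurable_sum => j; apply: measurable_funM => //.
by apply: measurable_indic; exact: measurable_level.
Qed.

Lemma Rintegral_level_sum (nu : {measure set T -> \bar R}) (D : set T) n : measurable D ->
  (nu D < +oo)%E ->
  \int[nu]_(x in D) level_sum n x =
  \sum_(0 <= j < n.+1) weight n j * fine (nu (level n j `&` D)).
Proof.
move=> mD Dfin; rewrite /level_sum.
have ii j : nu.-integrable D (EFin \o (fun x => weight n j * \1_(level n j) x)).
  apply: (@Rintegral_bounded _ _ _ _ _ _ `|weight n j|) => //.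
    apply: measurable_funTS; apply: measurable_funM => //.
    by apply: measurable_indic; exact: measurable_level.
  by move=> x _; rewrite normrM ler_piMr// ger0_norm// indicE lern1 leq_b1.
have i1 j : nu.-integrable D (EFin \o \1_(level n j)).
  apply: (@Rintegral_bounded _ _ _ _ _ _ 1) => //.
    by apply: measurable_funTS; apply: measurable_indic; exact: measurable_level.
  by move=> x _; rewrite ger0_norm// indicE lern1 leq_b1.
rewrite (Rintegral_sumn _ mD ii).1; apply: eq_bigr => j _.
rewrite RintegralZl//; congr (_ * _).
by rewrite /Rintegral integral_indic//; exact: measurable_level.
Qed.

Lemma Rintegral_level_sum_near (nu : {measure set T -> \bar R}) (D : set T) n : measurable D ->
  (nu D <= 1)%E ->
  `|\int[nu]_(x in D) f x - \int[nu]_(x in D) level_sum n x| <= 3 / n.+1%:R.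
Proof.
move=> mD D1; have Dfin : (nu D < +oo)%E by rewrite (le_lt_trans D1)// ltry.
have i1 : nu.-integrable D (EFin \o f).
  by apply: (Rintegral_bounded (M := 1)) => //; exact: measurable_funTS.
have i2 : nu.-integrable D (EFin \o level_sum n).
  apply: (Rintegral_bounded (M := 1 + 3 / n.+1%:R)) => //.
    by apply: measurable_funTS; exact: measurable_level_sum.
  move=> x _; rewrite -[level_sum n x](subrK (f x)) addrC (le_trans (ler_normD _ _))//.
  by rewrite lerD// distrC level_sum_near.
rewrite -RintegralB//; apply: (le_trans (ler_norm_Rintegral_bounded (M := 3 / n.+1%:R) _ _ _ _)) => //.
- by apply: measurable_funTS; apply: measurable_funB => //; exact: measurable_level_sum.
- by move=> x _; exact: level_sum_near.
- rewrite ler_piMr ?divr_ge0//.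
  have n0 : (0 <= nu D)%E by [].
  by move: (nu D) D1 n0 Dfin => [r| |]//=; rewrite lee_fin.
Qed.

End level_approximation.

Section disintegration.
Context {R : realType} d (T : measurableType d) (P : probability T R).
Variables (X Y : T -> R) (k : R.-pker (measurableTypeR R) ~> (measurableTypeR R)).
Hypotheses (mX : measurable_fun setT X) (mY : measurable_fun setT Y).
Hypothesis kXY : conditional_law P X Y k.
Variable f : measurableTypeR R -> R.
Hypotheses (mf : measurable_fun setT f) (f1 : forall x, `|f x| <= 1).

Let ker_setT (y : R) : (k y setT <= 1)%E. Proof. by rewrite prob_kernel. Qed.

Let ker_lty y (A : set (measurableTypeR R)) : measurable A -> (k y A < +oo)%E.
Proof.
move=> mA; rewrite (@le_lt_trans _ _ 1%E) ?ltry// (le_trans _ (ker_setT y))//.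
by apply: le_measure; rewrite ?inE.
Qed.

Let levels n j : set (measurableTypeR R) := f @^-1` cell (-2) 1 n.+1 j.

Let ker_level_le1 n j y : fine (k y (levels n j)) <= 1.
Proof.
have mL : measurable (levels n j) by exact: measurable_level.
rewrite -lee_fin fineK ?ge0_fin_numE ?ker_lty//.
by rewrite (le_trans _ (ker_setT y))//; apply: le_measure; rewrite ?inE.
Qed.

Let ker_level_sum n y : \int[k y]_p level_sum f n p =
  \sum_(0 <= j < n.+1) grid (-2) 1 n.+1 j.+1 * fine (k y (levels n j)).
Proof.
rewrite Rintegral_level_sum// ?ker_lty//.
by apply: eq_bigr => j _; rewrite setIT.
Qed.

Let measurable_ker_level n j : measurable_fun setT (fun x => fine (k (Y x) (levels n j))).
Proof.
apply: measurableT_comp => //.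
apply: (measurableT_comp (f := fun y => k y (levels n j))) => //.
by apply: measurable_kernel; exact: measurable_level.
Qed.

Let measurable_ker_level_sum n : measurable_fun setT (fun x => \int[k (Y x)]_p level_sum f n p).
Proof.
under eq_fun do rewrite ker_level_sum.
apply: measurable_sum => j; apply: measurable_funM => //.
Qed.

Let inv_succ_cvg0 : 3 / n.+1%:R @[n --> \oo] --> (0 : R).
Proof.
rewrite -[X in _ --> X](mulr0 3); apply: cvgM; first exact: cvg_cst.
exact: cvg_harmonic.
Qed.

(** Limit of the integrals of the level sums, which are finite combinations of measurable functions
    of [Y]. *)
Lemma measurable_Rintegral_kernel : measurable_fun setT (fun x => \int[k (Y x)]_p f p).
Proof.
apply: (measurable_fun_cvg measurable_ker_level_sum) => x _.
have nb n := Rintegral_level_sum_near mf f1 n measurableT (ker_setT (Y x)).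
apply/cvgrPdist_le => e e0; have /cvgrPdist_le/(_ e e0) := inv_succ_cvg0.
apply: filterS => n; rewrite sub0r normrN ger0_norm ?divr_ge0//.
exact: le_trans (nb n).
Qed.

(** The conditional law is characterized on sets only. For level sums the identity is the one on
    sets, and [f] is within 3 / n.+1 of its level sum on both sides, hence the error 6 / n.+1. *)
Lemma disintegration (C : set (measurableTypeR R)) : measurable C ->
  \int[P]_(x in Y @^-1` C) f (X x) = \int[P]_(x in Y @^-1` C) \int[k (Y x)]_p f p.
Proof.
move=> mC; have mD : measurable (Y @^-1` C) by rewrite -[_ @^-1` _]setTI; exact: mY.
have Dfin := probability_lty P mD.
have D1 := probability_le1 P mD.
have mfX : measurable_fun setT (f \o X) by exact: (measurableT_comp mf mX).
have fX1 x : `|(f \o X) x| <= 1 by exact: f1.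
have ker1 x : `|\int[k (Y x)]_p f p| <= 1.
  apply: (le_trans (ler_norm_Rintegral_bounded (M := 1) _ _ _ _)) => //.
    by rewrite ker_lty.
  by rewrite mul1r prob_kernel.
have ikf : P.-integrable (Y @^-1` C) (EFin \o (fun x => \int[k (Y x)]_p f p)).
  apply: (Rintegral_bounded (M := 1)) => //.
  by apply: measurable_funTS; exact: measurable_Rintegral_kernel.
have ikl n j : P.-integrable (Y @^-1` C) (EFin \o (fun x =>
    grid (-2) 1 n.+1 j.+1 * fine (k (Y x) (levels n j)))).
  apply: (Rintegral_bounded (M := `|grid (-2) 1 n.+1 j.+1|)) => //.
    by apply: measurable_funTS; exact: measurable_funM.
  move=> x _; rewrite normrM ler_piMr//.
  by rewrite ger0_norm ?fine_ge0//; exact: ker_level_le1.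
have ikl1 n j : P.-integrable (Y @^-1` C) (EFin \o (fun x => fine (k (Y x) (levels n j)))).
  apply: (Rintegral_bounded (M := 1)) => //.
    by apply: measurable_funTS.
  by move=> x _; rewrite ger0_norm ?fine_ge0//; exact: ker_level_le1.
have same n : \int[P]_(x in Y @^-1` C) level_sum (f \o X) n x =
    \int[P]_(x in Y @^-1` C) \int[k (Y x)]_p level_sum f n p.
  rewrite Rintegral_level_sum//.
  under [RHS]eq_Rintegral do rewrite ker_level_sum.
  rewrite (Rintegral_sumn _ mD (ikl n)).1; apply: eq_bigr => j _.
  rewrite RintegralZl//; congr (_ * _).
  rewrite /Rintegral; congr fine; rewrite [LHS](kXY (measurable_level mf n j) mC).
  apply: eq_integral => x _; rewrite fineK// ge0_fin_numE// ker_lty//.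
  exact: measurable_level.
have near n : `|\int[P]_(x in Y @^-1` C) f (X x) -
    \int[P]_(x in Y @^-1` C) \int[k (Y x)]_p f p| <= 6 * n.+1%:R^-1.
  have h1 := Rintegral_level_sum_near mfX fX1 n mD D1.
  have inl : P.-integrable (Y @^-1` C) (EFin \o (fun x => \int[k (Y x)]_p level_sum f n p)).
    apply: eq_integrable (Rintegral_sumn n.+1 mD (ikl n)).2 => //.
    by move=> x _; rewrite /= ker_level_sum.
  have h2 : `|\int[P]_(x in Y @^-1` C) \int[k (Y x)]_p f p -
      \int[P]_(x in Y @^-1` C) \int[k (Y x)]_p level_sum f n p| <= 3 / n.+1%:R.
    rewrite -RintegralB//.
    apply: (le_trans (ler_norm_Rintegral_bounded (M := 3 / n.+1%:R) _ _ _ _)) => //.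
    - apply: measurable_funTS; apply: measurable_funB; first exact: measurable_Rintegral_kernel.
      exact: measurable_ker_level_sum.
    - by move=> x _; exact: (Rintegral_level_sum_near mf f1 n measurableT (ker_setT (Y x))).
    - rewrite ler_piMr ?divr_ge0// -lee_fin fineK// ge0_fin_numE//.
  rewrite -(same n) in h2.
  move: h1 h2; set a := \int[P]_(x in _) (f \o X) x; set b := Rintegral _ _ _.
  set c := Rintegral _ _ (fun x => \int[k (Y x)]_p f p) => h1 h2.
  have -> : 6 * n.+1%:R^-1 = 3 / n.+1%:R + 3 / n.+1%:R :> R by rewrite -mulrDl -natrD.
  by rewrite (le_trans (ler_distD b _ _))// lerD// distrC.
apply/eqP; rewrite -subr_eq0 -normr_eq0; apply/eqP/eqP.
rewrite eq_le normr_ge0 andbT.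
have : (fun n => 6 * n.+1%:R^-1) @ \oo --> (0 : R).
  rewrite -[X in _ --> X](mulr0 6); apply: cvgM; first exact: cvg_cst.
  exact: cvg_harmonic.
by move=> /cvgr_to_ge; apply; exact: nearW.
Qed.

End disintegration.

(** * Characteristic functions of the conditional law *)

Section conditional_characteristic_function.
Context {R : realType} d (T : measurableType d) (P : probability T R).
Variables (X Y : T -> R) (k : R.-pker (measurableTypeR R) ~> (measurableTypeR R)).
Hypotheses (mX : measurable_fun setT X) (mY : measurable_fun setT Y).
Hypothesis kXY : conditional_law P X Y k.
Import Normc.

Let wave (c : R) (p : measurableTypeR R) : R[i] := cexp ('i%C * c%:C * p%:C).

Let normc_wave_le1 c p : normc (wave c p) <= 1.
Proof. by apply: normc_cexp_le1; rewrite Re_scaled mul_i_real mul0r. Qed.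

Let cmeasurable_wave c : cmeasurable setT (wave c).
Proof.
apply: cmeasurable_cexp; apply: cmeasurableM; first exact: cmeasurable_cst.
by apply: cmeasurable_real.
Qed.

Let Re_wave_le1 c p : `|complex.Re (wave c p)| <= 1.
Proof. exact: le_trans (ler_norm_Re _) (normc_wave_le1 _ _). Qed.

Let Im_wave_le1 c p : `|complex.Im (wave c p)| <= 1.
Proof. exact: le_trans (ler_norm_Im _) (normc_wave_le1 _ _). Qed.

Let ker_lty y : (k y setT < +oo)%E. Proof. by rewrite prob_kernel ltry. Qed.

Lemma normc_cond_charfun_le2 c y : normc (cond_charfun k c y) <= 2.
Proof.
rewrite /cond_charfun (le_trans (normc_Cintegral_le (M := 1) _ _ (cmeasurable_wave c) _))//.
by rewrite mulr1 prob_kernel mulr1.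
Qed.

Lemma cmeasurable_cond_charfun c : cmeasurable setT (fun x => cond_charfun k c (Y x)).
Proof.
have [m1 m2] := cmeasurable_wave c.
split.
  exact: (measurable_Rintegral_kernel k mY m1 (Re_wave_le1 c)).
exact: (measurable_Rintegral_kernel k mY m2 (Im_wave_le1 c)).
Qed.

Lemma Cdisintegration c (C : set (measurableTypeR R)) : measurable C ->
  Cintegral P (Y @^-1` C) (fun x => cexp ('i%C * c%:C * (X x)%:C)) =
  Cintegral P (Y @^-1` C) (fun x => cond_charfun k c (Y x)).
Proof.
move=> mC; have [m1 m2] := cmeasurable_wave c.
apply: complex_ext.
  exact: (disintegration mX mY kXY m1 (Re_wave_le1 c) mC).
exact: (disintegration mX mY kXY m2 (Im_wave_le1 c) mC).
Qed.

Lemma ccvg_cond_charfun (u : nat -> R) (c y : R) : u n @[n --> \oo] --> c ->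
  ccvg (fun n => cond_charfun k (u n) y) (cond_charfun k c y).
Proof.
move=> uc; apply: (Cdominated_cvg (g := cst 1)).
- exact: measurableT.
- by move=> n; exact: cmeasurable_wave.
- exact: cmeasurable_wave.
- apply: aeW => p _; apply: ccvg_cexp; apply: ccvgM; last exact: ccvg_cst.
  by apply: ccvgM; [exact: ccvg_cst|exact: ccvg_real].
- by apply: (Rintegral_bounded (M := 1)) => // x _; rewrite normr1.
- by move=> n p _; exact: normc_wave_le1.
Qed.

End conditional_characteristic_function.

Section conditional_charfun_invSINR.
Context {R : realType} d (T : measurableType d) (P : probability T R).
Variables (lambda : R -> R) (dist : nat -> {RV P >-> R}).
Hypotheses (scs : canonical_SCS lambda dist).
Hypothesis PI_fin : {ae P, forall x, (ext_interference dist x < +oo)%E}.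
Variables (eta w : R) (k : R.-pker (measurableTypeR R) ~> (measurableTypeR R)).
Hypothesis kP : conditional_law P (interference dist) (dist 0) k.
Import Normc.

Let mY := measurable_dist dist 0.
Let mX := measurable_interference dist.

(** Only the factor R_1 in the argument of the characteristic function is frozen at [t]; the
    conditioning value stays [dist 0 x], because the kernel is merely measurable in that
    variable. *)
Let h (t : R) (x : T) : R[i] :=
  cexp ('i%C * (w * t * eta)%:C) * cond_charfun k (w * t) (dist 0 x).

Let admissible_h : admissible (dist 0) h.
Proof.
split.
- move=> t _; apply: cmeasurableM; first exact: cmeasurable_cst.
  exact: cmeasurable_cond_charfun.
- move=> t x _; rewrite normcM -[leRHS]mul1r ler_pM ?normc_ge0//.
    by apply: normc_cexp_le1; exact: Re_imaginary_le0.
  exact: normc_cond_charfun_le2.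
- move=> x u M x0 ux cu.
  have cw : w * u n @[n --> \oo] --> w * dist 0 x by apply: cvgM => //; exact: cvg_cst.
  apply: ccvgM; last exact: ccvg_cond_charfun.
  apply: ccvg_cexp; apply: ccvgM; first exact: ccvg_cst.
  by apply: ccvg_real; apply: cvgM => //; exact: cvg_cst.
Qed.

(** With the factor frozen at [t], the two sides agree exactly on every cell by disintegration; the
    rounding is needed only because [w] is multiplied by the random R_1. *)
Lemma charfun_invSINR_cond : charfun P (fun x => (SINR eta dist x)^-1) w =
  Cexpectation P (fun x => cexp ('i%C * w%:C * eta%:C * (dist 0 x)%:C) *
    cond_charfun k (w * dist 0 x) (dist 0 x)).
Proof.
have [N [mN N0 Nr]] := null_irregular scs PI_fin.
transitivity (Cintegral P setT (fun x => char_at dist eta w (dist 0 x) x)).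
  apply: eq_Cintegral => x _; rewrite /char_at invSINR -['i%C * _ * _]mulrA -rmorphM.
  by rewrite mulrA.
transitivity (Cintegral P setT (fun x => h (dist 0 x) x)); last first.
  apply: eq_Cintegral => x _; rewrite /h -!['i%C * _ * _]mulrA -mulrA -!rmorphM.
  by rewrite -mulrA [eta * _]mulrC.
apply: (@Cintegral_discretizeT _ _ _ P (dist 0) mY N (fun _ _ _ => 0)
    (char_at dist eta w) h) => //.
- by move=> x /Nr; exact: regular_gt0.
- exact: admissible_char_at.
- move=> M n j M0 jn; set t := grid 0 M n.+1 j.+1; set D := dist 0 @^-1` _.
  have mD : measurable D by rewrite /D -[_ @^-1` _]setTI; apply: mY => //; exact: measurable_cell.
  have -> : char_at dist eta w t = fun x => cexp ('i%C * (w * t * eta)%:C) *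
      cexp ('i%C * (w * t)%:C * (interference dist x)%:C).
    apply/funext => x; rewrite /char_at -cexpD -['i%C * (w * t)%:C * _]mulrA -mulrDr -rmorphM -rmorphD.
    by rewrite mulrDr addrC.
  rewrite /h CintegralZl//; last first.
    apply: (@Cintegrable_bounded _ _ _ _ _ _ 1) => //.
    + exact: probability_lty.
    + apply: (cmeasurableS measurableT) => //; apply: cmeasurable_cexp.
      by apply: cmeasurableM; [exact: cmeasurable_cst|exact: cmeasurable_real].
    + by move=> x _; apply: normc_cexp_le1; rewrite Re_scaled mul_i_real mul0r.
  rewrite CintegralZl//; last first.
    apply: (@Cintegrable_bounded _ _ _ _ _ _ 2) => //.
    + exact: probability_lty.
    + by apply: (cmeasurableS measurableT) => //; exact: cmeasurable_cond_charfun.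
    + by move=> x _; exact: normc_cond_charfun_le2.
  rewrite (Cdisintegration mX mY kP (w * t) (measurable_cell _ _ _ _)) subrr.
  by rewrite normc_real normr0.
- move=> M M0; rewrite (_ : (fun n => _) = fun=> 0); first exact: cvg_cst.
  by apply/funext => n; rewrite big1.
Qed.

End conditional_charfun_invSINR.

(** * Absence of atoms *)

Section sign_independence.
Context {R : realType} d (T : measurableType d) (P : probability T R).
Variable Y : T -> R.
Hypothesis mY : measurable_fun setT Y.
Notation mu := (@lebesgue_measure R).
Import Normc.

Let wave w x : R[i] := cexp ('i%C * w%:C * (Y x)%:C).

Let sin_diff_wave w a b x :
  sin (w * (Y x - a)) - sin (w * (Y x - b)) =
  complex.Im ((cexp ('i%C * (- (w * a))%:C) - cexp ('i%C * (- (w * b))%:C)) * wave w x).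
Proof.
have e c : cexp ('i%C * (- (w * c))%:C) * wave w x = cexp ('i%C * (w * (Y x - c))%:C).
  rewrite /wave -cexpD -['i%C * w%:C * _]mulrA -mulrDr -rmorphM -rmorphD.
  by congr (cexp (_ * _%:C)); rewrite addrC mulrBr.
by rewrite mulrBl !e cImB !Im_cexp_i.
Qed.

(* The inversion formula turns a factorization of characteristic functions into
   one of the probabilities of intervals. *)
Lemma sign_independence (D : set T) (q a b : R) : measurable D ->
  (forall w, Cintegral P D (wave w) = q%:C * Cintegral P setT (wave w)) ->
  \int[P]_(x in D) (Num.sg (Y x - a) - Num.sg (Y x - b)) =
  q * \int[P]_x (Num.sg (Y x - a) - Num.sg (Y x - b)).
Proof.
move=> mD qP.
have u_cvg : (n%:R : R) @[n --> \oo] --> +oo by exact: cvgr_idn.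
have l1 := @levy_inversion _ _ _ P Y D a b _ mY mD u_cvg.
have l2 := @levy_inversion _ _ _ P Y setT a b _ mY measurableT u_cvg.
have mw w E : measurable E -> cmeasurable E (wave w).
  move=> mE; apply: (cmeasurableS measurableT) => //; apply: cmeasurable_cexp.
  by apply: cmeasurableM; [exact: cmeasurable_cst|exact: cmeasurable_real].
have iw w E : measurable E -> Cintegrable P E (wave w).
  move=> mE; apply: (@Cintegrable_bounded _ _ _ _ _ _ 1) => //.
  - exact: probability_lty.
  - exact: mw.
  - by move=> x _; apply: normc_cexp_le1; rewrite Re_scaled mul_i_real mul0r.
have key w E : measurable E ->
    \int[P]_(x in E) ((sin (w * (Y x - a)) - sin (w * (Y x - b))) / w) =
    w^-1 * complex.Im ((cexp ('i%C * (- (w * a))%:C) - cexp ('i%C * (- (w * b))%:C)) *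
      Cintegral P E (wave w)).
  move=> mE; rewrite -CintegralZl//; last exact: iw.
  have [_ ii] := CintegrableZl (cexp ('i%C * (- (w * a))%:C) - cexp ('i%C * (- (w * b))%:C)) mE (iw w E mE).
  rewrite [complex.Im _]/= -RintegralZl//; apply: eq_Rintegral => x _.
  by rewrite sin_diff_wave mulrC.
have Im_realM (c z : R[i]) : complex.Im (c * (q%:C * z)) = q * complex.Im (c * z).
  by rewrite mulrCA [LHS]cImM [X in _ + X](_ : _ = 0) ?addr0//; exact: mul0r.
have eqw w : \int[P]_(x in D) ((sin (w * (Y x - a)) - sin (w * (Y x - b))) / w) =
    q * \int[P]_x ((sin (w * (Y x - a)) - sin (w * (Y x - b))) / w).
  by rewrite !key// qP Im_realM mulrCA.
have mI n : measurable (`[0, n%:R]%classic : set (measurableTypeR R)) by exact: measurable_itv.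
have ii n : mu.-integrable `[0, n%:R] (EFin \o (fun w =>
    \int[P]_x ((sin (w * (Y x - a)) - sin (w * (Y x - b))) / w))).
  apply: (Rintegral_bounded (M := `|b - a|)) => //.
  - exact: lebesgue_measure_itvcc_lty.
  - apply: measurable_funTS.
    exact: (@measurable_fun_Rintegral _ _ (measurableTypeR R) T R P _ _ measurableT
      (measurable_sin_diff a b mY)).
  - move=> w _; rewrite -[leRHS]mulr1 -[X in _ <= _ * X]/(fine 1%E) -(@probability_setT _ _ _ P).
    apply: ler_norm_Rintegral_bounded => //.
    + exact: probability_lty.
    + have ms c : measurable_fun setT (fun x => sin (w * (Y x - c))).
        apply: measurableT_comp; first exact: measurable_fun_sin.
        by apply: measurable_funM => //; exact: measurable_funB.
      by apply: measurable_funM => //; exact: measurable_funB.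
    + by move=> x _; exact: ler_norm_sin_diff.
have l3 : \int[mu]_(w in `[0, n%:R])
     \int[P]_(x in D) ((sin (w * (Y x - a)) - sin (w * (Y x - b))) / w)
    @[n --> \oo] --> q * (pi / 2 * \int[P]_x (Num.sg (Y x - a) - Num.sg (Y x - b))).
  rewrite (_ : (fun n => _) = (fun n => q * \int[mu]_(w in `[0, n%:R])
     \int[P]_x ((sin (w * (Y x - a)) - sin (w * (Y x - b))) / w))).
    by apply: cvgM => //; exact: cvg_cst.
  by apply/funext => n; rewrite -RintegralZl//; apply: eq_Rintegral => w _.
(* The same sequence has both limits; cancelling pi / 2 leaves the identity between the sign
   integrals. *)
have pi2 : pi / 2 != 0 :> R by rewrite gt_eqF// divr_gt0// pi_gt0.
apply: (mulfI pi2); rewrite mulrCA; exact: (cvg_unique (@Rhausdorff R) l1 l3).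
Qed.

End sign_independence.

Section no_atoms.
Context {R : realType} d (T : measurableType d) (P : probability T R).
Variables (lambda : R -> R) (dist : nat -> {RV P >-> R}).
Hypotheses (scs : canonical_SCS lambda dist).
Hypothesis PI_fin : {ae P, forall x, (ext_interference dist x < +oo)%E}.
Variable eta : R.
Notation good := (good lambda).
Notation cev := (cev dist).
Notation point_sum := (point_sum dist).
Notation pr := (pr P).

Let dens : bs_density lambda. Proof. by case: scs. Qed.
Let pp : poisson_process lambda dist. Proof. by case: scs. Qed.

Let mI (i : interval R) : measurable ([set` i] : set (measurableTypeR R)).
Proof. exact: measurable_itv. Qed.

Definition sole_counts (a t b : R) : seq (set R * nat) :=
  [:: (`[0, a]%classic, 0%N); (`]a, t]%classic, 1%N); (`]t, b]%classic, 0%N)].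

Lemma good_sole_counts (a t b : R) : 0 <= a -> a < t -> t <= b ->
  good (map fst (sole_counts a t b)).
Proof.
move=> a0 at_ tb; have t0 : 0 <= t := le_trans a0 (ltW at_); have b0 := le_trans t0 tb.
split=> /=.
- case=> [|[|[|//]]] _ /=.
  + exact: (finite_mean_bounded dens (mI _) a0).
  + by apply: (finite_mean_bounded dens (mI _) t0); exact: subset_oc_cc.
  + by apply: (finite_mean_bounded dens (mI _) b0); exact: subset_oc_cc.
- have dis c (C D : set R) : (forall r, C r -> r <= c) -> (forall r, D r -> c < r) ->
      C `&` D = set0.
    by move=> hC hD; apply/seteqP; split => // r [/hC rc /hD]; rewrite ltNge rc.
  case=> [|[|[|i]]] [|[|[|j]]] //=; rewrite ?andbF//= => _.
  + by apply: (dis a) => r; rewrite /= in_itv/= => /andP[].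
  + apply: (dis t) => r; rewrite /= in_itv/= => /andP[]// _ ra.
    exact: le_trans ra (ltW at_).
  + by apply: (dis t) => r; rewrite /= in_itv/= => /andP[].
Qed.

Lemma sole_counts_sub (a t b : R) : 0 <= a -> a < t -> t <= b ->
  forall C, C \in map fst (sole_counts a t b) -> C `<=` `[0, b].
Proof.
move=> a0 at_ tb C; rewrite !inE => /or3P[]/eqP -> r; rewrite /= !in_itv/= => /andP[h1 h2].
- by rewrite h1 (le_trans h2)// (le_trans (ltW at_)).
- by rewrite (le_trans a0 (ltW h1)) (le_trans h2).
- by rewrite h2 (le_trans (le_trans a0 (ltW at_)) (ltW h1)).
Qed.

Lemma pr_sole_counts_le (a t b : R) : 0 <= a -> a < t -> t <= b ->
  pr (cev (sole_counts a t b)) <= mass lambda `]a, t].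
Proof.
move=> a0 at_ tb; have t0 : 0 <= t := le_trans a0 (ltW at_).
have ge0 (C : set R) : C `<=` `[0, +oo[ -> 0 <= mass lambda C by exact: mass_ge0.
have e1 c : 0 <= c -> expR (- c) <= 1 by move=> c0; rewrite -expR0 ler_expR oppr_le0.
have g1 : 0 <= mass lambda `[0, a] by apply: ge0 => r; rewrite /= !in_itv/= andbT => /andP[].
have g2 : 0 <= mass lambda `]a, t].
  by apply: ge0 => r; rewrite /= !in_itv/= andbT => /andP[/ltW/(le_trans a0)].
have g3 : 0 <= mass lambda `]t, b].
  by apply: ge0 => r; rewrite /= !in_itv/= andbT => /andP[/ltW/(le_trans t0)].
have -> : pr (cev (sole_counts a t b)) = expR (- mass lambda `[0, a]) *
    (mass lambda `]a, t] * expR (- mass lambda `]a, t]) * expR (- mass lambda `]t, b])).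
  rewrite /pr (prob_cev pp (good_sole_counts a0 at_ tb)) [LHS]/fine.
  rewrite 3!big_cons big_nil.
  rewrite poisson_weight0 poisson_weight1 poisson_weight0.
  by rewrite [X in _ * (_ * X)]mulr1.
have h1 : mass lambda `]a, t] * expR (- mass lambda `]a, t]) * expR (- mass lambda `]t, b]) <=
    mass lambda `]a, t] * expR (- mass lambda `]a, t]).
  by apply: ler_piMr; [exact: mulr_ge0 g2 (expR_ge0 _)|exact: e1].
have h2 : mass lambda `]a, t] * expR (- mass lambda `]a, t]) <= mass lambda `]a, t].
  by apply: ler_piMr; [exact: g2|exact: e1].
apply: (le_trans _ (le_trans h1 h2)); apply: ler_piMl; last exact: e1.
by apply: mulr_ge0; [exact: mulr_ge0 g2 (expR_ge0 _)|exact: expR_ge0].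
Qed.

(** Independence of a count event inside [0, b] from the sum S beyond [b], for intervals of values
    of S. The hypothesis on characteristic functions is Campbell's formula for this event and for
    the empty list of counts. *)
Lemma sign_sole_counts (a t b u v : R) : 0 <= a -> a < t -> t <= b ->
  \int[P]_(x in cev (sole_counts a t b))
    (Num.sg (point_sum `]b, +oo[ x - u) - Num.sg (point_sum `]b, +oo[ x - v)) =
  pr (cev (sole_counts a t b)) *
  \int[P]_x (Num.sg (point_sum `]b, +oo[ x - u) - Num.sg (point_sum `]b, +oo[ x - v)).
Proof.
move=> a0 at_ tb; have b0 : 0 < b := le_lt_trans a0 (lt_le_trans at_ tb).
have gs := good_sole_counts a0 at_ tb.
apply: sign_independence.
- by apply: measurable_point_sum => //; exact: subset_oy_cy (ltW b0).
- exact: measurable_cev gs.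
move=> w; rewrite (point_sum_char_oy scs PI_fin b0 (Re_imaginary_le0 w) gs (sole_counts_sub a0 at_ tb)).
have gnil : good (map fst ([::] : seq (set R * nat))) by split => [i|i j] //=; rewrite ltn0 andbF.
have := point_sum_char_oy scs PI_fin b0 (Re_imaginary_le0 w) gnil.
rewrite cev_nil pr_setT mul1r => -> //.
Qed.

End no_atoms.

Lemma sg_homo {R : realType} : {homo (@Num.sg R) : x y / x <= y}.
Proof.
move=> x y xy; have [x0|x0|x0] := ltgtP x 0.
- rewrite (ltr0_sg x0); have [y0|y0|->] := ltgtP y 0.
  + by rewrite ltr0_sg.
  + by rewrite gtr0_sg// (le_trans lerN10).
  + by rewrite sgr0 lerN10.
- by rewrite !gtr0_sg// (lt_le_trans x0).
- by rewrite x0 sgr0 sgr_ge0 -x0.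
Qed.

Lemma pr_le_Rintegral {R : realType} d (T : measurableType d) (P : probability T R)
    (D N : set T) (g : T -> R) : measurable D -> measurable N -> P N = 0%E ->
  P.-integrable setT (EFin \o g) -> (forall x, 0 <= g x) ->
  (forall x, ~ N x -> D x -> 1 <= g x) -> pr P D <= \int[P]_x g x.
Proof.
move=> mD mN N0 ig g0 h; have mDN : measurable (D `\` N) by exact: measurableD.
have -> : pr P D = pr P (D `\` N).
  rewrite /pr; congr fine; apply/eqP; rewrite eq_le; apply/andP; split; last first.
    by apply: le_measure; rewrite ?inE//; exact: subDsetl.
  have -> : P (D `\` N) = (P (D `\` N) + P N)%E by rewrite [P N]N0 adde0.
  apply: (le_trans _ (measureU2 P mDN mN)); apply: le_measure; rewrite ?inE//.
    exact: measurableU.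
  by move=> x Dx; have [Nx|Nx] := pselect (N x); [right|left].
have -> : pr P (D `\` N) = \int[P]_x \1_(D `\` N) x.
  by rewrite /Rintegral integral_indic// setIT.
apply: le_Rintegral => //.
  apply: (Rintegral_bounded (M := 1)) => //; first exact: probability_lty.
  by move=> x _; rewrite ger0_norm// indicE lern1 leq_b1.
move=> x _; rewrite indicE; have [[Dx Nx]|DN] := pselect ((D `\` N) x).
  by rewrite mem_set//; exact: h.
by rewrite memNset.
Qed.

Section atomless.
Context {R : realType} d (T : measurableType d) (P : probability T R).
Variables (lambda : R -> R) (dist : nat -> {RV P >-> R}).
Hypotheses (scs : canonical_SCS lambda dist).
Hypothesis PI_fin : {ae P, forall x, (ext_interference dist x < +oo)%E}.
Variable eta : R.
Notation cev := (cev dist).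
Notation point_sum := (point_sum dist).
Notation pr := (pr P).

Let mI (i : interval R) : measurable ([set` i] : set (measurableTypeR R)).
Proof. exact: measurable_itv. Qed.

(** The single point of [0, b] has index 0, since every lower index would also lie in [0, b]. *)
Lemma sole_count_event x (b : R) : regular dist x -> 0 < b -> count_event dist `[0, b] 1 x ->
  [/\ `]0, b]%classic (dist 0 x), interference dist x = point_sum `]b, +oo[ x &
    forall k, k != 0%N -> b < dist k x].
Proof.
move=> rx b0 /count_event1[k kb uk].
have in0 : `[0, b]%classic (dist 0 x).
  move: kb; rewrite /= !in_itv/= => /andP[_ kb]; rewrite (ltW (regular_gt0 0 rx))/=.
  by rewrite (le_trans (regular_le rx (leq0n k)) kb).
have k0 : k = 0%N by apply: contrapT => /eqP; rewrite eq_sym => /uk; exact.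
rewrite k0 in uk.
have d0 : `]0, b]%classic (dist 0 x).
  by move: in0; rewrite /= !in_itv/= => /andP[_ ->]; rewrite (regular_gt0 0 rx).
have big j : j != 0%N -> b < dist j x.
  move=> /uk; rewrite /= in_itv/= (ltW (regular_gt0 j rx))/= => /negP.
  by rewrite -ltNge.
have e0 : count_event dist `[0, 0] 0 x.
  apply: bs_count_eq0 => j; rewrite /= in_itv/= => /andP[_].
  by rewrite leNgt (regular_gt0 j rx).
have e1 : count_event dist `]0, b] 1 x.
  apply: (count_event_single (k := 0%N)) => // j /big bj.
  by rewrite /= in_itv/= leNgt bj andbF.
have [_ ii] := nearest_in_cell rx (lexx 0) b0 e0 e1.
by split => //; rewrite /interference ii.
Qed.

Lemma sole_counts_event x (a t b : R) : regular dist x -> 0 <= a -> t <= b ->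
  `]a, t]%classic (dist 0 x) -> (forall k, k != 0%N -> b < dist k x) ->
  cev (sole_counts a t b) x.
Proof.
move=> rx a0 tb d0 big; rewrite /cev !big_cons big_nil.
move: (d0); rewrite /= in_itv/= => /andP[ad dt].
split; [|split; [|split => //]].
- apply: bs_count_eq0 => k; rewrite /= in_itv/= => /andP[_ ka].
  by have := lt_le_trans ad (regular_le rx (leq0n k)); rewrite ltNge ka.
- apply: (count_event_single (k := 0%N)) => // k /big bk.
  by rewrite /= in_itv/= => /andP[_ /le_trans/(_ tb)]; rewrite leNgt bk.
- apply: bs_count_eq0 => k; rewrite /= in_itv/=.
  have [->|/big bk] := eqVneq k 0%N; first by rewrite ltNge dt.
  by move=> /andP[_]; rewrite leNgt bk.
Qed.

Let mS (b : R) : 0 <= b -> measurable_fun setT (point_sum `]b, +oo[).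
Proof. by move=> b0; apply: measurable_point_sum => //; exact: subset_oy_cy. Qed.

Let msg (b c : R) : 0 <= b -> measurable_fun setT (fun x => Num.sg (point_sum `]b, +oo[ x - c)).
Proof.
move=> b0; apply: (measurableT_comp (@measurable_fun_sg R)).
by apply: measurable_funB => //; exact: mS.
Qed.

(* When [dist 0] lies in the cell ]t j.+1, t j.+2], the value [a] forces
   [al j.+1 <= S < al j], on which the difference of signs [dsg j] is at least 1;
   the expectations of the [dsg j] telescope to at most 2. *)
Lemma pr_sole_level_le (a b e : R) n : 0 < a -> 0 < b ->
  (forall j, (j < n.+1)%N -> mass lambda (cell 0 b n.+1 j) <= e) ->
  pr (count_event dist `[0, b] 1 `&` [set x | dist 0 x * (interference dist x + eta) = a]) <= 3 * e.
Proof.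
move=> a0 b0 me; have [N [mN N0 Nr]] := null_irregular scs PI_fin.
have lebT := probability_lty P measurableT.
set t := grid 0 b n.+1.
have tS j : t j < t j.+1 by rewrite -subr_gt0 gridS subr0 divr_gt0// ltr0n.
have tge j : 0 <= t j by apply: grid_ge; exact: ltW.
have tle j : (j <= n.+1)%N -> t j <= b by move=> jn; apply: grid_le => //; exact: ltW.
have tgt j : 0 < t j.+1 by exact: le_lt_trans (tge j) (tS j).
pose al j := a / t j.+1 - eta.
pose A j := cev (sole_counts (t j) (t j.+1) b).
have mA j : (j < n.+1)%N -> measurable (A j).
  by move=> jn; apply: (measurable_cev dist (good_sole_counts scs (tge j) (tS j) (tle _ jn))).
have prA j : (j < n.+1)%N -> pr (A j) <= e.
  move=> jn; apply: (le_trans _ (me j jn)).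
  exact: (pr_sole_counts_le scs (tge j) (tS j) (tle _ jn)).
pose dsg j x := Num.sg (point_sum `]b, +oo[ x - al j.+1) - Num.sg (point_sum `]b, +oo[ x - al j).
have al_le j : al j.+1 <= al j.
  by rewrite lerD2r ler_pM2l// lef_pV2 ?posrE// ltW.
have dsg0 j x : 0 <= dsg j x by rewrite subr_ge0; apply: sg_homo; rewrite lerD2l lerN2.
have sg1 (c : R) : `|Num.sg c| <= 1 by rewrite normr_sg lern1 leq_b1.
have dsg2 j x : `|dsg j x| <= 2.
  by rewrite (le_trans (ler_normB _ _))// -[leRHS]/(1 + 1) lerD.
have mdsg j : measurable_fun setT (dsg j) by apply: measurable_funB; apply: msg; exact: ltW.
have mD : measurable (count_event dist `[0, b] 1 `&`
    [set x | dist 0 x * (interference dist x + eta) = a]).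
  apply: measurableI; first exact: (measurable_count_event dist 1 (mI _)).
  have mX : measurable_fun setT (fun x => dist 0 x * (interference dist x + eta)).
    apply: measurable_funM; first exact: measurable_dist.
    by apply: measurable_funD => //; exact: measurable_interference.
  by have := mX measurableT [set a] (measurable_set1 a); rewrite setTI.
(* The first cell has no finite upper level for S, as its left end is 0; it is accounted for by its
   probability alone. *)
pose g x := \1_(A 0%N) x + \sum_(0 <= j < n) \1_(A j.+1) x * dsg j x.
have i0 (B : set T) : measurable B -> P.-integrable setT (EFin \o \1_B).
  move=> mB; apply: (Rintegral_bounded (M := 1)) => // x _.
  by rewrite ger0_norm// indicE lern1 leq_b1.
(* Extended by 0 from [n] on, because [Rintegral_sumn] asks for integrability at every index while
   [A j] is controlled only for the cells of [0, b]. *)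
pose h j x := if (j < n)%N then \1_(A j.+1) x * dsg j x else 0.
have ih j : P.-integrable setT (EFin \o h j).
  rewrite /h; have [jn|jn] := ltnP j n; last exact: integrable0.
  apply: (Rintegral_bounded (M := 2)) => //.
    by apply: measurable_funM => //; apply: measurable_indic; exact: mA.
  move=> x _; rewrite normrM -[leRHS]mul1r ler_pM//.
  by rewrite ger0_norm// indicE lern1 leq_b1.
have gE x : g x = \1_(A 0%N) x + \sum_(0 <= j < n) h j x.
  rewrite /g; congr (_ + _); rewrite !big_nat; apply: eq_bigr => j /andP[_ jn].
  by rewrite /h jn.
have [sumE sumI] := Rintegral_sumn n measurableT ih.
apply: (le_trans (@pr_le_Rintegral _ _ _ P _ N g mD mN N0 _ _ _)).
- rewrite (funext gE).
  by apply: eq_integrable (integrableD measurableT (i0 _ (mA 0%N isT)) sumI).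
- by move=> x; rewrite /g addr_ge0//; apply: sumr_ge0 => j _; rewrite mulr_ge0.
- move=> x Nx [cx Xx]; have rx := Nr x Nx.
  have [d0 PIx big] := sole_count_event rx b0 cx.
  have [j jn cj] := cell_cover b0 (ltn0Sn n) d0.
  have Ajx : A j x by apply: sole_counts_event => //; exact: tle.
  have hge k : 0 <= \1_(A k.+1) x * dsg k x by rewrite mulr_ge0.
  case: j jn cj Ajx => [|j] jn cj Ajx.
    by rewrite /g indicE mem_set// lerDl; apply: sumr_ge0.
  rewrite /g (bigD1_seq j) ?iota_uniq ?mem_index_iota//= indicE [\1_(A j.+1) x]indicE.
  rewrite [x \in A j.+1]mem_set// mul1r.
  suff d1 : 1 <= dsg j x.
    by rewrite (le_trans d1)// addrCA lerDl addr_ge0//; apply: sumr_ge0.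
  have d00 := regular_gt0 0 rx.
  have SE : point_sum `]b, +oo[ x = a / dist 0 x - eta.
    by rewrite -PIx -Xx mulrAC divff ?gt_eqF// mul1r addrK.
  move: cj; rewrite /cell/= in_itv/= => /andP[tj jt].
  rewrite /dsg SE /al.
  have h1 : 0 <= Num.sg (a / dist 0 x - eta - (a / t j.+2 - eta)).
    by rewrite sgr_ge0 opprB addrA subrK subr_ge0 ler_pM2l// lef_pV2 ?posrE//.
  have h2 : Num.sg (a / dist 0 x - eta - (a / t j.+1 - eta)) = -1.
    apply: ltr0_sg; rewrite opprB addrA subrK subr_lt0 ltr_pM2l// ltf_pV2 ?posrE//.
  by rewrite h2 opprK lerDr.
(* One [e] for the first cell, and [e] times the telescoping sum, at most 2, for the others. *)
rewrite (_ : 3 = 1 + 2); last by ring.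
rewrite (_ : \int[P]_x g x = pr (A 0%N) + \sum_(0 <= j < n) \int[P]_x h j x); last first.
  rewrite (funext gE) RintegralD//; last exact: i0 (mA 0%N isT).
  rewrite sumE; congr (_ + _); rewrite /Rintegral integral_indic// ?setIT//.
  exact: mA.
rewrite mulrDl mul1r lerD ?prA//.
have hE j : (j < n)%N -> \int[P]_x h j x <= e * \int[P]_x dsg j x.
  move=> jn; rewrite /h jn -Rintegral_setI_indic setTI.
  rewrite [leLHS](@sign_sole_counts _ _ _ _ _ _ scs PI_fin _ _ _ _ _ (tge j.+1) (tS j.+1) (tle j.+2 jn)).
  by apply: ler_wpM2r; [apply: Rintegral_ge0 => x _; exact: (dsg0 j x)|exact: prA].
have idsg j : P.-integrable setT (EFin \o dsg j).
  by apply: (Rintegral_bounded (M := 2)).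
have [sE _] := Rintegral_sumn n measurableT idsg.
have e0 : 0 <= e by apply: le_trans (me 0%N isT); exact: (mass_cell_ge0 scs).
apply: (@le_trans _ _ (e * \sum_(0 <= j < n) \int[P]_x dsg j x)).
  rewrite mulr_sumr !big_nat; apply: ler_sum => j /andP[_ jn]; exact: hE.
rewrite mulrC ler_wpM2r// -sE.
have tel x : \sum_(0 <= j < n) dsg j x =
    Num.sg (point_sum `]b, +oo[ x - al n) - Num.sg (point_sum `]b, +oo[ x - al 0%N).
  by rewrite telescope_sumr.
rewrite (eq_Rintegral _ (fun x _ => tel x)).
apply: (le_trans (ler_norm _)); rewrite -[leRHS]mulr1.
rewrite -[X in _ <= _ * X](_ : fine (P setT) = 1); last by rewrite probability_setT.
apply: ler_norm_Rintegral_bounded => //.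
  by apply: measurable_funB; apply: msg; exact: ltW.
by move=> x _; rewrite (le_trans (ler_normB _ _))// -[leRHS]/(1 + 1) lerD.
Qed.

End atomless.

Section no_atom.
Context {R : realType} d (T : measurableType d) (P : probability T R).
Variables (lambda : R -> R) (dist : nat -> {RV P >-> R}).
Hypotheses (scs : canonical_SCS lambda dist).
Hypothesis PI_fin : {ae P, forall x, (ext_interference dist x < +oo)%E}.
Notation pr := (pr P).
Notation several := (several dist).

Let mI (i : interval R) : measurable ([set` i] : set (measurableTypeR R)).
Proof. exact: measurable_itv. Qed.

Lemma pr_negligible (A : set T) : measurable A -> pr A <= 0 -> P.-negligible A.
Proof.
move=> mA A0; apply/negligibleP => //; apply: (etrans (esym (prK P mA))); congr (_%:E).
by apply/eqP; rewrite eq_le A0 pr_ge0.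
Qed.

(** If R_1 = R_2, the cell containing them holds two points at every mesh, so the probability is at
    most the sum of the squared masses. *)
Lemma negligible_double (M : R) : 0 < M ->
  P.-negligible [set x | dist 0 x = dist 1 x /\ dist 0 x <= M].
Proof.
move=> M0; have [N [mN N0 Nr]] := null_irregular scs PI_fin.
have lebT := probability_lty P measurableT.
set E := [set x | _].
have mE : measurable E.
  have m1 : measurable_fun setT (fun x => dist 0 x == dist 1 x).
    by apply: measurable_fun_eqr; exact: measurable_dist.
  have m2 : measurable (dist 0 @^-1` `]-oo, M]).
    by rewrite -[_ @^-1` _]setTI; exact: measurable_dist.
  rewrite (_ : E = (fun x => dist 0 x == dist 1 x) @^-1` [set true] `&` dist 0 @^-1` `]-oo, M]).
    by apply: measurableI => //; rewrite -[_ @^-1` _]setTI; exact: m1.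
  apply/seteqP; split => x; rewrite /E /= in_itv/=.
    by move=> [/eqP -> ->].
  by move=> [/eqP].
apply: pr_negligible => //.
have ms n j : measurable (several (cell 0 M n j)).
  by apply: measurable_several; exact: measurable_cell.
have bound n : pr E <= \sum_(0 <= j < n.+1) mass lambda (cell 0 M n.+1 j) ^+ 2.
  have ii j : P.-integrable setT (EFin \o \1_(several (cell 0 M n.+1 j))).
    apply: (Rintegral_bounded (M := 1)) => // x _.
    by rewrite ger0_norm// indicE lern1 leq_b1.
  have [sumE sumI] := Rintegral_sumn n.+1 measurableT ii.
  apply: (le_trans (@pr_le_Rintegral _ _ _ P _ N _ mE mN N0 sumI _ _)).
  - by move=> x; apply: sumr_ge0.
  - move=> x Nx [d01 dM]; have rx := Nr x Nx.
    have [j jn cj] : exists2 j, (j < n.+1)%N & cell 0 M n.+1 j (dist 0 x).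
      by apply: cell_cover => //=; rewrite in_itv/= dM (regular_gt0 0 rx).
    rewrite (bigD1_seq j) ?iota_uniq ?mem_index_iota//= indicE mem_set.
      by rewrite lerDl; apply: sumr_ge0.
    have cj1 : cell 0 M n.+1 j (dist 1 x) by rewrite -d01.
    have ge2 := bs_count_ge2 (isT : (1 != 0)%N) cj1 cj.
    by move=> [|] h; move: ge2; rewrite h lee_fin ler_nat.
  - rewrite sumE !big_nat; apply: ler_sum => j /andP[_ jn].
    rewrite /Rintegral integral_indic// setIT.
    by apply: (pr_several_le scs); exact: (finite_mean_cell scs).
have : (fun n => \sum_(0 <= j < n.+1) mass lambda (cell 0 M n.+1 j) ^+ 2) @ \oo --> (0 : R).
  exact: (sum_mass_sqr_cvg0 scs (lexx 0) M0).
by move=> /cvgr_to_ge; apply; exact: nearW.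
Qed.

Variable eta : R.

Let X x := dist 0 x * (interference dist x + eta).

Let mX : measurable_fun setT X.
Proof.
apply: measurable_funM; first exact: measurable_dist.
by apply: measurable_funD => //; exact: measurable_interference.
Qed.

Lemma negligible_sole_level (a b : R) : 0 < a -> 0 < b ->
  P.-negligible (count_event dist `[0, b] 1 `&` [set x | X x = a]).
Proof.
move=> a0 b0; apply: pr_negligible.
  apply: measurableI; first exact: (measurable_count_event dist 1 (mI _)).
  by have := mX measurableT (measurable_set1 a); rewrite setTI.
apply/ler_addgt0Pl => e e0; rewrite addr0.
have e3 : 0 < e / 3 by rewrite divr_gt0.
have [n _ /(_ n (leqnn n)) hn] := near_mass_cells_small scs (lexx 0) b0 e3.
by rewrite (le_trans (pr_sole_level_le scs PI_fin eta a0 b0 hn))// mulrC divfK.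
Qed.

(** If R_1 < R_2, a rational q between them makes R_1 the only point of [0, q], which is the
    situation of [negligible_sole_level]; countably many q suffice, and equality R_1 = R_2 is
    negligible. *)
Lemma no_atom (a : R) : 0 < a -> P [set x | X x = a] = 0%E.
Proof.
move=> a0; have [N [mN N0 Nr]] := null_irregular scs PI_fin.
have mXa : measurable [set x | X x = a].
  by have := mX measurableT (measurable_set1 a); rewrite setTI.
apply/negligibleP => //.
(* The rationals are enumerated through [unpickle]; codes of no rational give the empty set. *)
pose F n := if unpickle n is Some q then
  [set x | 0 < ratr q :> R /\ count_event dist `[0, ratr q] 1 x /\ X x = a] else set0.
have nF n : P.-negligible (F n).
  rewrite /F; case: unpickle => [q|]; last exact: negligible_set0.
  have [q0|q0] := ltP (0 : R) (ratr q).
    by apply: (negligibleS _ (negligible_sole_level a0 q0)) => x [_ []].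
  by apply: (negligibleS _ (negligible_set0 P)) => x [].
pose E n := [set x | dist 0 x = dist 1 x /\ dist 0 x <= n.+1%:R].
have nE n : P.-negligible (E n) by apply: negligible_double; rewrite ltr0n.
have nN : P.-negligible N by apply/negligibleP.
apply: (negligibleS _ (negligibleU nN (negligibleU (negligible_bigcup nF) (negligible_bigcup nE)))).
move=> x /= Xa; have [Nx|Nx] := pselect (N x); [by left|right].
have rx := Nr x Nx; have d0 := regular_gt0 0 rx.
have := regular_le rx (leq0n 1); rewrite le_eqVlt => /predU1P[d01|d01].
  right; have [n _ hn] := nbhs_infty_ger (dist 0 x); exists n => //; split => //.
  by apply: (le_trans (hn n (leqnn n))); rewrite ler_nat.
left; have [q] := rat_in_itvoo d01; rewrite in_itv/= => /andP[dq qd].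
have q0 : 0 < ratr q :> R := lt_trans d0 dq.
exists (pickle q); [exact: I|rewrite /F pickleK; split; [exact: q0|split; last exact: Xa]].
apply: (count_event_single (k := 0%N)); first by rewrite /= in_itv/= !ltW.
move=> j j0; rewrite /= in_itv/= => /andP[_]; rewrite leNgt.
by rewrite (lt_le_trans qd)// regular_le// lt0n.
Qed.

End no_atom.

(** * Inversion on the whole line *)

Section inversion_kernel.
Context {R : realType}.

(* At [w = 0] both sides are the junk value [0]. *)
Lemma inv_imaginary (w : R) : ('i%C * w%:C)^-1 = 'i%C * (- w^-1)%:C.
Proof.
have [->|w0] := eqVneq w 0; first by rewrite invr0 oppr0 !mulr0 invr0.
apply: mulr1_eq; rewrite !mul_i_real; apply: complex_ext.
  by rewrite cReM/= mul0r mulrN divff// opprK add0r.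
by rewrite cImM/= mul0r mulr0 addr0.
Qed.

(** The real part is the kernel of [levy_inversion] for the interval from 0 to [c]; the imaginary
    part is odd in [w] and cancels on symmetric intervals. *)
Lemma inversion_kernelE (w c y : R) :
  cexp ('i%C * w%:C * y%:C) * ((1 - cexp ('i%C * (- (w * c))%:C)) * ('i%C * (- w^-1)%:C)) =
  Complex ((sin (w * (y - 0)) - sin (w * (y - c))) / w)
          ((cos (w * (y - c)) - cos (w * (y - 0))) / w).
Proof.
rewrite -['i%C * _ * _]mulrA -rmorphM.
have -> : cexp ('i%C * (w * y)%:C) = Complex (cos (w * y)) (sin (w * y)).
  by apply: complex_ext; [exact: Re_cexp_i|exact: Im_cexp_i].
have -> : cexp ('i%C * (- (w * c))%:C) = Complex (cos (w * c)) (- sin (w * c)).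
  by apply: complex_ext; [rewrite Re_cexp_i cosN|rewrite Im_cexp_i sinN].
rewrite mul_i_real !subr0 mulrBr sinB cosB.
move: (cos _) (sin _) (cos _) (sin _) (w^-1) => cy sy cc sc t.
by apply: complex_ext; rewrite /=; ring.
Qed.

Lemma ler_norm_cos_diff (y a b w : R) :
  `|(cos (w * (y - a)) - cos (w * (y - b))) / w| <= `|b - a|.
Proof.
have [->|w0] := eqVneq w 0; first by rewrite invr0 mulr0 normr0.
rewrite normrM normfV ler_pdivrMr ?normr_gt0//.
rewrite -!sinDpihalf; apply: (le_trans (ler_norm_sinB2 _ _)).
rewrite opprD addrACA subrr addr0 -mulrBr normrM mulrC (_ : y - a - (y - b) = b - a)//.
ring.
Qed.

End inversion_kernel.

Section line_integral.
Context {R : realType} d (T : measurableType d) (P : probability T R).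
Variables (X : T -> R) (c : R).
Hypothesis mX : measurable_fun setT X.
Notation mu := (@lebesgue_measure R).
Import Normc.

Let S (w : R) := \int[P]_x ((sin (w * (X x - 0)) - sin (w * (X x - c))) / w).
Let C (w : R) := \int[P]_x ((cos (w * (X x - c)) - cos (w * (X x - 0))) / w).

Lemma inversion_integrandE (w : R) :
  charfun P X w * ((1 - cexp ('i%C * (- (w * c))%:C)) / ('i%C * w%:C)) = Complex (S w) (C w).
Proof.
rewrite inv_imaginary mulrC /charfun /Cexpectation -CintegralZl//; last first.
  apply: (@Cintegrable_bounded _ _ _ _ _ _ 1) => //.
  - exact: probability_lty.
  - apply: cmeasurable_cexp.
    by apply: cmeasurableM; [exact: cmeasurable_cst|exact: cmeasurable_real].
  - by move=> x _; apply: normc_cexp_le1; rewrite Re_scaled mul_i_real mul0r.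
rewrite /Cintegral; congr (Complex _ _); apply: eq_Rintegral => x _;
  by rewrite mulrC inversion_kernelE.
Qed.

Let measurable_S : measurable_fun [set: measurableTypeR R] S.
Proof.
exact: (@measurable_fun_Rintegral _ _ (measurableTypeR R) T R P _ _ measurableT
      (measurable_sin_diff 0 c mX)).
Qed.

Let measurable_C : measurable_fun [set: measurableTypeR R] C.
Proof.
pose f (z : measurableTypeR R * T) := (cos (z.1 * (X z.2 - c)) - cos (z.1 * (X z.2 - 0))) / z.1.
apply: (@measurable_fun_Rintegral _ _ (measurableTypeR R) T R P _ f measurableT).
apply: measurable_funM; last by apply: measurableT_comp; first exact: measurable_fun_inv.
have ms b : measurable_fun setT (fun z : measurableTypeR R * T => cos (z.1 * (X z.2 - b))).
  apply: measurableT_comp; first exact: measurable_fun_cos.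
  apply: measurable_funM => //.
  by apply: measurable_funB => //; apply: (measurableT_comp mX); exact: measurable_snd.
exact: measurable_funB.
Qed.

Let PT (f : T -> R) (M : R) : measurable_fun setT f -> (forall x, `|f x| <= M) ->
  `|\int[P]_x f x| <= M.
Proof.
move=> mf fM; rewrite -[leRHS]mulr1 -[X in _ <= _ * X](_ : fine (P setT) = 1).
  by apply: ler_norm_Rintegral_bounded => //; exact: probability_lty.
by rewrite probability_setT.
Qed.

Let mcos (w b : R) : measurable_fun setT (fun x => cos (w * (X x - b))).
Proof.
apply: measurableT_comp; first exact: measurable_fun_cos.
by apply: measurable_funM => //; exact: measurable_funB.
Qed.

Let msin (w b : R) : measurable_fun setT (fun x => sin (w * (X x - b))).
Proof.
apply: measurableT_comp; first exact: measurable_fun_sin.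
by apply: measurable_funM => //; exact: measurable_funB.
Qed.

Let S_le w : `|S w| <= `|c - 0|.
Proof.
apply: PT; last by move=> x; exact: ler_norm_sin_diff.
by apply: measurable_funM => //; exact: measurable_funB.
Qed.

Let C_le w : `|C w| <= `|0 - c|.
Proof.
apply: PT; last by move=> x; exact: ler_norm_cos_diff.
by apply: measurable_funM => //; exact: measurable_funB.
Qed.

Let S_even w : S (- w) = S w.
Proof.
by apply: eq_Rintegral => x _; rewrite !mulNr !sinN invrN mulrN -mulNr opprB addrC opprK.
Qed.

Let C_odd w : C (- w) = - C w.
Proof.
rewrite -[RHS]mulN1r -RintegralZl//.
  by apply: eq_Rintegral => x _; rewrite !mulNr !cosN invrN mulrN mul1r.
apply: (Rintegral_bounded (M := `|0 - c|)) => //; first exact: probability_lty.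
  by apply: measurable_funM => //; exact: measurable_funB.
by move=> x _; exact: ler_norm_cos_diff.
Qed.

Lemma integral_C_itv (A : R) : 0 <= A -> \int[mu]_(w in `[- A, A]) C w = 0.
Proof.
move=> A0; rewrite (Rintegral_itv_sym A0 measurable_C C_le).
rewrite /Rintegral integral0_eq// => w _; by rewrite C_odd subrr.
Qed.

Lemma integral_S_itv (A : R) : 0 <= A ->
  \int[mu]_(w in `[- A, A]) S w = 2 * \int[mu]_(w in `[0, A]) S w.
Proof.
move=> A0; rewrite (Rintegral_itv_sym A0 measurable_S S_le).
rewrite -[RHS]RintegralZl; [|exact: measurable_itv|].
  by apply: eq_Rintegral => w _; rewrite S_even mulr_natl.
apply: (Rintegral_bounded (M := `|c - 0|)) => //; first exact: lebesgue_measure_itvcc_lty.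
exact: measurable_funTS.
Qed.

(** The factor 1/2 in front of the signs is (2 pi)^-1 from the normalization, times 2 from folding
    [-A, A] onto [0, A], times the Dirichlet limit pi / 2. *)
Lemma line_integral (f : R -> R[i]) (l : R) :
  (forall w, f w = Complex ((2 * pi)^-1 * S w) ((2 * pi)^-1 * C w)) ->
  l = 2^-1 * \int[P]_x (Num.sg (X x - 0) - Num.sg (X x - c)) ->
  is_Cintegral_line f l%:C.
Proof.
move=> fE lE; have ip (g : R -> R) (A M : R) : measurable_fun [set: measurableTypeR R] g ->
    (forall w, `|g w| <= M) -> mu.-integrable `[- A, A] (EFin \o g).
  move=> mg gM; apply: (Rintegral_bounded (M := M)) => //; first exact: lebesgue_measure_itvcc_lty.
  exact: measurable_funTS.
have cS : \int[mu]_(w in `[0, A]) S w @[A --> +oo] -->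
    pi / 2 * \int[P]_x (Num.sg (X x - 0) - Num.sg (X x - c)).
  by apply/cvg_pinftyP => u uoo; exact: (@levy_inversion _ _ _ P X setT 0 c u mX measurableT uoo).
have c2 : pi^-1 * \int[mu]_(w in `[0, A]) S w @[A --> +oo] --> l.
  rewrite lE (_ : 2^-1 * _ = pi^-1 * (pi / 2 * \int[P]_x (Num.sg (X x - 0) - Num.sg (X x - c)))).
    by apply: cvgM => //; exact: cvg_cst.
  by rewrite !mulrA mulVf ?mul1r// gt_eqF// pi_gt0.
have IE A : 0 <= A -> Cintegral mu `[- A, A] f = (pi^-1 * \int[mu]_(w in `[0, A]) S w)%:C.
  move=> A0; apply: complex_ext.
    transitivity (\int[mu]_(w in `[- A, A]) ((2 * pi)^-1 * S w)).
      by apply: eq_Rintegral => w _; rewrite fE.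
    rewrite RintegralZl//; last exact: ip measurable_S S_le.
    rewrite (integral_S_itv A0) mulrA; congr (_ * _).
    by rewrite invfM mulrAC mulVf ?mul1r// pnatr_eq0.
  transitivity (\int[mu]_(w in `[- A, A]) ((2 * pi)^-1 * C w)).
    by apply: eq_Rintegral => w _; rewrite fE.
  rewrite RintegralZl//; last exact: ip measurable_C C_le.
  by rewrite integral_C_itv// mulr0.
rewrite /is_Cintegral_line.
apply/(@cvgrPdist_le R[i] R[i]^o _ _ _ (fun A => Cintegral mu `[- A, A] f : R[i]^o)) => e e0.
(* In the order of [R[i]], a positive number is real, so the complex convergence reduces to the real
   one. *)
have eE : e = (complex.Re e)%:C.
  by apply: complex_ext => //; move: e0; rewrite ltcE => /andP[/eqP ->].
have e0' : 0 < complex.Re e by move: e0; rewrite eE ltcR.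
have /cvgrPdist_le/(_ _ e0') := c2.
move=> h; near=> A.
have A0 : 0 <= A by near: A; apply: nbhs_pinfty_ge; exact: num_real.
rewrite IE// -rmorphB eE -[leLHS]/((normc _)%:C) normc_real lecR.
by near: A.
Unshelve. all: by end_near. Qed.

End line_integral.

Section sinr_tail.
Context {R : realType} d (T : measurableType d) (P : probability T R).
Variables (lambda : R -> R) (dist : nat -> {RV P >-> R}) (eta : R).
Hypotheses (scs : canonical_SCS lambda dist).
Hypothesis eta_ge0 : 0 <= eta.
Hypothesis PI_fin : {ae P, forall x, (ext_interference dist x < +oo)%E}.

Lemma regular_SINR_gt0 x : regular dist x -> 0 < SINR eta dist x.
Proof.
move=> rx; rewrite /SINR divr_gt0// ?invr_gt0 ?(regular_gt0 0 rx)//.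
by rewrite ltr_pwDl// regular_interference_gt0.
Qed.

Let measurable_tail (g : R) : measurable [set x | g < SINR eta dist x].
Proof.
have := measurable_SINR dist eta measurableT (measurable_itv `]g, +oo[).
rewrite setTI (_ : _ @^-1` _ = [set x | g < SINR eta dist x])//.
by apply/seteqP; split => x /=; rewrite in_itv/= andbT.
Qed.

Lemma probability_SINR_gt0 : P [set x | 0 < SINR eta dist x] = 1%E.
Proof.
have [N [mN N0 Nr]] := null_irregular scs PI_fin.
apply/eqP; rewrite eq_le probability_le1//=.
have mD := measurable_tail 0; set D := [set x | _] in mD *.
have mU : measurable (D `|` N) by exact: measurableU.
have h : (P setT <= P (D `|` N))%E.
  apply: le_measure; rewrite ?inE// => x _.
  by have [Nx|/Nr rx] := pselect (N x); [right|left; exact: regular_SINR_gt0].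
rewrite probability_setT in h; apply: (le_trans h).
have := measureU2 P mD mN.
by rewrite [X in (_ <= _ + X)%E](_ : _ = 0%E) ?adde0.
Qed.

(** Half the difference of the signs of X and X - 1/g is the indicator of 0 < X < 1/g, except at X =
    1/g, which has probability 0 by [no_atom]; for X = 1/SINR this is the event that the SINR
    exceeds g. *)
Lemma SINR_tail_inversion (g : R) : 0 < g ->
  is_Cintegral_line
    (fun w => charfun P (fun x => (SINR eta dist x)^-1) w *
      ((1 - cexp (- ('i%C * w%:C / g%:C))) / ('i%C * w%:C)) / (2 * pi)%:C)
    (fine (P [set x | g < SINR eta dist x]))%:C.
Proof.
move=> g0; set X := fun x => (SINR eta dist x)^-1.
have mX : measurable_fun setT X.
  by apply: measurableT_comp; [exact: measurable_fun_inv|exact: measurable_SINR].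
apply: (line_integral (P := P) (X := X) (c := g^-1) mX).
  move=> w; have -> : - ('i%C * w%:C / g%:C) = 'i%C * (- (w * g^-1))%:C :> R[i].
    by rewrite inv_real rmorphN mulrN rmorphM mulrA.
  rewrite inversion_integrandE// inv_real mulrC.
  by apply: complex_ext; rewrite ?cReM ?cImM/= mul0r ?subr0 ?addr0.
have [N [mN N0 Nr]] := null_irregular scs PI_fin.
have ig0 : 0 < g^-1 by rewrite invr_gt0.
have nA := no_atom scs PI_fin eta ig0.
have EX : [set x | dist 0%N x * (interference dist x + eta) = g^-1] = [set x | X x = g^-1].
  by apply/seteqP; split => x /=; rewrite /X invSINR.
rewrite EX in nA.
have mA : measurable [set x | X x = g^-1].
  by have := mX measurableT _ (measurable_set1 g^-1); rewrite setTI.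
have mNA : measurable (N `|` [set x | X x = g^-1]) by exact: measurableU.
have NA0 : P (N `|` [set x | X x = g^-1]) = 0%E.
  apply/eqP; rewrite eq_le measure_ge0 andbT.
  have := measureU2 P mN mA; rewrite [X in (_ <= X + _)%E](_ : _ = 0%E)//.
  by rewrite [X in (_ <= _ + X)%E](_ : _ = 0%E) ?adde0.
have msg b : measurable_fun setT (fun x => Num.sg (X x - b)).
  apply: (measurableT_comp (@measurable_fun_sg R)).
  exact: measurable_funB.
have isg : P.-integrable setT (EFin \o (fun x => Num.sg (X x - 0) - Num.sg (X x - g^-1))).
  apply: (Rintegral_bounded (M := 2)) => //; first exact: probability_lty.
    exact: measurable_funB.
  move=> x _; have sg1 (c : R) : `|Num.sg c| <= 1 by rewrite normr_sg lern1 leq_b1.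
  by rewrite (le_trans (ler_normB _ _))// -[2]/(1 + 1) lerD.
rewrite -RintegralZl//.
transitivity (\int[P]_x \1_[set x | g < SINR eta dist x] x).
  by rewrite /Rintegral integral_indic// setIT.
congr fine; apply: (eq_integral_off_null mNA NA0) => x /not_orP[/Nr rx Xg].
have s0 := regular_SINR_gt0 rx.
have X0 : 0 < X x by rewrite invr_gt0.
congr (_%:E); rewrite subr0 (gtr0_sg X0) indicE.
have [gs|gs] := ltP g (SINR eta dist x).
  rewrite mem_set// ltr0_sg; last by rewrite subr_lt0 ltf_pV2 ?posrE.
  by rewrite opprK -[1 + 1]/(2 : R) mulVf// pnatr_eq0.
rewrite memNset//=; last by apply/negP; rewrite -leNgt.
rewrite gtr0_sg ?subrr ?mulr0// subr_gt0 lt_neqAle lef_pV2 ?posrE// gs andbT.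
by apply/eqP => e; apply: Xg; rewrite /X /= e.
Qed.

(** The scaled exponent is identified with [char_given] only where R_1 > 0, that is off a null set;
    [Cintegral_off_null] then needs no measurability of the new integrand. *)
Lemma charfun_invSINR_exponent (w : R) :
  charfun P (fun x => (SINR eta dist x)^-1) w =
  Cexpectation P (fun x =>
    cexp ('i%C * w%:C * eta%:C * (dist 0%N x)%:C) *
    cexp ((dist 0%N x)%:C * Cintegral lebesgue_measure `[1, +oo[
      (fun u => (cexp ('i%C * w%:C / u%:C) - 1) * (lambda (u * dist 0%N x))%:C))).
Proof.
have [N [mN N0 Nr]] := null_irregular scs PI_fin.
rewrite (charfun_invSINR scs PI_fin); apply: (Cintegral_off_null mN N0) => x /Nr rx.
rewrite /char_given -(tail_exponent_scale scs PI_fin w (regular_gt0 0 rx)).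
by congr (cexp _ * _); rewrite !rmorphM !mulrA mulrAC.
Qed.

End sinr_tail.

Theorem theorem3 (R : realType) (d : measure_display) (T : measurableType d)
    (P : probability T R) (lambda : R -> R) (dist : nat -> {RV P >-> R})
    (eta : R)
    (scs : canonical_SCS lambda dist)
    (eta_ge0 : 0 <= eta)
    (PI_fin : {ae P, forall x, (ext_interference dist x < +oo)%E}) :
  let R1 := dist 0%N in
  let Phi := charfun P (fun x => (SINR eta dist x)^-1) in
  [/\ (forall gamma : R, 0 < gamma ->
         is_Cintegral_line
           (fun w => Phi w * ((1 - cexp (- ('i%C * w%:C / gamma%:C))) /
                              ('i%C * w%:C)) / (2 * pi)%:C)
           (fine (P [set x | gamma < SINR eta dist x]))%:C),
      P [set x | 0 < SINR eta dist x] = 1%E,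
      (forall k : R.-pker (measurableTypeR R) ~> (measurableTypeR R),
         conditional_law P (interference dist) R1 k ->
         forall w : R,
           Phi w = Cexpectation P (fun x =>
             cexp ('i%C * w%:C * eta%:C * (R1 x)%:C) *
             cond_charfun k (w * R1 x) (R1 x))),
      (forall w : R,
         Phi w = Cexpectation P (fun x =>
           cexp ('i%C * w%:C * eta%:C * (R1 x)%:C) *
           cexp ((R1 x)%:C *
             Cintegral lebesgue_measure `[1, +oo[
               (fun u => (cexp ('i%C * w%:C / u%:C) - 1) *
                         (lambda (u * R1 x))%:C)))) &
      has_density R1 (nearest_pdf lambda)].
Proof.
split.
- by move=> gamma g0; apply: (SINR_tail_inversion scs eta_ge0 PI_fin g0).
- exact: (probability_SINR_gt0 scs eta_ge0 PI_fin).
- by move=> k kP w; apply: (charfun_invSINR_cond scs PI_fin).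
- by move=> w; apply: (charfun_invSINR_exponent eta scs PI_fin).
- exact: (nearest_has_density scs PI_fin).
Qed.
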